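(* Let $A$ and $\mathcal{D}$ be unital $C^*$-algebras, with $\mathcal{D}$ separable, strongly self-absorbing and $K_1$-injective. Then any two unital $*$-homomorphisms $\sigma,\gamma:\mathcal{D}\to A\otimes\mathcal{D}$ are strongly asymptotically unitarily equivalent. In particular, any two unital endomorphisms of $\mathcal{D}$ are strongly asymptotically unitarily equivalent.
   Context: Let $B$ be a unital $C^*$-algebra; $\mathcal{U}(B)$ denotes its unitary group and $\mathcal{U}_0(B)$ the connected component of $\mathbf{1}_B$ in $\mathcal{U}(B)$ (norm topology). Two $*$-homomorphisms $\sigma,\gamma:C\to B$ are approximately unitarily equivalent, $\sigma\approx_{\mathrm{u}}\gamma$, if there is a sequence $(u_n)_{n\in\mathbb{N}}$ of unitaries in $B$ with $\|u_n\sigma(c)u_n^*-\gamma(c)\|\to 0$ as $n\to\infty$ for every $c\in C$. They are strongly asymptotically unitarily equivalent if there is a norm-continuous path $(u_t)_{t\in[0,\infty)}$ of unitaries in $B$ with $u_0=\mathbf{1}_B$ (hence $u_t\in\mathcal{U}_0(B)$ for all $t$) and $\|u_t\sigma(c)u_t^*-\gamma(c)\|\to 0$ as $t\to\infty$ for every $c\in C$. A separable unital $C^*$-algebra $\mathcal{D}$ is strongly self-absorbing if $\mathcal{D}\neq\mathbb{C}$ and there is an isomorphism $\varphi:\mathcal{D}\to\mathcal{D}\otimes\mathcal{D}$ such that $\varphi\approx_{\mathrm{u}}\mathrm{id}_{\mathcal{D}}\otimes\mathbf{1}_{\mathcal{D}}$, where $\mathrm{id}_{\mathcal{D}}\otimes\mathbf{1}_{\mathcal{D}}$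 is the map $d\mapsto d\otimes\mathbf{1}_{\mathcal{D}}$. Strongly self-absorbing $C^*$-algebras are known to be simple and nuclear, so $C^*$-tensor products with $\mathcal{D}$ are unambiguous. A unital $C^*$-algebra $\mathcal{D}$ is $K_1$-injective if the canonical map $\mathcal{U}(\mathcal{D})/\mathcal{U}_0(\mathcal{D})\to K_1(\mathcal{D})$ is injective. *)

(* Defs.v *)
From HB Require Import structures.
From mathcomp Require Import all_boot all_order all_algebra.
From mathcomp Require Import complex.
From mathcomp Require Import all_classical all_reals all_analysis.

Set Implicit Arguments.
Unset Strict Implicit.
Unset Printing Implicit Defensive.

Import Order.TTheory GRing.Theory Num.Theory.
Import numFieldNormedType.Exports.

Local Open Scope classical_set_scope.
Local Open Scope ring_scope.
Local Open Scope complex_scope.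

(* A unital complex C*-algebra, as a Banach space over [R[i]] with extra
   operations.  The ring structure is attached to the carrier below instead of
   being inherited here, because the library has no join of rings and normed
   modules.  As for every normed module over [R[i]], norms live in [R[i]]. *)
HB.mixin Record isCStarAlgebra (R : realType) A
    & CompleteNormedModule R[i] A := {
  cs_one : A ;
  cs_mul : A -> A -> A ;
  star : A -> A ;
  cs_mulA : associative cs_mul ;
  cs_mul1l : left_id cs_one cs_mul ;
  cs_mul1r : right_id cs_one cs_mul ;
  cs_mulDl : left_distributive cs_mul +%R ;
  cs_mulDr : right_distributive cs_mul +%R ;
  cs_scaleAl : forall (c : R[i]) (x y : A),
    c *: cs_mul x y = cs_mul (c *: x) y ;
  cs_scaleAr : forall (c : R[i]) (x y : A),
    c *: cs_mul x y = cs_mul x (c *: y) ;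
  starK : involutive star ;
  starD : {morph star : x y / x + y} ;
  starZ : forall (c : R[i]) (x : A), star (c *: x) = Num.conj c *: star x ;
  starM : forall x y : A, star (cs_mul x y) = cs_mul (star y) (star x) ;
  cs_normM : forall x y : A, `|cs_mul x y| <= `|x| * `|y| ;
  cs_normC : forall x : A, `|cs_mul (star x) x| = `|x| ^+ 2
}.

#[short(type="cstarAlgType")]
HB.structure Definition CStarAlgebra (R : realType) :=
  {A of CompleteNormedModule R[i] A & isCStarAlgebra R A}.

HB.instance Definition _ (R : realType) (A : cstarAlgType R) :=
  GRing.Zmodule_isPzRing.Build A (@cs_mulA R A) (@cs_mul1l R A) (@cs_mul1r R A)
    (@cs_mulDl R A) (@cs_mulDr R A).

Section Homomorphisms.
Context {R : realType}.
Implicit Types A B C D : cstarAlgType R.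

Definition unital_starhom A B (f : A -> B) : Prop :=
  [/\ linear f, monoid_morphism f & {morph f : x / star x}].

Definition unital_stariso A B (f : A -> B) : Prop :=
  unital_starhom f /\ bijective f.

Definition unitary A : set A := [set u | star u * u = 1 /\ u * star u = 1].

Definition unitary0 A : set A := connected_component (@unitary A) 1.

Definition approx_unitary_equiv C B (s g : C -> B) : Prop :=
  exists u : nat -> B, (forall n, unitary (u n)) /\
    forall c, u n * s c * star (u n) @[n --> \oo] --> g c.

Definition strong_asymp_unitary_equiv C B (s g : C -> B) : Prop :=
  exists u : R -> B,
    [/\ {within `[0, +oo[, continuous u},
        forall t, 0 <= t -> unitary (u t),
        u 0 = 1 &
        forall c, u t * s c * star (u t) @[t --> +oo] --> g c].

Definition separable_space (T : topologicalType) : Prop :=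
  exists S : set T, countable S /\ dense S.

End Homomorphisms.

Section TensorProducts.
Context {R : realType}.
Implicit Types A D T : cstarAlgType R.

(* The image in T of the element \sum_k a_k (x) d_k of the algebraic tensor
   product, given by the list of pairs (a_k, d_k). *)
Definition tensor_eval A D T (iA : A -> T) (iD : D -> T) (s : seq (A * D)) : T :=
  \sum_(p <- s) iA p.1 * iD p.2.

(* \sum_k a_k (x) d_k = 0 in the algebraic tensor product, expressed by its
   universal property. *)
Definition tensor_null A D (s : seq (A * D)) : Prop :=
  forall (V : lmodType R[i]) (b : {bilinear A -> D -> V}),
    \sum_(p <- s) b p.1 p.2 = 0.

(* T, with iA = (a |-> a (x) 1) and iD = (d |-> 1 (x) d), is the completion of
   the algebraic tensor product of A and D for some C*-norm. *)
Definition cstar_tensor A D T (iA : A -> T) (iD : D -> T) : Prop :=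
  [/\ unital_starhom iA /\ unital_starhom iD,
      forall a d, iA a * iD d = iD d * iA a,
      forall s, tensor_eval iA iD s = 0 -> tensor_null s &
      dense (range (tensor_eval iA iD))].

(* The minimal tensor product: the C*-norm is the least one.  It is the
   only C*-tensor product as soon as A or D is nuclear. *)
Definition min_tensor A D T (iA : A -> T) (iD : D -> T) : Prop :=
  cstar_tensor iA iD /\
  forall (T' : cstarAlgType R) (jA : A -> T') (jD : D -> T'),
    cstar_tensor jA jD ->
    forall s, `|tensor_eval iA iD s| <= `|tensor_eval jA jD s|.

(* [D <> C] is expressed through c |-> c 1, the only unital *-homomorphism
   from C to D. *)
Definition strongly_self_absorbing D : Prop :=
  [/\ separable_space D,
      ~ bijective (fun c : R[i] => c *: (1 : D)) &
      exists (DD : cstarAlgType R) (i1 i2 : D -> DD) (phi : D -> DD),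
        [/\ min_tensor i1 i2, unital_stariso phi & approx_unitary_equiv phi i1]].

End TensorProducts.

Section K1.
Context {R : realType}.
Variable A : cstarAlgType R.

Definition star_mx n (u : 'M[A]_n) : 'M[A]_n := (map_mx (@star R A) u)^T.

Definition unitary_mx n : set 'M[A]_n :=
  [set u | star_mx u *m u = 1%:M /\ u *m star_mx u = 1%:M].

(* The topology of ['M[A]_n] is entrywise convergence, which is the topology
   of the C*-norm of M_n(A). *)
Definition unitary0_mx n : set 'M[A]_n :=
  connected_component (@unitary_mx n) 1%:M.

(* diag(u, 1_k) *)
Definition stab_mx n (k : nat) (u : 'M[A]_n) : 'M[A]_(n + k) :=
  block_mx u 0 0 1%:M.

(* K_1(A) is the inductive limit of the groups U_n(A) / U_n(A)_0 along the maps
   u |-> diag(u, 1): the relation [K1_eq] says that u and v agree in the limit,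
   and [K1_class u] is the corresponding element of K_1(A). *)
Definition K1_eq m n (u : 'M[A]_m) (v : 'M[A]_n) : Prop :=
  exists (k l : nat) (e : (m + k = n + l)%N),
    unitary0_mx
      (castmx (e, e) (stab_mx k u) *m star_mx (stab_mx l v)).

Definition K1_class m (u : 'M[A]_m) : set {n : nat & 'M[A]_n} :=
  [set w | unitary_mx (tagged w) /\ K1_eq u (tagged w)].

Definition unitary0_coset (u : A) : set A := [set u * w | w in @unitary0 R A].

Definition K1_injective : Prop :=
  forall u v : A, unitary u -> unitary v ->
    K1_class (u%:M : 'M[A]_1) = K1_class (v%:M : 'M[A]_1) ->
    unitary0_coset u = unitary0_coset v.

End K1.

(* Main.v *)
(* For D strongly self-absorbing, call B absorbing when it has an endomorphism
   lam, approximately unitarily equivalent to the identity, and a unital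
   homomorphism mu : D -> B whose range commutes with lam(B); D and A (x) D are
   absorbing.  The half flip of D (x) D is implemented approximately by unitaries
   u, and also by u w^* with w = 1 (x) psi(u), psi : D (x) D -> D an isomorphism.
   As u w^* is close to a commutator, K1-injectivity puts it in the path component
   of 1.  The homomorphism (lam sigma) (x) mu carries these unitaries into B, so
   that any sigma, gamma : D -> B are both equivalent to mu and thus to each other,
   through unitaries connected to 1.  If x is joined to 1 by a path x_t and almost
   commutes with gamma(D), then U^* lam(x_t) U, where U flips lam gamma to mu, is a
   path almost commuting with gamma(D); this joins successive unitaries of an
   approximate equivalence into one asymptotic path.

   That (lam sigma) (x) mu is bounded for the minimal norm is the nuclearity of D
   (Effros-Rosenberg): slicing the half flip by a state yields finite-rank
   completely positive approximations of the identity of D.  Since the tensor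
   product is only known through the minimality of its norm, a state with
   bounded slices is produced by averaging, d |-> sum x_i^* d x_i, which can be
   pushed to the scalars because D is simple. *)
Require Import Defs.
From mathcomp Require Import all_boot all_order all_algebra.
From mathcomp Require Import all_classical all_reals all_analysis.
From HB Require Import structures.
From mathcomp Require Import complex ring lra zify.

Set Implicit Arguments.
Unset Strict Implicit.
Unset Printing Implicit Defensive.

Import Order.TTheory GRing.Theory Num.Theory.
Import numFieldNormedType.Exports.

Local Open Scope classical_set_scope.
Local Open Scope ring_scope.
Local Open Scope complex_scope.

(** * Identities in noncommutative rings *)

(** Minimality of the norm of D (x) D compares it with other norms on the same algebraic tensor
    product. This yields the flip, and an automorphism tensored with the identity, but no map into
    another algebra. Bounding f (x) g there calls for a state realised by averages, and averages act
    on the target only through a homomorphism k of D that commutes with both f and g. Room for k is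
    made by replacing g with g lam and taking k = g mu; lam is removed at the end, being a limit of
    conjugations. The averages are bounded only up to a factor 2; positivity of the approximants,
    whose value at 1 tends to 1, brings the constant back to 1. No spectral theory enters:
    positivity is a norm inequality, square roots are limits of a fixed point iteration, and
    positivity of [star x * x] comes from the growth of powers. *)

Inductive nexp :=
  | NVar of nat | NZero | NOne | NAdd of nexp & nexp | NOpp of nexp
  | NMul of nexp & nexp.

(* An expression is normalized to a pair of lists of words, of positive and of
   negative sign; [wsort cs] moves the letters of [cs], which commute with all
   the others, to the front of a word. *)
Fixpoint nnorm (e : nexp) : seq (seq nat) * seq (seq nat) :=
  match e with
  | NVar i => ([:: [:: i]], [::])
  | NZero => ([::], [::])
  | NOne => ([:: [::]], [::])
  | NAdd e f => ((nnorm e).1 ++ (nnorm f).1, (nnorm e).2 ++ (nnorm f).2)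
  | NOpp e => ((nnorm e).2, (nnorm e).1)
  | NMul e f =>
    let a := nnorm e in let b := nnorm f in
    ([seq v ++ w | v <- a.1, w <- b.1] ++ [seq v ++ w | v <- a.2, w <- b.2],
     [seq v ++ w | v <- a.1, w <- b.2] ++ [seq v ++ w | v <- a.2, w <- b.1])
  end.

Definition wsort (cs : seq nat) (w : seq nat) : seq nat :=
  sort leq [seq i <- w | i \in cs] ++ [seq i <- w | i \notin cs].

(** Negative words change sides, so that an equality of signed sums becomes an equality of multisets
    and cancellation needs no search. *)
Definition ncheck (cs : seq nat) (e f : nexp) : bool :=
  let a := nnorm e in let b := nnorm f in
  perm_eq [seq wsort cs w | w <- a.1 ++ b.2] [seq wsort cs w | w <- b.1 ++ a.2].

Section NcRing.
Context {A : pzRingType}.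
Implicit Types (env : seq A) (e f : nexp).

Fixpoint neval env e : A :=
  match e with
  | NVar i => env`_i
  | NZero => 0
  | NOne => 1
  | NAdd e f => neval env e + neval env f
  | NOpp e => - neval env e
  | NMul e f => neval env e * neval env f
  end.

Fixpoint comm_with (x : A) env : Prop :=
  if env is y :: env' then x * y = y * x /\ comm_with x env' else True.

Fixpoint comm_letters env (cs : seq nat) : Prop :=
  if cs is i :: cs' then comm_with env`_i env /\ comm_letters env cs' else True.

Let wval env (w : seq nat) : A := \prod_(i <- w) env`_i.
Let lval env (s : seq (seq nat)) : A := \sum_(w <- s) wval env w.

Lemma lval_pairs env s t :
  lval env [seq v ++ w | v <- s, w <- t] = lval env s * lval env t.
Proof.
rewrite /lval big_allpairs_dep big_distrlr /=.
by apply: eq_bigr => v _; apply: eq_bigr => w _; rewrite /wval big_cat.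
Qed.

Lemma nnormP env e :
  neval env e = lval env (nnorm e).1 - lval env (nnorm e).2.
Proof.
have nil : lval env [::] = 0 by rewrite /lval big_nil.
have cat s t : lval env (s ++ t) = lval env s + lval env t.
  by rewrite /lval big_cat.
elim: e => [i||| e IHe f IHf| e IHe| e IHe f IHf] /=.
- by rewrite nil subr0 /lval /wval !big_seq1.
- by rewrite nil subr0.
- by rewrite nil subr0 /lval big_seq1 /wval big_nil.
- by rewrite IHe IHf !cat opprD addrACA.
- by rewrite IHe opprB.
- by rewrite IHe IHf !cat !lval_pairs mulrBl !mulrBr opprB opprD [RHS]addrACA.
Qed.

Lemma comm_withP x env i : comm_with x env -> x * env`_i = env`_i * x.
Proof.
elim: env i => [|y env IH] i /=; first by move=> _; rewrite nth_nil mulr0 mul0r.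
case: i => [|i] [xy xe]; first exact: xy.
exact: IH.
Qed.

Lemma wsortP env cs w : comm_letters env cs -> wval env (wsort cs w) = wval env w.
Proof.
move=> cc; have comm i j : i \in cs -> env`_i * env`_j = env`_j * env`_i.
  elim: cs cc => // k cs IH [kc cc]; rewrite inE => /orP[/eqP ->|/(IH cc)//].
  exact: comm_withP.
have push i u : i \in cs -> env`_i * wval env u = wval env u * env`_i.
  move=> ic; elim: u => [|j u IH]; first by rewrite /wval big_nil mulr1 mul1r.
  by rewrite /wval big_cons mulrA comm // -mulrA -/(wval env u) IH mulrA.
have perm u v : perm_eq u v -> all (mem cs) u -> wval env u = wval env v.
  elim: u v => [|i u IH] v uv; first by rewrite perm_sym in uv; move/perm_nilP: uv => ->.
  case/andP=> ic uc; have iv : i \in v by rewrite -(perm_mem uv) inE eqxx.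
  have [v1 [v2 ev]] : exists v1 v2, v = v1 ++ i :: v2.
    by move: iv => /splitPr[v1 v2]; exists v1, v2.
  have uv' : perm_eq u (v1 ++ v2).
    rewrite -(perm_cons i); apply: (perm_trans uv).
    by rewrite ev perm_sym -cat_cons -[in X in perm_eq X _](cat1s i v1) -catA perm_catCA.
  rewrite {1}/wval big_cons -/(wval env u) (IH _ uv' uc) ev.
  rewrite /wval !big_cat big_cons /= !mulrA; congr (_ * _).
  exact: push.
have split u : wval env ([seq i <- u | i \in cs] ++ [seq i <- u | i \notin cs])
    = wval env u.
  elim: u => [//|i u IH] /=; case: ifPn => ic /=.
    by rewrite /wval !big_cons -!/(wval env _) IH.
  have -> : wval env (i :: u) = env`_i * wval env u by rewrite /wval big_cons.
  rewrite -IH /wval !big_cat big_cons /= !mulrA.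
  congr (_ * _); elim: [seq i <- u | i \in cs] (filter_all (mem cs) u) => [_|j v IHv].
    by rewrite big_nil mulr1 mul1r.
  by case/andP=> jc vc; rewrite big_cons -mulrA (IHv vc) !mulrA (comm j).
rewrite /wsort -[RHS]split /wval !big_cat; congr (_ * _).
apply: perm; first by rewrite perm_sort.
by rewrite all_sort filter_all.
Qed.

Lemma ncheckP env cs e f : comm_letters env cs -> ncheck cs e f ->
  neval env e = neval env f.
Proof.
move=> cc; rewrite /ncheck => pe.
have := @perm_big A +%R 0 _ _ _ xpredT (wval env) pe.
rewrite !big_map !big_cat /=.
have srt s : \sum_(w <- s) wval env (wsort cs w) = lval env s.
  by apply: eq_bigr => w _; rewrite wsortP.
rewrite !srt => E; rewrite !nnormP; apply/eqP.
by rewrite subr_eq addrAC eq_sym subr_eq -E addrC.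
Qed.

End NcRing.

(* Atoms are compared up to conversion, as the same constant may occur through
   different instance paths. *)
Ltac nc_mem x l :=
  match l with
  | nil => constr:(false)
  | x :: _ => constr:(true)
  | ?y :: _ => let _ := constr:(erefl x : x = y) in constr:(true)
  | _ :: ?l' => nc_mem x l'
  end.
Ltac nc_index x l :=
  match l with
  | x :: _ => constr:(0%N)
  | ?y :: _ => let _ := constr:(erefl x : x = y) in constr:(0%N)
  | _ :: ?l' => let n := nc_index x l' in constr:(S n)
  end.
Ltac nc_insert T x l :=
  lazymatch nc_mem x l with true => l | false => constr:(@cons T x l) end.
Ltac nc_atoms T t l :=
  lazymatch t with
  | @GRing.zero _ => l
  | @GRing.one _ => l
  | @GRing.add _ ?a ?b => let l' := nc_atoms T a l in nc_atoms T b l'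
  | @GRing.opp _ ?a => nc_atoms T a l
  | @GRing.mul _ ?a ?b => let l' := nc_atoms T a l in nc_atoms T b l'
  | _ => nc_insert T t l
  end.
Ltac nc_reify t l :=
  lazymatch t with
  | @GRing.zero _ => constr:(NZero)
  | @GRing.one _ => constr:(NOne)
  | @GRing.add _ ?a ?b =>
    let a' := nc_reify a l in let b' := nc_reify b l in constr:(NAdd a' b')
  | @GRing.opp _ ?a => let a' := nc_reify a l in constr:(NOpp a')
  | @GRing.mul _ ?a ?b =>
    let a' := nc_reify a l in let b' := nc_reify b l in constr:(NMul a' b')
  | _ => let n := nc_index t l in constr:(NVar n)
  end.
Ltac nc_indices cs l :=
  lazymatch cs with
  | nil => constr:(@nil nat)
  | ?x :: ?cs' => let n := nc_index x l in let ns := nc_indices cs' l in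
      constr:(@cons nat n ns)
  end.

(* [ncring_with cs] proves an identity in a noncommutative ring, where the
   elements of the list [cs] commute with all the atoms by hypothesis. *)
Ltac ncring_with cs :=
  rewrite ?expr2;
  lazymatch goal with
  | |- @eq ?T ?a ?b =>
    let l := nc_atoms T a (@nil T) in
    let l := nc_atoms T b l in
    let e := nc_reify a l in
    let f := nc_reify b l in
    let ns := nc_indices cs l in
    change (neval l e = neval l f);
    apply: (@ncheckP _ l ns e f);
    [ rewrite /=; repeat split; try solve [ exact: erefl | assumption | symmetry; assumption ]
    | vm_compute; reflexivity ]
  end.
Ltac ncring :=
  lazymatch goal with |- @eq ?T _ _ => ncring_with (@nil T) end.

(** * Norms and limits in a C*-algebra *)

Section RealNorm.
Context {R : realType}.
Implicit Types A B : cstarAlgType R.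

(** The norm takes values in [R[i]]; its real part carries the same information and is open to real
    arithmetic. *)
Definition nr A (x : A) : R := complex.Re `|x|.
Definition rsc A (t : R) (x : A) : A := t%:C *: x.
End RealNorm.

Notation "t :*: x" := (rsc t x) (at level 40, left associativity).

Section NormedAlgebra.
Context {R : realType} {A : cstarAlgType R}.
Implicit Types (x y z : A) (s t : R) (c : R[i]).

Lemma nrE x : `|x| = (nr x)%:C.
Proof. by rewrite /nr RRe_real // ger0_real. Qed.

Lemma nr_ge0 x : 0 <= nr x.
Proof. by rewrite -ler0c -nrE. Qed.

Lemma nr0 : nr (0 : A) = 0.
Proof. by rewrite /nr normr0. Qed.

Lemma nr0_eq0 x : nr x = 0 -> x = 0.
Proof. by move=> x0; apply: normr0_eq0; rewrite nrE x0. Qed.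

Lemma nr_gt0 x : x <> 0 -> 0 < nr x.
Proof. by move=> x0; rewrite lt0r nr_ge0 andbT; apply/eqP => /nr0_eq0. Qed.

Lemma nrN x : nr (- x) = nr x.
Proof. by rewrite /nr normrN. Qed.

Lemma nrB x y : nr (x - y) = nr (y - x).
Proof. by rewrite -nrN opprB. Qed.

Lemma nrD x y : nr (x + y) <= nr x + nr y.
Proof. by have := ler_normD x y; rewrite !nrE -rmorphD lecR. Qed.

Lemma nrD_le x y s t : nr x <= s -> nr y <= t -> nr (x + y) <= s + t.
Proof. by move=> xs yt; apply: (le_trans (nrD x y)); rewrite lerD. Qed.

Lemma nr_triangle y x z : nr (x - z) <= nr (x - y) + nr (y - z).
Proof. by rewrite -(subrKA y x (- z)) nrD. Qed.

Lemma nr_leB x y : nr x <= nr (x - y) + nr y.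
Proof. by rewrite -{1}(subrK y x) nrD. Qed.

Lemma nrM x y : nr (x * y) <= nr x * nr y.
Proof. by have := cs_normM x y; rewrite !nrE -rmorphM lecR. Qed.

Lemma nrM_le x y s t : nr x <= s -> nr y <= t -> nr (x * y) <= s * t.
Proof.
by move=> xs yt; apply: (le_trans (nrM x y)); rewrite ler_pM ?nr_ge0.
Qed.

Lemma nr_starM x : nr (star x * x) = nr x ^+ 2.
Proof. by have := cs_normC x; rewrite !nrE -rmorphXn => /complexI. Qed.

Lemma nr_star x : nr (star x) = nr x.
Proof.
have le y : nr y <= nr (star y).
  have [/nr0_eq0 ->|/eqP y0] := eqVneq (nr y) 0; first by rewrite nr0 nr_ge0.
  have ygt : 0 < nr y by rewrite lt0r nr_ge0 andbT; apply/eqP.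
  by rewrite -(ler_pM2r ygt) -expr2 -nr_starM nrM.
by apply/eqP; rewrite eq_le le -{2}(starK x) le.
Qed.

Lemma nr_Mstar x : nr (x * star x) = nr x ^+ 2.
Proof. by rewrite -{1}(starK x) nr_starM nr_star. Qed.

Lemma star0 : star (0 : A) = 0.
Proof. by apply: (addIr (star 0)); rewrite add0r -starD addr0. Qed.

Lemma starN x : star (- x) = - star x.
Proof. by apply: (addIr (star x)); rewrite -starD !addNr star0. Qed.

Lemma starB x y : star (x - y) = star x - star y.
Proof. by rewrite starD starN. Qed.

Lemma star_mul x y : star (x * y) = star y * star x.
Proof. exact: starM. Qed.

Lemma star1 : star (1 : A) = 1.
Proof. by rewrite -[LHS]mul1r -{1}(starK 1) -star_mul mul1r starK. Qed.

Lemma star_sum I (r : seq I) (F : I -> A) :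
  star (\sum_(i <- r) F i) = \sum_(i <- r) star (F i).
Proof. exact: (big_morph _ starD star0). Qed.

Lemma starX x n : star (x ^+ n) = star x ^+ n.
Proof.
elim: n => [|n IH]; first by rewrite !expr0 star1.
by rewrite exprS star_mul IH -exprSr.
Qed.

(** By the C*-identity [nr 1] is idempotent, hence 0 or 1; the value 0 belongs to the zero algebra,
    which is not excluded. *)
Lemma nr1_le1 : nr (1 : A) <= 1.
Proof.
have := nr_starM (1 : A); rewrite star1 mulr1 => e.
have := nr_ge0 (1 : A) => ge0.
have [->|n0] := eqVneq (nr (1 : A)) 0; first by rewrite ler01.
by move: e; rewrite expr2 -{1}[nr 1]mulr1 => /(mulfI n0) <-.
Qed.

Lemma scaleAl c x y : c *: (x * y) = c *: x * y.
Proof. exact: cs_scaleAl. Qed.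

Lemma scaleAr c x y : c *: (x * y) = x * (c *: y).
Proof. exact: cs_scaleAr. Qed.

Lemma nrZ c x : nr (c *: x) = complex.Re `|c| * nr x.
Proof.
rewrite {1}/nr normrZ nrE -[`|c|](RRe_real (ger0_real (normr_ge0 c))).
by rewrite -rmorphM.
Qed.

Lemma rscDr t x y : t :*: (x + y) = t :*: x + t :*: y.
Proof. exact: scalerDr. Qed.
Lemma rscBr t x y : t :*: (x - y) = t :*: x - t :*: y.
Proof. exact: scalerBr. Qed.
Lemma rscNr t x : t :*: (- x) = - (t :*: x).
Proof. exact: scalerN. Qed.
Lemma rsc0r t : t :*: (0 : A) = 0.
Proof. exact: scaler0. Qed.
Lemma rscDl s t x : (s + t) :*: x = s :*: x + t :*: x.
Proof. by rewrite /rsc rmorphD scalerDl. Qed.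
Lemma rscNl t x : (- t) :*: x = - (t :*: x).
Proof. by rewrite /rsc rmorphN scaleNr. Qed.
Lemma rscBl s t x : (s - t) :*: x = s :*: x - t :*: x.
Proof. by rewrite rscDl rscNl. Qed.
Lemma rsc1 x : 1 :*: x = x.
Proof. by rewrite /rsc rmorph1 scale1r. Qed.
Lemma rsc0 x : 0 :*: x = 0.
Proof. by rewrite /rsc rmorph0 scale0r. Qed.
Lemma rscA s t x : s :*: (t :*: x) = (s * t) :*: x.
Proof. by rewrite /rsc rmorphM scalerA. Qed.
Lemma rscAl t x y : t :*: (x * y) = t :*: x * y.
Proof. exact: scaleAl. Qed.
Lemma rscAr t x y : t :*: (x * y) = x * (t :*: y).
Proof. exact: scaleAr. Qed.
Lemma rsc_nat n x : n%:R :*: x = x *+ n.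
Proof. by rewrite /rsc rmorph_nat scaler_nat. Qed.
Lemma rsc_sum I (r : seq I) (F : I -> A) t :
  t :*: (\sum_(i <- r) F i) = \sum_(i <- r) t :*: F i.
Proof. exact: scaler_sumr. Qed.
Lemma nr_rsc t x : nr (t :*: x) = `|t| * nr x.
Proof.
rewrite /rsc nrZ; congr (_ * _).
by rewrite normc_def /= expr0n addr0 sqrtr_sqr.
Qed.
Lemma star_rsc t x : star (t :*: x) = t :*: star x.
Proof. by rewrite /rsc starZ; congr (_ *: _); apply: conjc_real. Qed.

Lemma rsc_half x : 2^-1 :*: (x + x) = x.
Proof. by rewrite -mulr2n -rsc_nat rscA mulVf ?rsc1 // pnatr_eq0. Qed.

Lemma nr_rsc1 t : 0 <= t -> nr (t :*: (1 : A)) <= t.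
Proof.
move=> t0; rewrite nr_rsc ger0_norm //.
by rewrite -[leRHS]mulr1 ler_wpM2l // nr1_le1.
Qed.

Lemma nr_sum I (r : seq I) (F : I -> A) :
  nr (\sum_(i <- r) F i) <= \sum_(i <- r) nr (F i).
Proof.
elim/big_ind2 : _ => [|x s y t xs yt|//]; first by rewrite nr0.
exact: nrD_le.
Qed.

Definition slim (u : nat -> A) (l : A) : Prop :=
  forall e : R, 0 < e -> exists N, forall n, (N <= n)%N -> nr (u n - l) < e.

Lemma slimP u l : slim u l <-> u n @[n --> \oo] --> l.
Proof.
split=> [ul|/cvgrPdist_lt ul].
  apply/cvgrPdist_lt => e e0.
  have er : e = (complex.Re e)%:C by rewrite RRe_real // gtr0_real.
  have [N HN] := ul _ (ltac:(by rewrite -ltcR -er) : 0 < complex.Re e).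
  by exists N => // n /= /HN; rewrite nrB er nrE ltcR.
move=> e e0; have /ul[N _ HN] : 0 < e%:C by rewrite ltcR.
by exists N => n /HN /=; rewrite nrE ltcR nrB.
Qed.

Lemma slim_unique u l m : slim u l -> slim u m -> l = m.
Proof.
move=> ul um; apply/eqP; rewrite -subr_eq0; apply/eqP/nr0_eq0/eqP.
rewrite eq_le nr_ge0 andbT; apply/ler_addgt0Pr => e e0; rewrite add0r.
have e2 : 0 < e / 2 by rewrite divr_gt0.
have [N1 H1] := ul _ e2; have [N2 H2] := um _ e2.
have := H1 _ (leq_maxl N1 N2); have := H2 _ (leq_maxr N1 N2).
have := nr_triangle (u (maxn N1 N2)) l m; rewrite (nrB l (u _)).
lra.
Qed.

Lemma slim_cst x : slim (fun=> x) x.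
Proof. by move=> e e0; exists 0%N => n _; rewrite subrr nr0. Qed.

Lemma slim_ext u v l : (forall n, u n = v n) -> slim u l -> slim v l.
Proof. by move=> uv ul e /ul[N HN]; exists N => n /HN; rewrite uv. Qed.

Lemma slimD u v l m : slim u l -> slim v m -> slim (fun n => u n + v n) (l + m).
Proof.
move=> ul vm e e0; have e2 : 0 < e / 2 by rewrite divr_gt0.
have [N1 H1] := ul _ e2; have [N2 H2] := vm _ e2.
exists (maxn N1 N2) => n; rewrite geq_max => /andP[/H1 un /H2 vn].
rewrite opprD addrACA; have := nrD (u n - l) (v n - m); lra.
Qed.

Lemma slim_sum (I : eqType) (r : seq I) (u : I -> nat -> A) (l : I -> A) :
  (forall i, i \in r -> slim (u i) (l i)) ->
  slim (fun n => \sum_(i <- r) u i n) (\sum_(i <- r) l i).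
Proof.
elim: r => [|i r IH] ul.
  by rewrite big_nil; apply: slim_ext (slim_cst 0) => n; rewrite big_nil.
have ur j : j \in r -> slim (u j) (l j) by move=> jr; apply: ul; rewrite inE jr orbT.
rewrite big_cons; apply: slim_ext (slimD (ul i (mem_head _ _)) (IH ur)) => n.
by rewrite big_cons.
Qed.

Lemma slim_lip (f : A -> A) k u l :
  (forall x, nr (f x - f l) <= k * nr (x - l)) -> slim u l ->
  slim (fun n => f (u n)) (f l).
Proof.
move=> fl ul e e0; pose k' := `|k| + 1.
have k'0 : 0 < k' by rewrite ltr_wpDl.
have [N HN] := ul (e / k') (divr_gt0 e0 k'0).
exists N => n /HN un; apply: (le_lt_trans (fl _)).
apply: (@le_lt_trans _ _ (k' * nr (u n - l))).
  rewrite ler_wpM2r ?nr_ge0 //.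
  by apply: (le_trans (ler_norm k)); rewrite lerDl.
by rewrite mulrC -ltr_pdivlMr.
Qed.

Lemma slimN u l : slim u l -> slim (fun n => - u n) (- l).
Proof.
by apply: (@slim_lip -%R 1) => x; rewrite -opprD nrN mul1r.
Qed.

Lemma slimB u v l m : slim u l -> slim v m -> slim (fun n => u n - v n) (l - m).
Proof. by move=> ul /slimN; apply: slimD. Qed.

Lemma slimMl x u l : slim u l -> slim (fun n => x * u n) (x * l).
Proof. by apply: (@slim_lip ( *%R x) (nr x)) => y; rewrite -mulrBr nrM. Qed.

Lemma slimMr x u l : slim u l -> slim (fun n => u n * x) (l * x).
Proof.
by apply: (@slim_lip (fun y => y * x) (nr x)) => y; rewrite -mulrBl mulrC nrM.
Qed.

Lemma slim_star u l : slim u l -> slim (fun n => star (u n)) (star l).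
Proof.
by apply: (@slim_lip star 1) => x; rewrite -starB nr_star mul1r.
Qed.

Lemma slimZ c u l : slim u l -> slim (fun n => c *: u n) (c *: l).
Proof.
by apply: (@slim_lip ( *:%R c) (complex.Re `|c|)) => x; rewrite -scalerBr nrZ.
Qed.

Lemma slim_rsc t u l : slim u l -> slim (fun n => t :*: u n) (t :*: l).
Proof. exact: slimZ. Qed.

Lemma slim_bound u l : slim u l -> exists N, forall n, (N <= n)%N ->
  nr (u n) <= nr l + 1.
Proof.
move=> /(_ 1 ltr01)[N HN]; exists N => n /HN un.
by have := nr_leB (u n) l; lra.
Qed.

Lemma slim_zeroM u l (v : nat -> A) k : 0 <= k -> (forall n, nr (v n) <= k) ->
  slim u l -> slim (fun n => v n * (u n - l)) 0.
Proof.
move=> k0 vk ul e e0; have k1 : 0 < k + 1 by rewrite ltr_wpDl.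
have [N HN] := ul (e / (k + 1)) (divr_gt0 e0 k1); exists N => n /HN un.
rewrite subr0; apply: (le_lt_trans (nrM _ _)).
apply: (@le_lt_trans _ _ ((k + 1) * nr (u n - l))).
  by rewrite ler_wpM2r ?nr_ge0 // (le_trans (vk n)) // lerDl.
by rewrite mulrC -ltr_pdivlMr.
Qed.

Lemma slim_shift k u l : slim u l -> slim (fun n => u (n + k)%N) l.
Proof.
by move=> ul e /ul[N HN]; exists N => n Nn; apply: HN; rewrite (leq_trans Nn) ?leq_addr.
Qed.

Lemma slimM u v l m : slim u l -> slim v m -> slim (fun n => u n * v n) (l * m).
Proof.
move=> ul vm; have [N HN] := slim_bound ul.
suff H : slim (fun n => u (n + N)%N * v (n + N)%N) (l * m).
  move=> e /H[N' HN']; exists (N' + N)%N => n Nn.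
  have {1 2}<- : (n - N + N = n)%N by lia.
  by apply: HN'; lia.
have vm' := slim_shift N vm; have ul' := slim_shift N ul.
have k0 : 0 <= nr l + 1 by rewrite addr_ge0 ?nr_ge0.
have := slimD (slim_zeroM k0 (fun n => HN _ (leq_addl n N)) vm') (slimMr m ul').
by rewrite add0r; apply: slim_ext => n; rewrite mulrBr subrK.
Qed.

Lemma slimX u l k : slim u l -> slim (fun n => u n ^+ k) (l ^+ k).
Proof.
move=> ul; elim: k => [|k IH].
  by rewrite expr0; apply: slim_ext (slim_cst 1) => n; rewrite expr0.
by rewrite exprS; apply: slim_ext (slimM ul IH) => n; rewrite exprS.
Qed.

Lemma nr_slim_le u l t : slim u l -> (forall n, nr (u n) <= t) -> nr l <= t.
Proof.
move=> ul ut; apply/ler_addgt0Pr => e e0; have [N /(_ _ (leqnn N)) HN] := ul _ e0.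
by have := nr_leB l (u N); have := ut N; rewrite nrB; lra.
Qed.

Lemma slim_cauchy (u : nat -> A) :
  (forall e : R, 0 < e -> exists N, forall m n, (N <= m)%N -> (N <= n)%N ->
     nr (u m - u n) < e) -> exists l, slim u l.
Proof.
move=> uc; suff /cvg_ex[l ul] : cvgn u by exists l; apply/slimP.
apply/cauchy_cvgP/cauchy_exP => e e0.
have er : e = (complex.Re e)%:C by rewrite RRe_real // gtr0_real.
have e1 : 0 < complex.Re e by rewrite -ltcR -er.
have [N HN] := uc _ e1; exists (u N); exists N => // n /= Nn.
by rewrite -ball_normE /= nrE er ltcR; apply: HN.
Qed.

Lemma slim_geometric (u : nat -> A) (k r : R) : 0 <= r -> r < 1 ->
  (forall n, nr (u n.+1 - u n) <= k * r ^+ n) -> exists l, slim u l.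
Proof.
move=> r0 r1 ur; have k0 : 0 <= k.
  by have := ur 0%N; rewrite expr0 mulr1; apply: le_trans (nr_ge0 _).
have s0 : 0 < 1 - r by rewrite subr_gt0.
have tail m p : nr (u (m + p)%N - u m) <= k / (1 - r) * r ^+ m * (1 - r ^+ p).
  elim: p => [|p IH]; first by rewrite addn0 subrr nr0 expr0 subrr mulr0.
  have := nr_triangle (u (m + p)%N) (u (m + p).+1) (u m).
  have := ur (m + p)%N; rewrite addnS => H1 H2.
  apply: (le_trans H2); apply: (le_trans (lerD H1 IH)).
  rewrite exprD exprS; 
  have s1 : 1 - r != 0 by rewrite gt_eqF.
  rewrite le_eqVlt; apply/orP; left; apply/eqP; field.
  exact: s1.
have cv : (k / (1 - r) * r ^+ n) @[n --> \oo] --> (0 : R).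
  rewrite -[X in _ --> X](mulr0 (k / (1 - r))).
  by apply: cvgMr; apply: cvg_expr; rewrite ger0_norm.
apply: slim_cauchy => e e0.
have e2 : 0 < e / 2 by rewrite divr_gt0.
have /cvgrPdist_lt/(_ _ e2)[N _ HN] := cv.
have close n : (N <= n)%N -> nr (u n - u N) < e / 2.
  move=> Nn; have := tail N (n - N)%N; rewrite subnKC // => H.
  have := HN N (leqnn N); rewrite /= sub0r normrN ger0_norm; last first.
    by rewrite mulr_ge0 ?exprn_ge0 // divr_ge0 // ltW.
  apply: le_lt_trans; apply: (le_trans H).
  by rewrite ler_piMr ?mulr_ge0 ?exprn_ge0 ?invr_ge0 ?(ltW s0) ?gerBl ?exprn_ge0.
exists N => m n /close Hm /close Hn.
have := nr_triangle (u N) (u m) (u n); rewrite (nrB (u N) (u n)); lra.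
Qed.

End NormedAlgebra.

(** * Positive elements *)

Section CStarBasics.
Context {R : realType} {A : cstarAlgType R}.
Implicit Types (x y z h k : A) (s t : R).

Definition sa x : Prop := star x = x.
(** Membership of [y] in the bicommutant of [x]. It stands in for [y] being a function of [x], and
    makes square roots of commuting elements commute. *)
Definition bicomm x y : Prop := forall z, x * z = z * x -> y * z = z * y.

Lemma rsc1C t x : (t :*: 1) * x = x * (t :*: 1).
Proof. by rewrite -rscAl -rscAr mul1r mulr1. Qed.

Lemma rsc1M s t : ((s * t) :*: (1 : A)) = (s :*: 1) * (t :*: 1).
Proof. by rewrite -rscAl mul1r rscA. Qed.

Lemma saD x y : sa x -> sa y -> sa (x + y).
Proof. by rewrite /sa starD => -> ->. Qed.
Lemma saN x : sa x -> sa (- x).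
Proof. by rewrite /sa starN => ->. Qed.
Lemma saB x y : sa x -> sa y -> sa (x - y).
Proof. by move=> xs /saN; apply: saD. Qed.
Lemma sa0 : sa (0 : A). Proof. exact: star0. Qed.
Lemma sa1 : sa (1 : A). Proof. exact: star1. Qed.
Lemma sa_rsc t x : sa x -> sa (t :*: x).
Proof. by rewrite /sa star_rsc => ->. Qed.
Lemma saX x n : sa x -> sa (x ^+ n).
Proof. by rewrite /sa starX => ->. Qed.
Lemma saMC x y : sa x -> sa y -> x * y = y * x -> sa (x * y).
Proof. by rewrite /sa star_mul => -> ->. Qed.
Lemma sa_star_mul x : sa (star x * x).
Proof. by rewrite /sa star_mul starK. Qed.
Lemma sa_conj x z : sa z -> sa (star x * z * x).
Proof. by rewrite /sa !star_mul starK mulrA => ->. Qed.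
Lemma sa_slim u x : (forall n, sa (u n)) -> slim u x -> sa x.
Proof.
move=> us ux; apply: (slim_unique _ ux).
by apply: slim_ext (slim_star ux) => n; apply: us.
Qed.

Lemma nr_sa_sq x : sa x -> nr (x ^+ 2) = nr x ^+ 2.
Proof. by move=> xs; rewrite -nr_starM xs expr2. Qed.

Lemma nr_sa_pow2 x n : sa x -> nr (x ^+ (2 ^ n)) = nr x ^+ (2 ^ n).
Proof.
move=> xs; elim: n => [|n IH]; first by rewrite !expr1.
by rewrite expnSr !exprM nr_sa_sq ?IH //; apply: saX.
Qed.

Lemma inv_comm x y z : x * y = 1 -> y * x = 1 -> x * z = z * x -> y * z = z * y.
Proof.
move=> xy yx xz; rewrite -[y * z]mulr1 -xy.
by rewrite mulrA -(mulrA y) -xz mulrA yx mul1r.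
Qed.

Lemma neumann h : nr h < 1 ->
  exists g, [/\ (1 - h) * g = 1, g * (1 - h) = 1 & nr g <= (1 - nr h)^-1].
Proof.
move=> h1; have h0 := nr_ge0 h.
pose fix u n : A := if n is n'.+1 then 1 + h * u n' else 1.
have ustep n : nr (u n.+1 - u n) <= nr h * nr h ^+ n.
  elim: n => [|n IH] /=.
    by rewrite mulr1 addrAC subrr add0r expr0 mulr1.
  rewrite opprD addrACA subrr add0r -mulrBr.
  by rewrite exprS mulrA; apply: (le_trans (nrM _ _)); rewrite -mulrA ler_wpM2l.
have [g ug] := slim_geometric h0 h1 ustep.
have ucomm n : h * u n = u n * h.
  elim: n => [|n IH] /=; first by rewrite mulr1 mul1r.
  by rewrite mulrDr mulrDl mulr1 mul1r {1}IH mulrA.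
have e1 : g = 1 + h * g.
  apply: (slim_unique (slim_shift 1 ug)).
  apply: slim_ext (slimD (slim_cst 1) (slimMl h ug)) => n.
  by rewrite addn1.
have hg : h * g = g * h.
  apply: (slim_unique (slimMl h ug)).
  by apply: slim_ext (slimMr h ug) => n; rewrite ucomm.
have l1 : (1 - h) * g = 1 by rewrite mulrBl mul1r {1}e1 addrK.
exists g; split => //; first by rewrite mulrBr mulr1 -hg -{1}[g]mul1r -mulrBl.
rewrite -[leRHS]mul1r ler_pdivlMr ?subr_gt0 //.
have := nrD 1 (h * g); rewrite -e1; have := nr1_le1 (A := A); have := nrM h g.
rewrite mulrBr mulr1 (mulrC (nr g)); lra.
Qed.

(* The fixed point of [y = (h + y^2) / 2] satisfies [(1 - y)^2 = 1 - h]. *)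
Lemma sqrt_small h : nr h < 1 -> sa h ->
  exists y, [/\ sa y, nr y <= nr h, bicomm h y & (1 - y) ^+ 2 = 1 - h].
Proof.
move=> h1 hs; have h0 := nr_ge0 h; set r := nr h in h1 h0 *.
pose phi y := 2^-1 :*: (h + y * y).
have half0 : 0 <= (2^-1 : R) by rewrite invr_ge0.
pose u n : A := iter n phi 0.
have uS n : u n.+1 = 2^-1 :*: (h + u n * u n) by [].
have ur n : nr (u n) <= r.
  elim: n => [|n IH]; first by rewrite /u /= nr0.
  rewrite uS nr_rsc ger0_norm //.
  have := nrD_le (lexx (nr h)) (nrM_le IH IH).
  by rewrite -/r; nra.
have usa n : sa (u n).
  elim: n => [|n IH]; first exact: sa0.
  by rewrite uS; apply: sa_rsc; apply: saD => //; apply: saMC.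
have ubi n : bicomm h (u n).
  elim: n => [|n IH] z hz; first by rewrite /u /= mul0r mulr0.
  rewrite uS -rscAl -rscAr; congr (_ :*: _).
  by rewrite mulrDl mulrDr hz -mulrA (IH _ hz) mulrA (IH _ hz) -mulrA.
have ustep n : nr (u n.+1 - u n) <= r * r ^+ n.
  elim: n => [|n IH].
    by rewrite expr0 mulr1 [u 0%N]/(0 : A) subr0 ur.
  rewrite uS [u n.+1 in X in _ - X]uS -rscBr opprD addrACA subrr add0r.
  have -> : u n.+1 * u n.+1 - u n * u n
      = u n.+1 * (u n.+1 - u n) + (u n.+1 - u n) * u n by ncring.
  rewrite nr_rsc ger0_norm // exprS.
  have := nrD_le (nrM_le (ur n.+1) IH) (nrM_le IH (ur n)).
  by rewrite [_ * _ * r]mulrC => H; lra.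
have [y uy] := slim_geometric h0 h1 ustep.
have e1 : y = 2^-1 :*: (h + y * y).
  apply: (slim_unique (slim_shift 1 uy)).
  apply: slim_ext (slim_rsc 2^-1 (slimD (slim_cst h) (slimM uy uy))) => n.
  by rewrite addn1.
exists y; split.
- exact: sa_slim uy.
- exact: nr_slim_le uy ur.
- move=> z hz; apply: (slim_unique (slimMr z uy)).
  by apply: slim_ext (slimMl z uy) => n; rewrite ubi.
- have e2 : y + y = h + y * y.
    by rewrite {1 2}e1 -rscDr; apply: rsc_half.
  have -> : h = y + y - y * y by rewrite e2 addrK.
  by ncring.
Qed.

(** The element [c = x + 'i *: y] satisfies [star c * c = x ^+ 2 + y ^+ 2], and [x] is its real
    part, so [nr x <= nr c]. The order estimates for the norm rest on this. *)
Lemma arens x y : sa x -> sa y -> x * y = y * x -> nr x ^+ 2 <= nr (x ^+ 2 + y ^+ 2).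
Proof.
move=> xs ys xy; pose c := x + 'i *: y.
have cs : star c = x - 'i *: y.
  rewrite /c starD starZ xs ys; congr (_ + _).
  by rewrite -scaleNr conjCi.
have cc : star c * c = x ^+ 2 + y ^+ 2.
  rewrite cs /c mulrBl !mulrDr -scaleAl -!scaleAr -scaleAl xy scalerA.
  have -> : ('i : R[i]) * 'i = -1 by rewrite -expr2 sqrCi.
  by rewrite scaleN1r opprD opprK addrA addrK !expr2.
rewrite -cc nr_starM ler_pXn2r ?nnegrE ?nr_ge0 //.
have -> : x = 2^-1 :*: (c + star c).
  by rewrite cs /c addrACA subrr addr0 rsc_half.
have half0 : 0 <= (2^-1 : R) by rewrite invr_ge0.
rewrite nr_rsc ger0_norm //; have := nrD c (star c); rewrite nr_star.
have := nr_ge0 c; lra.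
Qed.

(** [1 - k ^+ 2] is itself a square [(1 - y) ^+ 2] with [y] commuting with [k]; the two squares add
    up to 1, so [arens] applies. *)
Lemma nr_1sub_sq k : sa k -> nr k < 1 -> nr (1 - k ^+ 2) <= 1.
Proof.
move=> ks k1; have k2 : nr (k ^+ 2) < 1.
  by rewrite nr_sa_sq // expr_lt1 ?nr_ge0.
have [y [ys _ yb ey]] := sqrt_small k2 (saX 2 ks).
have ky : k * y = y * k by apply/esym/yb; rewrite expr2 mulrA.
have k1y : (1 - y) * k = k * (1 - y) by rewrite mulrBl mulrBr ky mulr1 mul1r.
have := arens (saB sa1 ys) ks k1y.
rewrite ey subrK -nr_sa_sq ?ey; last exact: saB sa1 ys.
by move=> /le_trans; apply; apply: nr1_le1.
Qed.

(* Positivity: [nr (t - x) <= t] means that the spectrum lies in [0, 2t]. *)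
Definition psd x : Prop := sa x /\ exists t, nr (t :*: 1 - x) <= t.

Lemma psd_sa x : psd x -> sa x. Proof. by case. Qed.

Lemma psd_up x : psd x -> exists t0, forall t, t0 <= t -> nr (t :*: 1 - x) <= t.
Proof.
case=> xs [t xt]; exists t => t' tt'.
have -> : t' :*: 1 - x = (t' - t) :*: 1 + (t :*: 1 - x).
  by rewrite rscBl addrA subrK.
have := nrD_le (nr_rsc1 (A := A) (t := t' - t) _) xt.
by rewrite subrK; apply; rewrite subr_ge0.
Qed.

Lemma psd_near x t : sa x -> nr (t :*: 1 - x) <= t -> psd x.
Proof. by move=> xs xt; split=> //; exists t. Qed.

Lemma psd_1sub x : sa x -> nr x <= 1 -> psd (1 - x).
Proof.
move=> xs x1; apply: (@psd_near _ 1); first exact: saB sa1 xs.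
by rewrite rsc1 opprB addrC subrK.
Qed.

Lemma psd_sub x t : sa x -> nr x <= t -> psd (t :*: 1 - x).
Proof.
move=> xs xt; apply: (@psd_near _ t); first exact: saB (sa_rsc t sa1) xs.
by rewrite opprB addrC subrK.
Qed.

Lemma psd0 : psd (0 : A).
Proof. by apply: (@psd_near _ 0); [exact: sa0 | rewrite rsc0 subr0 nr0]. Qed.

Lemma psd_rsc1 t : 0 <= t -> psd (t :*: (1 : A)).
Proof.
move=> t0; apply: (@psd_near _ t); first exact: sa_rsc sa1.
by rewrite subrr nr0.
Qed.

Lemma psdD x y : psd x -> psd y -> psd (x + y).
Proof.
move=> [xs [t xt]] [ys [s yS]]; apply: (@psd_near _ (t + s)); first exact: saD.
by rewrite rscDl opprD addrACA nrD_le.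
Qed.

Lemma psd_rsc t x : 0 <= t -> psd x -> psd (t :*: x).
Proof.
move=> t0 [xs [s xS]]; apply: (@psd_near _ (t * s)); first exact: sa_rsc.
by rewrite -rscA -rscBr nr_rsc ger0_norm // ler_wpM2l.
Qed.

Lemma psd_rsc_inv t x : 0 < t -> psd (t :*: x) -> psd x.
Proof.
move=> t0 /(psd_rsc (t := t^-1)); rewrite rscA mulVf ?gt_eqF // rsc1.
by apply; rewrite invr_ge0 ltW.
Qed.

Lemma psd_sum I (r : seq I) (F : I -> A) :
  (forall i, psd (F i)) -> psd (\sum_(i <- r) F i).
Proof. by move=> Fp; elim/big_ind : _ => //; [exact: psd0 | exact: psdD]. Qed.

(** Divided by [s + t], the element [x + t :*: 1] is [1 - h] with [nr h <= s / (s + t)]; the shift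
    by [t] makes this strictly less than 1, as [sqrt_small] demands. *)
Lemma psd_sqrt_eps x t : psd x -> 0 < t ->
  exists k, [/\ sa k, bicomm x k, k ^+ 2 = x + t :*: 1 & psd k].
Proof.
move=> xp t0; have [s0 /(_ (Num.max s0 0))] := psd_up xp.
rewrite le_max lexx => /(_ isT); set s := Num.max s0 0 => xS.
have s_ge0 : 0 <= s by rewrite le_max lexx orbT.
have st0 : 0 < s + t by rewrite ltr_wpDl.
have stN0 : s + t != 0 by rewrite gt_eqF.
pose h := (s + t)^-1 :*: (s :*: 1 - x).
have hs : sa h by apply: sa_rsc; apply: saB (psd_sa xp); apply: sa_rsc sa1.
have h1 : nr h < 1.
  rewrite /h nr_rsc ger0_norm ?invr_ge0 ?(ltW st0) // mulrC ltr_pdivrMr // mul1r.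
  by rewrite (le_lt_trans xS) // ltrDl.
have [y [ys y1 yb ey]] := sqrt_small h1 hs.
have s_ge : 0 <= Num.sqrt (s + t) by rewrite sqrtr_ge0.
exists (Num.sqrt (s + t) :*: (1 - y)); split.
- by apply: sa_rsc; apply: saB sa1 ys.
- move=> z xz; rewrite -rscAl -rscAr mulrBl mulrBr mul1r mulr1; congr (_ :*: (_ - _)).
  by apply: yb; rewrite /h -rscAl -rscAr mulrBl mulrBr xz -rscAl -rscAr mul1r mulr1.
- rewrite expr2 -rscAl -rscAr rscA -!expr2 ey sqr_sqrtr ?(ltW st0) //.
  by rewrite rscBr /h rscA mulfV // rsc1 rscDl; ncring.
- apply: psd_rsc => //; apply: psd_1sub => //.
  exact: le_trans y1 (ltW h1).
Qed.

(** The witness in [psd] can be any bound of the norm, which gives the uniform witness that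
    closedness under limits requires. A square root of [x + d], divided by the root of
    [s = t + 2 d], is a strict contraction, to which [nr_1sub_sq] applies. *)
Lemma psd_norm x t : psd x -> nr x <= t -> nr (t :*: 1 - x) <= t.
Proof.
move=> xp xt; apply/ler_addgt0Pr => e e0.
have t0 : 0 <= t := le_trans (nr_ge0 x) xt.
have d0 : 0 < e / 4 by rewrite divr_gt0.
set d := e / 4 in d0.
have [k [ks _ ek _]] := psd_sqrt_eps xp d0.
pose s := t + d + d.
have s0 : 0 < s by rewrite /s; lra.
have sN0 : s != 0 by rewrite gt_eqF.
pose q := Num.sqrt s.
have q0 : 0 < q by rewrite sqrtr_gt0.
have qq : q ^+ 2 = s by rewrite sqr_sqrtr // ltW.
have kq : nr (q^-1 :*: k) < 1.
  rewrite nr_rsc ger0_norm ?invr_ge0 ?(ltW q0) // mulrC ltr_pdivrMr // mul1r.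
  rewrite -(@ltr_pXn2r _ 2) ?nnegrE ?nr_ge0 ?(ltW q0) // qq -nr_sa_sq // ek.
  have := nrD_le xt (nr_rsc1 (A := A) (ltW d0)); rewrite /s; lra.
have := nr_1sub_sq (sa_rsc q^-1 ks) kq.
have -> : (q^-1 :*: k) ^+ 2 = s^-1 :*: (x + d :*: 1).
  by rewrite expr2 -rscAl -rscAr rscA -(expr2 k) ek -expr2 exprVn qq.
move=> H; have : nr (s :*: (1 - s^-1 :*: (x + d :*: 1))) <= s.
  by rewrite nr_rsc ger0_norm ?(ltW s0) // -[leRHS]mulr1 ler_wpM2l // ltW.
rewrite rscBr rscA mulfV // rsc1.
have -> : s :*: 1 - (x + d :*: 1) = (t :*: 1 - x) + d :*: 1.
  by rewrite /s !rscDl; ncring.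
move=> H1; have := nrD_le H1 (nr_rsc1 (A := A) (ltW d0)).
have := nr_leB (t :*: 1 - x) ((t :*: 1 - x) + d :*: 1).
rewrite opprD addrA subrr add0r nrN.
have := nr_rsc1 (A := A) (ltW d0); rewrite /s /d in H1 *; lra.
Qed.

Lemma psd_slim u x : (forall n, psd (u n)) -> slim u x -> psd x.
Proof.
move=> up ux; have [N HN] := slim_bound ux.
apply: (@psd_near _ (nr x + 1)); first by apply: sa_slim ux => n; apply: psd_sa.
apply: (nr_slim_le (slimB (slim_cst ((nr x + 1) :*: 1)) (slim_shift N ux))) => n.
by apply: psd_norm => //; apply: HN; rewrite leq_addl.
Qed.

Lemma slim_harmonic x : slim (fun n => n.+1%:R^-1 :*: x) 0.
Proof.
move=> e e0; pose N := (Num.bound (nr x / e)).+1.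
have x0 := nr_ge0 x; exists N => n Nn; rewrite subr0 nr_rsc ger0_norm ?invr_ge0 //.
rewrite mulrC ltr_pdivrMr // mulrC -ltr_pdivrMr //.
apply: (lt_le_trans (archi_boundP (divr_ge0 x0 (ltW e0)))).
by rewrite ler_nat; apply: leq_trans (leqnSn _) (leqW Nn).
Qed.

Lemma psd_eps x y : (forall t, 0 < t -> psd (x + t :*: y)) -> psd x.
Proof.
move=> xp; apply: (@psd_slim (fun n => x + n.+1%:R^-1 :*: y)).
  by move=> n; apply: xp; rewrite invr_gt0.
by rewrite -[X in slim _ X]addr0; apply: slimD (slim_cst x) (slim_harmonic y).
Qed.

Lemma psd_sq k : sa k -> psd (k ^+ 2).
Proof.
move=> ks; pose s := nr k + 1.
have s0 : 0 < s by rewrite ltr_wpDl ?nr_ge0.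
have k1 : nr (s^-1 :*: k) < 1.
  rewrite nr_rsc ger0_norm ?invr_ge0 ?(ltW s0) // mulrC ltr_pdivrMr // mul1r.
  by rewrite ltrDl.
have -> : k ^+ 2 = (s ^+ 2) :*: (s^-1 :*: k) ^+ 2.
  rewrite [(_ :*: k) ^+ 2]expr2 -rscAl -rscAr -(expr2 k) !rscA.
  rewrite [X in X :*: _](_ : _ = 1) ?rsc1 //.
  by field; rewrite gt_eqF.
apply: psd_rsc; first by rewrite exprn_ge0 // ltW.
apply: (@psd_near _ 1); first by apply: saX; apply: sa_rsc.
by rewrite rsc1; apply: nr_1sub_sq => //; apply: sa_rsc.
Qed.

(** Up to [d], both [x] and [s - x] are squares of commuting self-adjoint elements, and these
    squares add up to about [s]; [arens] then bounds the first one. *)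
Lemma psd_le_norm x s : 0 <= s -> psd x -> psd (s :*: 1 - x) -> nr x <= s.
Proof.
move=> s0 xp sp; apply/ler_addgt0Pr => e e0.
have d0 : 0 < e / 4 by rewrite divr_gt0.
set d := e / 4 in d0.
have [k [ks kb ek _]] := psd_sqrt_eps xp d0.
have [l [ls lb el _]] := psd_sqrt_eps sp d0.
have kl : k * l = l * k.
  apply: kb; apply/esym; apply: lb.
  by rewrite mulrBl mulrBr -rscAl -rscAr mul1r mulr1.
have := arens ks ls kl; rewrite ek el -nr_sa_sq // ek.
have -> : x + d :*: 1 + (s :*: 1 - x + d :*: 1) = (s + d + d) :*: 1.
  by rewrite !rscDl; ncring.
have sd : 0 <= s + d + d by lra.
have := nr_rsc1 (A := A) sd; have := nr_leB x (x + d :*: 1).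
rewrite opprD addrA subrr add0r nrN.
have := nr_rsc1 (A := A) (ltW d0); rewrite /d; lra.
Qed.

Lemma psd_anti x : psd x -> psd (- x) -> x = 0.
Proof.
move=> xp nxp; apply/nr0_eq0/eqP; rewrite eq_le nr_ge0 andbT.
by apply: psd_le_norm => //; rewrite rsc0 add0r.
Qed.

(** Twice the sum is [p ^+ 2 + q ^+ 2] with [p] and [q] self-adjoint. This is available before
    [star m * m] alone is known to be positive. *)
Lemma psd_anticomm m : psd (m * star m + star m * m).
Proof.
pose p := m + star m; pose q := 'i *: (m - star m).
have ps : sa p by rewrite /p /sa starD starK addrC.
have qs : sa q.
  by rewrite /q /sa starZ starB starK -(opprB m) scalerN -scaleNr conjCi opprK.
apply: (@psd_rsc_inv 2) => //.
have -> : 2 :*: (m * star m + star m * m) = p ^+ 2 + q ^+ 2.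
  have -> : q ^+ 2 = - ((m - star m) * (m - star m)).
    rewrite expr2 /q -scaleAl -scaleAr scalerA.
    by rewrite -expr2 sqrCi scaleN1r.
  by rewrite (rsc_nat 2) mulr2n /p; ncring.
by apply: psdD; apply: psd_sq.
Qed.

(* With [a = y* y], [c = y y*] and [m = y (t - a)^(1/2)], positivity of
   [m m* + m* m = t c - c^2 + t a - a^2] bounds [a]. *)
Lemma nr_sq_le y s : 0 <= s -> psd (s :*: 1 - star y * y) -> nr y ^+ 2 <= 2 * s.
Proof.
move=> s0 yp; apply/ler_addgt0Pr => e e0.
pose d := e / 2; have d0 : 0 < d by rewrite divr_gt0.
have [l [ls lb el _]] := psd_sqrt_eps yp d0.
pose a := star y * y; pose c := y * star y; pose t := s + d.
have t0 : 0 < t by rewrite ltr_wpDl.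
have {}el : l ^+ 2 = t :*: 1 - a by rewrite el /t rscDl addrAC.
have as_ : sa a := sa_star_mul y.
have cs : sa c by rewrite /sa /c star_mul starK.
have al : l * a = a * l.
  by apply: lb; rewrite mulrBl mulrBr -rscAl -rscAr mul1r mulr1.
pose m := y * l.
pose T := t :*: (1 : A).
have TC z : T * z = z * T by apply: rsc1C.
have mm : star m * m = T * a - a ^+ 2.
  have -> : star m * m = l ^+ 2 * a.
    by rewrite /m star_mul ls -mulrA (mulrA (star y)) -/a -al mulrA expr2.
  by rewrite el -/T; ncring.
have mm' : m * star m = T * c - c ^+ 2.
  have -> : m * star m = y * l ^+ 2 * star y.
    by rewrite /m star_mul ls expr2 !mulrA.
  by rewrite el -/T mulrBr mulrBl -TC /a /c; ncring.
have := psd_anticomm m; rewrite mm mm' => Sp.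
pose H := (t / 2) :*: (1 : A).
have HC z : H * z = z * H by apply: rsc1C.
have HT : T = H + H by rewrite /T /H -rscDl -splitr.
have Hs : sa H by apply: sa_rsc sa1.
have zs : sa (a - H) by apply: saB.
(* Completing squares: [T * a - a ^+ 2] equals [H ^+ 2 - (a - H) ^+ 2], likewise for [c], so
   positivity of the sum bounds [(a - H) ^+ 2] by [2 H ^+ 2 = t ^+ 2 / 2]. *)
have Zp : psd ((t ^+ 2 / 2) :*: 1 - (a - H) ^+ 2).
  have -> : (t ^+ 2 / 2) :*: 1 - (a - H) ^+ 2
      = T * c - c ^+ 2 + (T * a - a ^+ 2) + (c - H) ^+ 2.
    have -> : (t ^+ 2 / 2) :*: (1 : A) = H * H + H * H.
      by rewrite -rsc1M -rscDl; congr (_ :*: _); field.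
    by rewrite HT; ncring_with [:: H].
  by apply: psdD => //; apply: psd_sq; apply: saB.
have t20 : 0 <= t ^+ 2 / 2 by rewrite divr_ge0 // exprn_ge0 // ltW.
have := psd_le_norm t20 (psd_sq zs) Zp; rewrite nr_sa_sq // => z1.
have z2 : nr (a - H) <= t.
  rewrite -(@ler_pXn2r _ 2) ?nnegrE ?nr_ge0 ?(ltW t0) //.
  apply: (le_trans z1); have := exprn_ge0 2 (ltW t0); lra.
rewrite -nr_starM -/a; have := nr_leB a H.
have t2 : 0 <= t / 2 by rewrite divr_ge0 // ltW.
have := nr_rsc1 (A := A) t2; rewrite -/H /t /d in z2 *; lra.
Qed.

Lemma bernoulli (d : R) n : 0 <= d -> 1 + n%:R * d <= (1 + d) ^+ n.
Proof.
move=> d0; elim: n => [|n IH]; first by rewrite mul0r addr0 expr0.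
rewrite exprS; have n0 : 0 <= n%:R * d by rewrite mulr_ge0.
have : (1 + d) * (1 + n%:R * d) <= (1 + d) * (1 + d) ^+ n.
  by rewrite ler_wpM2l // addr_ge0.
apply: le_trans; rewrite -natr1; have : 0 <= d * (n%:R * d) by rewrite mulr_ge0.
lra.
Qed.

Lemma linear_growth_le1 (r : R) : 0 <= r ->
  (forall n, r ^+ (2 ^ n) <= 1 + 4 * (2 ^ n)%:R) -> r <= 1.
Proof.
move=> r0 H; rewrite leNgt; apply/negP => r1.
pose d := r - 1; have d0 : 0 < d by rewrite subr_gt0.
have dd : 0 < d ^+ 2 by rewrite exprn_gt0.
(* Chosen so that [r ^+ (2 n) >= (n d) ^+ 2 > 9 n >= 1 + 8 n], against the hypothesis at the
   exponent [2 n]. *)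
pose k := Num.bound (9 / d ^+ 2); pose n := (2 ^ k)%N.
have kn : 9 / d ^+ 2 < n%:R.
  apply: (lt_trans (archi_boundP _)); first by rewrite divr_ge0 // ltW.
  by rewrite ltr_nat -/k /n ltn_expl.
have n9 : 9 < n%:R * d ^+ 2 by rewrite -ltr_pdivrMr.
have n1 : 1 <= n%:R :> R by rewrite ler1n expn_gt0.
have := H k.+1; rewrite expnSr exprM -/n natrM.
have := bernoulli n (ltW d0); have -> : 1 + d = r by rewrite /d addrC subrK.
move=> B.
have nd : 0 <= n%:R * d by rewrite mulr_ge0 // ltW.
have rn : n%:R * d <= r ^+ n by lra.
have : (n%:R * d) ^+ 2 <= (r ^+ n) ^+ 2 by rewrite ler_pXn2r ?nnegrE ?exprn_ge0.
rewrite exprMn expr2 -mulrA; nra.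
Qed.

(* For [b = x* x] of norm at most 1 and [y = x (1 - b)^N], one has
   [y* y = b (1 - b)^(2N) <= 1]; so [b (1 - b)^(2N)] is bounded, hence
   [(1 - b)^n] grows at most linearly, which forces [1 - b] into the unit ball. *)
Lemma psd_star_mul x : psd (star x * x).
Proof.
wlog x1 : x / nr x <= 1.
  move=> H; pose s := nr x + 1; have x0 := nr_ge0 x.
  have s0 : 0 < s by rewrite ltr_wpDl.
  have /H : nr (s^-1 :*: x) <= 1.
    rewrite nr_rsc ger0_norm ?invr_ge0 ?(ltW s0) // mulrC ler_pdivrMr // mul1r.
    by rewrite lerDl.
  rewrite star_rsc -rscAl -rscAr rscA; apply: psd_rsc_inv.
  by rewrite mulr_gt0 // invr_gt0.
pose b := star x * x; rewrite -/b.
have bs : sa b := sa_star_mul x.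
have b1 : nr b <= 1 by rewrite nr_starM expr_le1 // nr_ge0.
pose w := 1 - b; have ws : sa w by apply: saB sa1 bs.
have bw : b * w = w * b by rewrite /w; ncring.
have bwX n : b * w ^+ n = w ^+ n * b by apply: commrX.
have [k [ks kb ek _]] : exists k, [/\ sa k, bicomm w k, k ^+ 2 = w + 1 :*: 1 & psd k].
  by apply: psd_sqrt_eps => //; apply: psd_1sub.
have kw : k * w = w * k by apply: kb.
have kbb : k * b = b * k by apply: kb; rewrite bw.
have kwX n : k * w ^+ n = w ^+ n * k by apply: commrX.
have bnd N : nr (b * w ^+ (2 * N)) <= 2.
  have P : psd (1 - b * w ^+ (2 * N)).
    elim: N => [|N IH]; first by rewrite muln0 expr0 mulr1; apply: psd_1sub.
    (* Since [b = 1 - w] and [k ^+ 2 = 1 + w], one has [1 - w * w = b * k ^+ 2]; passing from [N] to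
       [N.+1] therefore adds a square. *)
    have -> : 1 - b * w ^+ (2 * N.+1) = 1 - b * w ^+ (2 * N) + (b * k * w ^+ N) ^+ 2.
      have -> : (b * k * w ^+ N) ^+ 2 = b * w ^+ (2 * N) * (b * k ^+ 2).
        have bwN := bwX N; have kwN := kwX N.
        rewrite mul2n -addnn exprD; ncring_with [:: b; k].
      have -> : w ^+ (2 * N.+1) = w ^+ (2 * N) * (w * w).
        by rewrite mulnS addnC exprD expr2.
      have -> : b * k ^+ 2 = 1 - w * w by rewrite ek rsc1 /w; ncring.
      ncring.
    apply: psdD => //; apply: psd_sq.
    have bkw : b * k * w ^+ N = w ^+ N * (b * k).
      by rewrite -mulrA kwX mulrA bwX -mulrA.
    by apply: saMC => //; [exact: saMC | exact: saX].
  pose y := x * w ^+ N.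
  have yy : star y * y = b * w ^+ (2 * N).
    by rewrite /y star_mul (saX N ws) -mulrA (mulrA (star x)) -/b mulrA -bwX
               -mulrA -exprD mul2n addnn.
  have := @nr_sq_le y 1 ler01; rewrite yy rsc1 -nr_starM yy mulr1.
  exact.
have w2 : nr w <= 2.
  have := nrD 1 (- b); rewrite nrN -/w; have := nr1_le1 (A := A); lra.
have step n : nr (w ^+ n - w ^+ n.+1) <= 4.
  have e m : w ^+ m - w ^+ m.+1 = b * w ^+ m by rewrite exprS /w; ncring.
  have [m [->|->]] : exists m, n = (2 * m)%N \/ n = (2 * m).+1.
    exists n./2; have := odd_double_half n; case: (odd n) => /=; lia.
  - by rewrite e; have := bnd m; lra.
  - rewrite e exprSr mulrA; have := nrM_le (bnd m) w2; lra.
have wn n : nr (w ^+ n) <= 1 + 4 * n%:R.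
  elim: n => [|n IH]; first by rewrite expr0 mulr0 addr0 nr1_le1.
  have := nr_leB (w ^+ n.+1) (w ^+ n); rewrite nrB -natr1; have := step n; lra.
apply: (@psd_near _ 1) => //; rewrite rsc1 -/w.
by apply: linear_growth_le1 => [|n]; rewrite ?nr_ge0 // -nr_sa_pow2 // wn.
Qed.

Lemma psd_conj x z : psd z -> psd (star x * z * x).
Proof.
move=> zp; apply: (@psd_eps _ (star x * x)) => t t0.
have [k [ks _ ek _]] := psd_sqrt_eps zp t0.
have -> : star x * z * x + t :*: (star x * x) = star (k * x) * (k * x).
  rewrite star_mul ks -[RHS]mulrA [k * (k * x)]mulrA -expr2 ek mulrDl mulrDr.
  by rewrite -[_ :*: _ * _]rscAl mul1r -rscAr mulrA.
exact: psd_star_mul.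
Qed.

Lemma psd_conj_sa x z : sa x -> psd z -> psd (x * z * x).
Proof. by move=> xs /(psd_conj x); rewrite xs. Qed.

Lemma psdM x y : psd x -> psd y -> x * y = y * x -> psd (x * y).
Proof.
move=> xp yp xy; apply: (@psd_eps _ x) => t t0.
have [k [ks kb ek _]] := psd_sqrt_eps yp t0.
have -> : x * y + t :*: x = k * x * k.
  have kx : k * x = x * k by apply: kb.
  by rewrite kx -mulrA -expr2 ek mulrDr -rscAr mulr1.
exact: psd_conj_sa.
Qed.

(** [(k ^+ 2 - l ^+ 2) ^+ 2] exceeds [(k - l) ^+ 4] by [(k - l) * (4 k l) * (k - l)], which is
    positive. This continuity of square roots lets the approximate roots of [psd_sqrt_eps]
    converge. *)
Lemma nr_sub_sqrt k l : psd k -> psd l -> k * l = l * k ->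
  nr (k - l) ^+ 2 <= nr (k ^+ 2 - l ^+ 2).
Proof.
move=> kp lp kl; have ks := psd_sa kp; have ls := psd_sa lp.
have ds : sa (k - l) by apply: saB.
have ds2 : sa (k ^+ 2 - l ^+ 2) by apply: saB; apply: saX.
rewrite -(@ler_pXn2r _ 2) ?nnegrE ?exprn_ge0 ?nr_ge0 //.
rewrite -!nr_sa_sq //; last exact: saX.
set s := (X in _ <= X); apply: psd_le_norm; first exact: nr_ge0.
- by apply: psd_sq; apply: saX.
- have -> : s :*: 1 - ((k - l) ^+ 2) ^+ 2 = (s :*: 1 - (k ^+ 2 - l ^+ 2) ^+ 2) +
      (k - l) * (k * l + k * l + k * l + k * l) * (k - l).
    have -> : (k ^+ 2 - l ^+ 2) ^+ 2 = ((k - l) ^+ 2) ^+ 2 +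
        (k - l) * (k * l + k * l + k * l + k * l) * (k - l).
      ncring_with [:: k; l].
    by rewrite opprD addrA subrK.
  apply: psdD; last by apply: psd_conj_sa => //; do ?apply: psdD; apply: psdM.
  by apply: psd_sub; [apply: saX | exact: lexx].
Qed.

Lemma psd_sqrt x : psd x -> exists k, [/\ psd k, bicomm x k & k ^+ 2 = x].
Proof.
move=> xp; have pos n : 0 < n.+1%:R^-1 :> R by rewrite invr_gt0.
have /choice[k kP] n := psd_sqrt_eps xp (pos n).
have [l kl] : exists l, slim k l.
  apply: slim_cauchy => e e0.
  have e22 : 0 < e ^+ 2 / 2 by rewrite divr_gt0 // exprn_gt0.
  have [M HM] := slim_harmonic 1 e22; exists M => m n /HM Hm /HM Hn.
  have [ms mb em mp] := kP m; have [ns nb en np] := kP n.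
  have xn : x * k n = k n * x by apply/esym; apply: nb.
  rewrite -(@ltr_pXn2r _ 2) ?nnegrE ?nr_ge0 ?(ltW e0) //.
  apply: (le_lt_trans (nr_sub_sqrt mp np (mb _ xn))).
  rewrite em en opprD addrACA subrr add0r.
  rewrite !subr0 in Hm Hn; have := nrD (m.+1%:R^-1 :*: (1 : A)) (- (n.+1%:R^-1 :*: 1)).
  rewrite nrN; lra.
exists l; split.
- by apply: psd_slim kl => n; case: (kP n).
- move=> z xz; apply: (slim_unique (slimMr z kl)).
  by apply: slim_ext (slimMl z kl) => n; case: (kP n) => _ /(_ z xz).
- apply: (slim_unique (slimX 2 kl)).
  rewrite -[X in slim _ X]addr0.
  apply: slim_ext (slimD (slim_cst x) (slim_harmonic 1)) => n.
  by case: (kP n).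
Qed.

(** With [a] the absolute value of [b], [q = a + b] is twice the positive part. It replaces a
    spectral projection: cutting down by [q] sees only the part where [b] is positive. *)
Lemma pos_part b : sa b -> ~ psd (- b) ->
  exists q, [/\ sa q, psd (q * b * q) & q * b * q <> 0].
Proof.
move=> bs nb; have [a [ap ab ea]] := psd_sqrt (psd_sq bs).
have as_ := psd_sa ap.
have ba : b * a = a * b by apply/esym; apply: ab; rewrite expr2 mulrA.
pose q := a + b; have qs : sa q by apply: saD.
have aq : a * q = b * q by rewrite /q !mulrDr -!expr2 ea ba addrC.
have qbq : q * b * q = q * a * q by rewrite -!mulrA aq.
exists q; split=> //; rewrite qbq; first exact: psd_conj_sa.
have [k [kp _ ek]] := psd_sqrt ap => q0.
have kq : k * q = 0.
  apply/nr0_eq0/eqP; rewrite -sqrf_eq0 -nr_starM star_mul (psd_sa kp) qs.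
  by rewrite -mulrA (mulrA k) -expr2 ek mulrA q0 nr0.
have aq0 : a * q = 0 by rewrite -ek expr2 -mulrA kq mulr0.
have {}q0 : q = 0.
  apply/nr0_eq0/eqP; rewrite -sqrf_eq0 -nr_sa_sq //.
  by rewrite expr2 {1}/q mulrDl -aq aq0 addr0 nr0.
by apply: nb; move/eqP: q0; rewrite /q addrC addr_eq0 => /eqP ->; rewrite opprK.
Qed.

Lemma psd_invsqrt x s : 0 < s -> psd (x - s :*: 1) ->
  exists g, sa g /\ g * x * g = 1.
Proof.
move=> s0 xp; have [t0 /(_ (Num.max t0 0))] := psd_up xp.
rewrite le_max lexx => /(_ isT); set t := Num.max t0 0 => xt.
have t_ge0 : 0 <= t by rewrite le_max lexx orbT.
have st0 : 0 < t + s by rewrite ltr_wpDl.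
have stN0 : t + s != 0 by rewrite gt_eqF.
have xs : sa x.
  have -> : x = (x - s :*: 1) + s :*: 1 by rewrite subrK.
  by apply: saD (psd_sa xp) _; apply: sa_rsc sa1.
pose h := 1 - (t + s)^-1 :*: x.
have hs : sa h by apply: saB sa1 _; apply: sa_rsc.
have eh : h = (t + s)^-1 :*: (t :*: 1 - (x - s :*: 1)).
  by rewrite opprB addrA -rscDl rscBr rscA mulVf // rsc1.
have h1 : nr h < 1.
  rewrite eh nr_rsc ger0_norm ?invr_ge0 ?(ltW st0) // mulrC ltr_pdivrMr // mul1r.
  by rewrite (le_lt_trans xt) // ltrDl.
have [y [ys y1 yb ey]] := sqrt_small h1 hs.
have [g [g1 g2 _]] := neumann (le_lt_trans y1 h1).
have gs : sa g.
  have sg : star g * (1 - y) = 1.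
    by rewrite -[1 - y](saB sa1 ys) -star_mul g1 star1.
  by rewrite /sa -[LHS]mulr1 -g1 mulrA sg mul1r.
have [q q0 qq] : exists2 q, 0 < q & q ^+ 2 = t + s.
  by exists (Num.sqrt (t + s)); rewrite ?sqrtr_gt0 // sqr_sqrtr // ltW.
exists (q^-1 :*: g); split; first exact: sa_rsc.
have -> : x = (t + s) :*: (1 - y) ^+ 2.
  by rewrite ey /h opprB addrCA subrr addr0 rscA mulfV // rsc1.
rewrite -rscAl -!rscAr -rscAl -[(t + s) :*: _ * _]rscAl !rscA expr2.
rewrite [X in X :*: _](_ : _ = 1); last by rewrite -qq; field; rewrite gt_eqF.
by rewrite rsc1 mulrA g2 mul1r g1.
Qed.

End CStarBasics.

(** * Homomorphisms, unitaries and paths *)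

Section Homomorphism.
Context {R : realType} {A B : cstarAlgType R} {f : A -> B}.
Hypothesis hf : unital_starhom f.
Implicit Types x y : A.

Lemma homD x y : f (x + y) = f x + f y.
Proof. by case: hf => fl _ _; have := fl 1 x y; rewrite !scale1r. Qed.
Lemma hom0 : f 0 = 0.
Proof. by apply: (addIr (f 0)); rewrite add0r -homD addr0. Qed.
Lemma homN x : f (- x) = - f x.
Proof. by apply: (addIr (f x)); rewrite -homD !addNr hom0. Qed.
Lemma homB x y : f (x - y) = f x - f y.
Proof. by rewrite homD homN. Qed.
Lemma homZ (c : R[i]) x : f (c *: x) = c *: f x.
Proof. by case: hf => fl _ _; have := fl c x 0; rewrite !addr0 hom0 addr0. Qed.
Lemma hom_rsc (t : R) x : f (t :*: x) = t :*: f x.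
Proof. exact: homZ. Qed.
Lemma hom1 : f 1 = 1.
Proof. by case: hf => _ [-> _] _. Qed.
Lemma homM x y : f (x * y) = f x * f y.
Proof. by case: hf => _ [_ fM] _; apply: fM. Qed.
Lemma hom_star x : f (star x) = star (f x).
Proof. by case: hf => _ _ fs; apply: fs. Qed.
Lemma hom_sum I (r : seq I) (F : I -> A) :
  f (\sum_(i <- r) F i) = \sum_(i <- r) f (F i).
Proof. exact: (big_morph _ homD hom0). Qed.
Lemma hom_sa x : sa x -> sa (f x).
Proof. by rewrite /sa -hom_star => ->. Qed.

(* If [h] is self-adjoint of norm < 1 then [1 - h^2] is a square [k^2], and
   [f h ^2 + f k ^2 = 1] bounds [f h]. *)
Lemma nr_hom x : nr (f x) <= nr x.
Proof.
have small y : nr y < 1 -> nr (f y) <= 1.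
  move=> y1; pose h := star y * y; have hs : sa h := sa_star_mul y.
  have h1 : nr h < 1 by rewrite nr_starM expr_lt1 ?nr_ge0.
  have h2 : nr (h ^+ 2) < 1 by rewrite nr_sa_sq // expr_lt1 ?nr_ge0.
  have [z [zs _ zb ez]] := sqrt_small h2 (saX 2 hs).
  have hz : h * z = z * h by apply/esym/zb; rewrite expr2 mulrA.
  have fhz : f h * f (1 - z) = f (1 - z) * f h.
    by rewrite -!homM mulrBr mulrBl mulr1 mul1r hz.
  have := arens (hom_sa hs) (hom_sa (saB sa1 zs)) fhz.
  rewrite !expr2 -!homM -homD -!expr2 ez addrC subrK hom1 => H.
  have {H} := le_trans H nr1_le1; rewrite expr_le1 ?nr_ge0 //.
  by rewrite /h homM hom_star nr_starM expr_le1 // nr_ge0.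
apply/ler_addgt0Pr => e e0; pose s := nr x + e.
have s0 : 0 < s by rewrite ltr_wpDl ?nr_ge0.
have /small : nr (s^-1 :*: x) < 1.
  rewrite nr_rsc ger0_norm ?invr_ge0 ?(ltW s0) // mulrC ltr_pdivrMr // mul1r.
  by rewrite ltrDl.
by rewrite hom_rsc nr_rsc ger0_norm ?invr_ge0 ?(ltW s0) // mulrC ler_pdivrMr // mul1r.
Qed.

Lemma hom_slim u l : slim u l -> slim (fun n => f (u n)) (f l).
Proof.
move=> ul e /ul[N HN]; exists N => n /HN; apply: le_lt_trans.
by rewrite -homB nr_hom.
Qed.

Lemma hom_unitary x : unitary x -> unitary (f x).
Proof. by case=> e1 e2; split; rewrite -hom_star -homM ?e1 ?e2 hom1. Qed.

End Homomorphism.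

Section UnitaryEquivalence.
Context {R : realType}.
Implicit Types A B C : cstarAlgType R.

Lemma hom_comp A B C (f : A -> B) (g : B -> C) :
  unital_starhom f -> unital_starhom g -> unital_starhom (g \o f).
Proof.
move=> hf hg; split=> [a x y|| x] /=.
- by rewrite (homD hf) (homZ hf) (homD hg) (homZ hg).
- by split=> [|x y] /=; rewrite ?(hom1 hf) ?(hom1 hg) // (homM hf) (homM hg).
- by rewrite (hom_star hf) (hom_star hg).
Qed.

Lemma hom_id A : unital_starhom (@id A).
Proof. by split. Qed.

Lemma hom_inv A B (f : A -> B) g : unital_starhom f -> cancel f g -> cancel g f ->
  unital_starhom g.
Proof.
move=> hf fg gf; split=> [a x y|| x].
- by rewrite -[RHS]fg (homD hf) (homZ hf) !gf.
- by split=> [|x y]; rewrite -[RHS]fg ?(hom1 hf) // (homM hf) !gf.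
- by rewrite -[RHS]fg (hom_star hf) gf.
Qed.

Lemma unitary1 A : unitary (1 : A).
Proof. by split; rewrite star1 mulr1. Qed.

Lemma unitaryM A (u v : A) : unitary u -> unitary v -> unitary (u * v).
Proof.
case=> u1 u2 [v1 v2]; split; rewrite star_mul.
- by rewrite -mulrA (mulrA (star u)) u1 mul1r.
- by rewrite -mulrA (mulrA v) v2 mul1r.
Qed.

Lemma unitary_star A (u : A) : unitary u -> unitary (star u).
Proof. by case=> u1 u2; split; rewrite starK. Qed.

Lemma nr_unitary A (u : A) : unitary u -> nr u <= 1.
Proof.
case=> u1 _; rewrite -(@ler_pXn2r _ 2) ?nnegrE ?nr_ge0 // -nr_starM u1.
by rewrite expr1n nr1_le1.
Qed.

Lemma nr_unitaryl A (u x : A) : unitary u -> nr (u * x) = nr x.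
Proof.
move=> uu; apply/eqP; rewrite eq_le.
have le v y : unitary v -> nr (v * y) <= nr y :> R.
  move=> /nr_unitary v1; apply: (le_trans (nrM _ _)).
  by rewrite ler_piMl ?nr_ge0.
rewrite le //=; case: (uu) => u1 _.
by rewrite -{1}[x]mul1r -u1 -mulrA le //; apply: unitary_star.
Qed.

Lemma nr_unitaryr A (u x : A) : unitary u -> nr (x * u) = nr x.
Proof. by move=> uu; rewrite -nr_star star_mul nr_unitaryl ?nr_star //; apply: unitary_star. Qed.

Lemma nr_unitary_conj A (u x : A) : unitary u -> nr (u * x * star u) = nr x.
Proof. by move=> uu; rewrite nr_unitaryr ?nr_unitaryl //; apply: unitary_star. Qed.

Lemma unitary_swap A (u x y : A) : unitary u ->
  nr (u * x * star u - y) = nr (u * x - y * u).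
Proof.
move=> uu; rewrite -(nr_unitaryr (u * x * star u - y) uu) mulrBl.
by case: uu => u1 _; rewrite -(mulrA (u * x)) u1 mulr1.
Qed.

Lemma unitary_swapV A (u x y : A) : unitary u ->
  nr (u * x * star u - y) = nr (star u * y * u - x).
Proof.
move=> uu; rewrite -(nr_unitary_conj (star u * y * u - x) uu) nrB; congr nr.
case: uu => u1 u2; rewrite mulrBr mulrBl -!mulrA u2 mulr1.
by rewrite !mulrA u2 mul1r.
Qed.

Definition aue A B (s g : A -> B) : Prop :=
  exists u : nat -> B, (forall n, unitary (u n)) /\
    forall c, slim (fun n => u n * s c * star (u n)) (g c).

Lemma aueP A B (s g : A -> B) : approx_unitary_equiv s g <-> aue s g.
Proof. by split=> -[u [uu us]]; exists u; split=> // c; apply/slimP; apply: us. Qed.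

Lemma aue_sym A B (s g : A -> B) : aue s g -> aue g s.
Proof.
case=> u [uu us]; exists (star \o u); split=> [n|c e /(us c)[N HN]] /=.
  exact: unitary_star.
by exists N => n /HN; rewrite starK unitary_swapV.
Qed.

Lemma aue_trans A B (s g h : A -> B) : aue s g -> aue g h -> aue s h.
Proof.
move=> [u [uu us]] [v [vv vg]]; exists (fun n => v n * u n); split.
  by move=> n; apply: unitaryM.
move=> c e e0; have e2 : 0 < e / 2 by rewrite divr_gt0.
have [N1 H1] := us c _ e2; have [N2 H2] := vg c _ e2.
exists (maxn N1 N2) => n; rewrite geq_max => /andP[/H1 un /H2 vn].
apply: (le_lt_trans (nr_triangle (v n * g c * star (v n)) _ _)).
have -> : v n * u n * s c * star (v n * u n) - v n * g c * star (v n)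
    = v n * (u n * s c * star (u n) - g c) * star (v n) by rewrite star_mul; ncring.
by rewrite nr_unitary_conj // [e]splitr ltrD.
Qed.

Lemma aue_postcomp A B C (s g : A -> B) (f : B -> C) :
  unital_starhom f -> aue s g -> aue (f \o s) (f \o g).
Proof.
move=> hf [u [uu us]]; exists (f \o u); split=> [n|c] /=; first exact: hom_unitary.
by apply: slim_ext (hom_slim hf (us c)) => n; rewrite !(homM hf) (hom_star hf).
Qed.

Lemma aue_precomp A B C (s g : B -> C) (f : A -> B) :
  aue s g -> aue (s \o f) (g \o f).
Proof. by case=> u [uu us]; exists u; split=> // c; apply: us. Qed.

Lemma slim_finite A C (u : C -> nat -> A) (l : C -> A) (F : seq C) (e : R) :
  (forall c, slim (u c) (l c)) -> 0 < e ->
  exists N, forall n, (N <= n)%N -> forall i, (i < size F)%N -> forall x0,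
    nr (u (nth x0 F i) n - l (nth x0 F i)) < e.
Proof.
move=> ul e0; elim: F => [|c F [N HN]]; first by exists 0%N.
have [M HM] := ul c e e0; exists (maxn N M) => n; rewrite geq_max => /andP[Nn Mn].
by case=> [|i] iF x0 /=; [apply: HM | apply: HN].
Qed.

Lemma slim_finite_in (A C : cstarAlgType R) (u : C -> nat -> A) (l : C -> A)
    (F : seq C) (e : R) :
  (forall c, slim (u c) (l c)) -> 0 < e ->
  exists N, forall n, (N <= n)%N -> forall c, c \in F -> nr (u c n - l c) < e.
Proof.
move=> ul e0; have [N HN] := slim_finite F ul e0; exists N => n Nn c cF.
by have := HN n Nn (index c F); rewrite index_mem => /(_ cF c); rewrite nth_index.
Qed.

Lemma aue_finite A B (s g : A -> B) (F : seq A) (e : R) : aue s g -> 0 < e ->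
  exists2 u, unitary u & forall c, c \in F -> nr (u * s c * star u - g c) < e.
Proof.
move=> [u [uu us]] e0; have [N HN] := slim_finite_in F us e0.
by exists (u N) => //; apply: HN.
Qed.

End UnitaryEquivalence.

(** * Continuous paths of unitaries *)

Section Paths.
Context {R : realType}.
Implicit Types A B : cstarAlgType R.

Definition ccont A (c : R -> A) : Prop := forall t (e : R), 0 < e ->
  exists2 d : R, 0 < d & forall s, `|s - t| < d -> nr (c s - c t) < e.

(** A path lives on the whole line and is constant outside [[0, 1]]. Paths are then glued by adding
    reparametrised copies and subtracting the common endpoint, so continuity needs no case
    analysis. *)
Definition pathin A (S : A -> Prop) (a b : A) : Prop := exists c : R -> A,
  [/\ ccont c, forall t, t <= 0 -> c t = a, forall t, 1 <= t -> c t = b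
    & forall t, S (c t)].

Lemma ccont_cst A (a : A) : ccont (fun=> a).
Proof. by move=> t e e0; exists 1 => // s _; rewrite subrr nr0. Qed.

Lemma ccont_ext A (c d : R -> A) : (forall t, c t = d t) -> ccont c -> ccont d.
Proof. by move=> cd cc t e /(cc t)[r r0 H]; exists r => // s /H; rewrite !cd. Qed.

Lemma ccont_local A (c : R -> A) (b : R -> R -> A) :
  (forall t, ccont (b t)) ->
  (forall t, exists2 d, 0 < d & forall s, `|s - t| < d -> c s = b t s) -> ccont c.
Proof.
move=> bc cb t e e0; have [d d0 Hd] := cb t; have [r r0 Hr] := bc t t e e0.
exists (Num.min d r); first by rewrite lt_min d0 r0.
move=> s; rewrite lt_min => /andP[sd sr].
by rewrite !Hd ?subrr ?normr0 //; apply: Hr.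
Qed.

Lemma ccontD A (c d : R -> A) : ccont c -> ccont d -> ccont (fun t => c t + d t).
Proof.
move=> cc dc t e e0; have e2 : 0 < e / 2 by rewrite divr_gt0.
have [r r0 H] := cc t _ e2; have [q q0 K] := dc t _ e2.
exists (Num.min r q); first by rewrite lt_min r0 q0.
move=> s; rewrite lt_min => /andP[/H sr /K sq].
by rewrite opprD addrACA; apply: (le_lt_trans (nrD _ _)); lra.
Qed.

Lemma ccont_sum A I (r : seq I) (c : I -> R -> A) :
  (forall i, ccont (c i)) -> ccont (fun t => \sum_(i <- r) c i t).
Proof.
move=> cc; elim: r => [|i r IH].
  by apply: ccont_ext (ccont_cst 0) => t; rewrite big_nil.
by apply: ccont_ext (ccontD (cc i) IH) => t; rewrite big_cons.
Qed.

Lemma ccont_lip A B (f : A -> B) k (c : R -> A) :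
  (forall x y, nr (f x - f y) <= k * nr (x - y)) -> ccont c -> ccont (f \o c).
Proof.
move=> fl cc t e e0; have k0 : 0 < `|k| + 1 by rewrite ltr_wpDl.
have [d d0 H] := cc t (e / (`|k| + 1)) (divr_gt0 e0 k0).
exists d => // s /H; rewrite ltr_pdivlMr // => Hs /=.
apply: (le_lt_trans (fl _ _)); apply: le_lt_trans Hs.
rewrite mulrC ler_wpM2l ?nr_ge0 //.
by apply: (le_trans (ler_norm k)); rewrite lerDl.
Qed.

Lemma ccontM A (c d : R -> A) : ccont c -> ccont d -> ccont (fun t => c t * d t).
Proof.
move=> cc dc t e e0; pose k := nr (c t) + nr (d t) + 1.
have c0 := nr_ge0 (c t); have d0 := nr_ge0 (d t).
have k0 : 0 < k by rewrite /k; lra.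
have e2 : 0 < Num.min 1 (e / 2 / k) by rewrite lt_min ltr01 !divr_gt0.
have [r r0 H] := cc t _ e2; have [q q0 K] := dc t _ e2.
exists (Num.min r q); first by rewrite lt_min r0 q0.
move=> s; rewrite lt_min => /andP[/H sr /K sq].
move: sr sq; rewrite !lt_min !ltr_pdivlMr // => /andP[s1 s2] /andP[s3 s4].
have -> : c s * d s - c t * d t = c s * (d s - d t) + (c s - c t) * d t by ncring.
have ck : nr (c s) <= k by have := nr_leB (c s) (c t); rewrite /k; lra.
have dk : nr (d t) <= k by rewrite /k; lra.
have := nrD_le (nrM_le ck (lexx (nr (d s - d t)))) (nrM_le (lexx (nr (c s - c t))) dk).
rewrite (mulrC k) => H1; lra.
Qed.

Lemma ccont_affine A (c : R -> A) a b : ccont c -> ccont (fun t => c (a * t + b)).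
Proof.
move=> cc t e e0; have [d d0 H] := cc (a * t + b) e e0.
have a0 : 0 < `|a| + 1 by rewrite ltr_wpDl.
exists (d / (`|a| + 1)); first by rewrite divr_gt0.
move=> s; rewrite ltr_pdivlMr // => st; apply: H.
have -> : a * s + b - (a * t + b) = a * (s - t) by ring.
rewrite normrM; apply: le_lt_trans st; rewrite mulrC ler_wpM2l // lerDl //.
Qed.

Lemma pathin_refl A (S : A -> Prop) a : S a -> pathin S a a.
Proof. by move=> Sa; exists (fun=> a); split=> //; apply: ccont_cst. Qed.

Lemma pathin_weaken A (S T : A -> Prop) a b :
  (forall x, S x -> T x) -> pathin S a b -> pathin T a b.
Proof. by move=> ST [c [cc c0 c1 cS]]; exists c; split=> // t; apply: ST. Qed.

Lemma pathin_end A (S : A -> Prop) a b : pathin S a b -> S b.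
Proof. by case=> c [_ _ c1 cS]; rewrite -(c1 1). Qed.

Lemma pathin_trans A (S : A -> Prop) a b d : pathin S a b -> pathin S b d -> pathin S a d.
Proof.
move=> [c1 [cc1 c10 c11 cS1]] [c2 [cc2 c20 c21 cS2]].
pose c t := c1 (2 * t + 0) + c2 (2 * t - 1) - b.
have cl t : t <= 2^-1 -> c t = c1 (2 * t).
  by move=> t2; rewrite /c addr0 c20 ?addrK //; lra.
have cr t : 2^-1 <= t -> c t = c2 (2 * t - 1).
  by move=> t2; rewrite /c addr0 c11 ?[b + _]addrC ?addrK //; lra.
exists c; split.
- by apply: ccontD (ccont_cst (- b)); apply: ccontD; apply: ccont_affine.
- by move=> t t0; rewrite cl ?c10 //; lra.
- by move=> t t1; rewrite cr ?c21 //; lra.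
- by move=> t; case: (lerP t 2^-1) => [/cl ->|/ltW/cr ->].
Qed.

Lemma pathin_map A B (f : A -> B) k (S : A -> Prop) (T : B -> Prop) a b :
  (forall x y, nr (f x - f y) <= k * nr (x - y)) -> (forall x, S x -> T (f x)) ->
  pathin S a b -> pathin T (f a) (f b).
Proof.
move=> fl ST [c [cc c0 c1 cS]]; exists (f \o c); split=> /=.
- exact: ccont_lip cc.
- by move=> t /c0 ->.
- by move=> t /c1 ->.
- by move=> t; apply: ST.
Qed.

(* The Cayley transform [2 (1 - t k)^-1 - 1], [k] skew-adjoint, runs through
   unitaries from 1 at t = 0 to [v] at t = 1 when [k = 1 - 2 (1 + v)^-1]. *)
Lemma cayley_path A (v : A) : unitary v -> nr (v - 1) <= 2^-1 ->
  pathin (fun y => unitary y /\ nr (y - 1) <= 2 * nr (v - 1)) 1 v.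
Proof.
move=> [v1 v2] vn; set d := nr (v - 1) in vn *; have d0 : 0 <= d := nr_ge0 _.
pose h := 2^-1 :*: (1 - v).
have half0 : 0 <= (2^-1 : R) by rewrite invr_ge0.
have hd : nr h = 2^-1 * d by rewrite nr_rsc nrB ger0_norm.
have h4 : nr h <= 4^-1 by rewrite hd; lra.
have h1 : nr h < 1 by lra.
have [g [g1 g2 gn]] := neumann h1.
have hv : 1 - h = 2^-1 :*: (1 + v).
  rewrite /h -{1}(rsc_half 1) -rscBr; congr (_ :*: _); ncring.
pose w := 2^-1 :*: g.
have w1 : (1 + v) * w = 1 by rewrite /w -rscAr rscAl -hv.
have w2 : w * (1 + v) = 1 by rewrite /w -rscAl rscAr -hv.
have wn : nr w <= 2 / 3.
  have : (1 - nr h)^-1 <= (3 / 4)^-1 by rewrite lef_pV2 ?posrE; lra.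
  rewrite /w nr_rsc ger0_norm //; have -> : (3 / 4)^-1 = 4 / 3 :> R by field.
  lra.
pose k := 1 - (w + w).
have ek : k = w * (v - 1).
  have e : w * v = 1 - w by rewrite -w2; ncring.
  by rewrite mulrBr mulr1 e /k; ncring.
have kd : nr k <= 2 / 3 * d by rewrite ek; apply: nrM_le.
have k3 : nr k <= 3^-1 by apply: (le_trans kd); lra.
have vw : v * w = w * v.
  apply/esym/(@inv_comm _ _ (1 + v)) => //; ncring.
have ks : star k = - k.
  have sw : star w = w * v.
    have e : star w * (1 + star v) = 1 by rewrite -{1}star1 -starD -star_mul w1 star1.
    have e2 : (1 + star v) * (w * v) = 1.
      have -> : 1 + star v = star v * (1 + v) by rewrite mulrDr mulr1 v1 addrC.
      by rewrite -mulrA (mulrA (1 + v)) w1 mul1r v1.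
    by rewrite -[star w]mulr1 -e2 mulrA e mul1r.
  rewrite /k starB starD star1 sw.
  have -> : w * v = 1 - w by rewrite -w2; ncring.
  ncring.
have /choice[G GP] t : exists g, 0 <= t <= 1 ->
    [/\ (1 - t :*: k) * g = 1, g * (1 - t :*: k) = 1 & nr g <= 3 / 2].
  (* The value 0 chosen outside [[0, 1]] is never reached, because the path evaluates [G] at the
     clamped parameter [cl t]. *)
  case: (boolP (0 <= t <= 1)) => [/andP[t0 t1]|_]; last by exists 0.
  have tk : nr (t :*: k) <= 3^-1.
    by rewrite nr_rsc ger0_norm //; apply: le_trans k3; rewrite ler_piMl ?nr_ge0.
  have tk1 : nr (t :*: k) < 1 by lra.
  have [b [b1 b2 bn]] := neumann tk1; exists b => _; split=> //.
  apply: (le_trans bn); have -> : 3 / 2 = (2 / 3)^-1 :> R by field.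
  by rewrite lef_pV2 ?posrE; lra.
pose cl t : R := Num.max 0 (Num.min 1 t).
have cl01 t : 0 <= cl t <= 1.
  by rewrite /cl le_max lexx /= ge_max ler01 /= ge_min lexx.
have cl_le t : t <= 0 -> cl t = 0.
  move=> t0; rewrite /cl max_l // ge_min t0 orbT //.
have cl_ge t : 1 <= t -> cl t = 1 by move=> t1; rewrite /cl min_l // max_r.
have cl_lip s t : `|cl s - cl t| <= `|s - t|.
  have clE r : [\/ r <= 0 /\ cl r = 0, 1 <= r /\ cl r = 1 | 0 <= r <= 1 /\ cl r = r].
    case: (lerP r 0) => r0; first by constructor 1; rewrite cl_le.
    case: (lerP 1 r) => r1; first by constructor 2; rewrite cl_ge.
    by constructor 3; rewrite !ltW //= /cl min_r ?max_r // ltW.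
  have n1 := ler_norm (s - t); have n2 := ler_norm (t - s).
  rewrite distrC in n2; have n0 := normr_ge0 (s - t).
  by case: (clE s) => -[sb ->]; case: (clE t) => -[tb ->];
    rewrite ler_norml; apply/andP; clear -sb tb n0 n1 n2; split; lra.
pose c t := G (cl t) + G (cl t) - 1.
have k0 := nr_ge0 k.
exists c; split.
- suff Gc : ccont (G \o cl).
    by apply: ccontD (ccont_cst (- 1)); apply: ccontD.
  move=> t e e0; exists e => // s st /=.
  have [s1 s2 sn] := GP _ (cl01 s); have [t1 t2 tn] := GP _ (cl01 t).
  (* The resolvent identity gives the Lipschitz constant [3 / 2 * 3^-1 * (3 / 2) = 3 / 4], so [e]
     itself serves as modulus of continuity. *)
  have -> : G (cl s) - G (cl t) = G (cl s) * ((cl s - cl t) :*: k) * G (cl t).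
    have -> : (cl s - cl t) :*: k = (1 - cl t :*: k) - (1 - cl s :*: k).
      by rewrite rscBl; ncring.
    by rewrite mulrBr mulrBl s2 -mulrA t1 mulr1 mul1r.
  have Kn : nr ((cl s - cl t) :*: k) <= `|s - t| * 3^-1.
    by rewrite nr_rsc; apply: ler_pM => //.
  have := nrM_le (nrM_le sn Kn) tn; set q := `|s - t| in st *.
  have q0 : 0 <= q := normr_ge0 _.
  lra.
- move=> t /cl_le e; have [] := GP 0; first by rewrite lexx ler01.
  by rewrite rsc0 subr0 mul1r => g01 _ _; rewrite /c e g01 addrK.
- move=> t /cl_ge e; have [] := GP 1; first by rewrite lexx ler01.
  rewrite rsc1 => a1 a2 _; rewrite /c e.
  have ew : 1 - k = w + w by rewrite /k; ncring.
  have -> : G 1 + G 1 = (1 + v) * w * G 1 + (1 + v) * w * G 1 by rewrite w1 mul1r.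
  have -> : (1 + v) * w * G 1 + (1 + v) * w * G 1 = (1 + v) * ((w + w) * G 1) by ncring.
  by rewrite -ew a1 mulr1 addrC addKr.
- move=> t; have [a1 a2 an] := GP _ (cl01 t); have /andP[s0 s1] := cl01 t.
  rewrite /c; set s := cl t in s0 s1 a1 a2 an *; set b := G s in a1 a2 an *.
  pose x := s :*: k; rewrite -/x in a1 a2.
  have xs : star x = - x by rewrite /x star_rsc ks rscNr.
  have b1 : star b * (1 + x) = 1.
    by rewrite -[x]opprK -xs -star1 -starB -star_mul a1 star1.
  have b2 : (1 + x) * star b = 1.
    by rewrite -[x]opprK -xs -star1 -starB -star_mul a2 star1.
  have e1 : star b + b = star b * b + star b * b.
    have -> : star b * b + star b * b
        = star b * ((1 - x) * b) + (star b * (1 + x)) * b by ncring.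
    by rewrite a1 b1 mulr1 mul1r.
  have e2 : star b + b = b * star b + b * star b.
    have -> : b * star b + b * star b
        = (b * (1 - x)) * star b + b * ((1 + x) * star b) by ncring.
    by rewrite a2 b2 mulr1 mul1r.
  have sc : star (b + b - 1) = star b + star b - 1 by rewrite starB starD star1.
  split; first split; rewrite ?sc.
  + have -> : (star b + star b - 1) * (b + b - 1) = (star b * b + star b * b)
        + (star b * b + star b * b) - (star b + b) - (star b + b) + 1 by ncring.
    by rewrite -e1; ncring.
  + have -> : (b + b - 1) * (star b + star b - 1) = (b * star b + b * star b)
        + (b * star b + b * star b) - (star b + b) - (star b + b) + 1 by ncring.
    by rewrite -e2; ncring.
  + have -> : b + b - 1 - 1 = x * b + x * b.
      by rewrite -{1 2}a1; ncring.
    have xn : nr x <= 2 / 3 * d.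
      by rewrite /x nr_rsc ger0_norm //; apply: le_trans kd; rewrite ler_piMl.
    have := nrD_le (nrM_le xn an) (nrM_le xn an); lra.
Qed.

Lemma short_path A (a b : A) : unitary a -> unitary b -> nr (b - a) <= 2^-1 ->
  pathin (fun y => unitary y /\ nr (y - a) <= 2 * nr (b - a)) a b.
Proof.
move=> ua ub ab; pose v := star a * b.
have va : nr (v - 1) = nr (b - a).
  case: (ua) => a1 _; rewrite /v -a1 -mulrBr nr_unitaryl //.
  exact: unitary_star.
have uv : unitary v by apply: unitaryM ub; apply: unitary_star.
have av : a * v = b by rewrite /v mulrA; case: ua => _ ->; rewrite mul1r.
rewrite -va in ab *; have H := cayley_path uv ab.
suff : pathin (fun y => unitary y /\ nr (y - a) <= 2 * nr (v - 1)) (a * 1) (a * v).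
  by rewrite mulr1 av.
apply: (@pathin_map _ _ ( *%R a) 1 _ _ _ _ _ _ H).
- by move=> x y; rewrite -mulrBr nr_unitaryl // mul1r.
- move=> x [ux x1]; split; first exact: unitaryM.
  by rewrite -{2}[a]mulr1 -mulrBr nr_unitaryl.
Qed.

End Paths.

(** * The path component of 1 *)

Section UnitaryComponent.
Context {R : realType}.
Implicit Types A B : cstarAlgType R.

Definition uconn A (u : A) : Prop := pathin (@unitary R A) 1 u.

Lemma uconn_unitary A (u : A) : uconn u -> unitary u.
Proof. exact: pathin_end. Qed.

Lemma uconn1 A : uconn (1 : A).
Proof. exact/pathin_refl/unitary1. Qed.

Lemma uconnM A (u v : A) : uconn u -> uconn v -> uconn (u * v).
Proof.
move=> [c [cc c0 c1 cS]] [d [dc d0 d1 dS]]; exists (fun t => c t * d t); split.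
- exact: ccontM.
- by move=> t t0; rewrite c0 // d0 // mulr1.
- by move=> t t1; rewrite c1 // d1.
- by move=> t; apply: unitaryM.
Qed.

Lemma uconn_star A (u : A) : uconn u -> uconn (star u).
Proof.
rewrite /uconn -{2}(star1 (A := A)); apply: (@pathin_map _ _ _ _ 1).
- by move=> x y; rewrite -starB nr_star mul1r.
- by move=> x; apply: unitary_star.
Qed.

Lemma uconn_hom A B (f : A -> B) u : unital_starhom f -> uconn u -> uconn (f u).
Proof.
move=> hf; rewrite /uconn -(hom1 hf); apply: (@pathin_map _ _ _ _ 1).
- by move=> x y; rewrite -(homB hf) mul1r nr_hom.
- by move=> x; apply: hom_unitary.
Qed.

Lemma uconn_conj A (w u : A) : unitary w -> uconn u -> uconn (w * u * star w).
Proof.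
move=> uw; have e : w * 1 * star w = 1 by case: uw => _; rewrite mulr1.
rewrite /uconn -{2}e; apply: (@pathin_map _ _ _ (fun x => w * x * star w) 1).
- by move=> x y; rewrite mul1r -mulrBl -mulrBr nr_unitary_conj.
- move=> x ux; apply: unitaryM; last exact: unitary_star.
  exact: unitaryM.
Qed.

Lemma uconn_close A (u v : A) : uconn u -> unitary v -> nr (v - u) <= 2^-1 -> uconn v.
Proof.
move=> cu uv vu; apply: (pathin_trans cu).
have uu := uconn_unitary cu.
by apply: pathin_weaken (short_path uu uv vu) => x [].
Qed.

Lemma nball_open A (u : A) (r : R) : 0 < r -> open [set x | nr (u - x) < r].
Proof.
move=> r0; have -> : [set x | nr (u - x) < r] = ball u r%:C.
  by apply/seteqP; split=> x /=; rewrite -ball_normE /= nrE ltcR.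
by apply: ball_open; rewrite ltcR.
Qed.

(* Unitaries at distance at most 1/2 are joined by a path, so the set of
   unitaries joined to 1 is relatively open and closed. *)
Lemma unitary0_uconn A (u : A) : unitary0 u -> uconn u.
Proof.
set C := @unitary0 R A => Cu.
have Cunit x : C x -> unitary x by apply: connected_component_sub.
have C1 : C 1 by apply: connected_component_refl; apply: unitary1.
pose B := C `&` [set x | uconn x].
have half0 : 0 < (2^-1 : R) by rewrite invr_gt0.
suff BC : B = C by move: Cu; rewrite -BC => -[].
have close x y : C x -> uconn y -> nr (y - x) < 2^-1 -> uconn x.
  by move=> /Cunit ux uy yx; apply: (uconn_close uy ux); rewrite nrB ltW.
apply: (@component_connected _ _ (1 : A)).
- by exists 1; split => //; apply: uconn1.
- exists (\bigcup_(y in [set y | uconn y]) [set x | nr (y - x) < 2^-1]).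
    by apply: bigcup_open => y _; apply: nball_open.
  apply/seteqP; split=> x [Cx xu]; split=> //.
    by exists x => //=; rewrite subrr nr0.
  by case: xu => y /= uy; apply: close.
- exists (~` \bigcup_(y in C `&` [set y | ~ uconn y]) [set x | nr (y - x) < 2^-1]).
    by apply: open_closedC; apply: bigcup_open => y _; apply: nball_open.
  apply/seteqP; split=> x [Cx xu]; split=> //.
    case=> y [Cy ny] /= yx; apply: ny; apply: (close y x) => //.
    by rewrite nrB.
  apply: contrapT => nx; apply: xu; exists x; first by split.
  by rewrite /= subrr nr0.
Qed.

(* Infinitely many paths in a row, glued as [V 0 + sum_n (c_n (t - n) - V n)];
   near any t only finitely many summands are nonzero. *)
Lemma path_concat A (V : nat -> A) (P : nat -> A -> Prop) :
  (forall n, pathin (P n) (V n) (V n.+1)) ->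
  exists u : R -> A, [/\ ccont u, u 0 = V 0%N &
    forall t, 0 <= t -> exists2 n, t < n.+1%:R & P n (u t)].
Proof.
move=> /choice[c cP].
pose U N (t : R) : A := V 0%N + \sum_(n <- iota 0 N) (c n (1 * t + - n%:R) - V n).
have Ustab N M (t : R) : t <= N%:R -> (N <= M)%N -> U M t = U N t.
  move=> tN NM; rewrite /U -(subnKC NM) iotaD big_cat /= add0n.
  rewrite [X in _ + (_ + X)]big1_seq ?addr0 // => n /andP[_].
  rewrite mem_iota => /andP[Nn _]; case: (cP n) => _ -> //; first by rewrite subrr.
  by rewrite mul1r subr_le0 (le_trans tN) // ler_nat.
pose N (t : R) : nat := Num.bound t.
have Nt (t : R) : t < (N t)%:R.
  case: (lerP 0 t) => [|t0]; first exact: archi_boundP.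
  by apply: (lt_le_trans t0).
pose u (t : R) := U (N t) t.
have uE M (t : R) : t <= M%:R -> u t = U M t.
  move=> tM; case/orP: (leq_total M (N t)) => H; first exact: Ustab.
  by rewrite /u -(Ustab (N t) M) // ltW.
have Uc M : ccont (U M).
  apply: ccontD; first exact: ccont_cst.
  apply: ccont_sum => n; apply: ccontD (ccont_cst _).
  by apply: ccont_affine; case: (cP n).
exists u; split.
- apply: (@ccont_local _ _ _ (fun t => U (N t))) => // t.
  exists ((N t)%:R - t) => [|s]; first by rewrite subr_gt0.
  by rewrite ltr_norml => /andP[_ st]; apply: uE; lra.
- by rewrite (uE 0%N) // /U big_nil addr0.
- move=> t t0; have [n /andP[nt tn]] : exists n, (n%:R <= t) && (t < n.+1%:R).
    have ex : exists m : nat, t < m%:R by exists (N t).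
    case: (ex_minnP ex) => -[|n] tn mmin.
      by move: tn; rewrite ltNge t0.
    exists n; rewrite tn andbT leNgt; apply/negP => /mmin; by rewrite ltnn.
  exists n => //; rewrite (uE n.+1) ?(ltW tn) // /U -addn1 iotaD big_cat /= add0n.
  rewrite big_seq1.
  have -> : V 0%N + (\sum_(m <- iota 0 n) (c m (1 * t + - m%:R) - V m)
      + (c n (1 * t - n%:R) - V n)) = c n (1 * t - n%:R).
    have tele k : (k <= n)%N ->
        V 0%N + \sum_(m <- iota 0 k) (c m (1 * t + - m%:R) - V m) = V k.
      elim: k => [|k IH] kn; first by rewrite big_nil addr0.
      rewrite -addn1 iotaD big_cat big_seq1 /= add0n addrA IH ?(ltnW kn) //.
      case: (cP k) => _ _ -> //; first by rewrite addrC subrK addn1.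
      by rewrite mul1r lerBrDl natr1 (le_trans _ nt) // ler_nat.
    by rewrite addrA tele // addrC subrK.
  by case: (cP n).
Qed.

End UnitaryComponent.

(** * Commutators are connected to 1 *)

Section Corner.
Context {S : pzRingType}.
Implicit Types (k : nat) (a b c d : S).

(** A 2 by 2 matrix placed in the first and last coordinates, with an identity block of size [k]
    between them: stabilising once more after [k] steps leaves room for a rotation. *)
Definition corner k a b c d : 'M[S]_(1 + k + 1) :=
  block_mx (block_mx a%:M 0 0 1%:M) (col_mx b%:M 0) (row_mx c%:M 0) d%:M.

Lemma corner_mul k a b c d a' b' c' d' :
  corner k a b c d *m corner k a' b' c' d' =
  corner k (a * a' + b * c') (a * b' + b * d') (c * a' + d * c') (c * b' + d * d').
Proof.
rewrite /corner mulmx_block mul_col_row mulmx_block mul_block_col mul_row_block.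
rewrite mul_row_col !mul_col_mx mul_mx_row.
rewrite !mulmx0 !mul0mx !addr0 !add0r mulmx1 -!scalar_mxM add_block_mx.
by rewrite add_col_mx add_row_mx !addr0 -!raddfD.
Qed.

Lemma corner_map_tr (f : S -> S) k a b c d : f 0 = 0 -> f 1 = 1 ->
  (map_mx f (corner k a b c d))^T = corner k (f a) (f c) (f b) (f d).
Proof.
move=> f0 f1.
have F0 m n : map_mx f (0 : 'M[S]_(m, n)) = 0 by apply/matrixP => i j; rewrite !mxE.
have FC n x : map_mx f (x%:M : 'M[S]_n) = (f x)%:M.
  by apply/matrixP => i j; rewrite !mxE; case: (i == j); rewrite ?mulr1n ?mulr0n.
rewrite /corner !map_block_mx map_col_mx map_row_mx !FC !F0 f1.
by rewrite !tr_block_mx tr_col_mx tr_row_mx !tr_scalar_mx !trmx0.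
Qed.

Lemma corner_diag k a d :
  corner k a 0 0 d = block_mx (block_mx a%:M 0 0 1%:M) 0 0 d%:M.
Proof. by rewrite /corner raddf0 col_mx0 row_mx0. Qed.

Lemma corner1 k : corner k 1 0 0 1 = 1%:M.
Proof. by rewrite corner_diag -!scalar_mx_block. Qed.

End Corner.

(** * Entrywise topology, Whitehead rotations and classes in K_1 *)

Section MatrixTopology.
Context {R : realType} {A : cstarAlgType R}.
Implicit Types (k l m n p q : nat).

Lemma ccont_continuous (c : R -> A) : ccont c -> continuous c.
Proof.
move=> cc t; apply/cvgrPdist_lt => e e0.
have er : e = (complex.Re e)%:C by rewrite RRe_real // gtr0_real.
have e1 : 0 < complex.Re e by rewrite -ltcR -er.
have [d d0 H] := cc t _ e1; apply/nbhs_ballP; exists d => // s /=.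
rewrite /ball /= distrC => /H.
by rewrite nrB nrE er ltcR.
Qed.

Lemma ccont_real (g : R -> R) : continuous g -> ccont (fun t => g t :*: (1 : A)).
Proof.
move=> gc t e e0; have /cvgrPdist_lt/(_ _ e0) := gc t.
move=> /nbhs_ballP[d /= d0 H]; exists d => // s st.
have := H s; rewrite /ball /= distrC => /(_ st).
rewrite -rscBl nr_rsc distrC; apply: le_lt_trans.
by rewrite ler_piMr // nr1_le1.
Qed.

Lemma mx_continuous (T : topologicalType) m n (f : T -> 'M[A]_(m, n)) :
  (forall i j, continuous (fun x => f x i j)) -> continuous f.
Proof.
move=> fc x P [Q Qx QP]; rewrite nbhs_filterE /=.
have : \forall y \near x, forall ij : 'I_m * 'I_n, Q ij.1 ij.2 (f y ij.1 ij.2).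
  by apply: filter_forall => -[i j] /=; apply: fc; apply: Qx.
by apply: filterS => y Hy; apply: QP => i j; apply: (Hy (i, j)).
Qed.

Lemma mx_entry_continuous m n (i : 'I_m) (j : 'I_n) :
  continuous (fun M : 'M[A]_(m, n) => M i j).
Proof.
move=> M P MP; exists (fun a b => if (a == i) && (b == j) then P else setT).
  by move=> a b; case: ifP => [/andP[/eqP -> /eqP ->] //|_]; apply: filterT.
by move=> N /(_ i j); rewrite !eqxx.
Qed.

Lemma cs_mull_continuous (a : A) : continuous (fun x => a * x).
Proof.
move=> x; apply/cvgrPdist_lt => e e0.
have er : e = (complex.Re e)%:C by rewrite RRe_real // gtr0_real.
have e1 : 0 < complex.Re e by rewrite -ltcR -er.
have a0 : 0 < nr a + 1 by rewrite ltr_wpDl ?nr_ge0.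
apply/nbhs_ballP; exists (complex.Re e / (nr a + 1))%:C; first by rewrite /= ltcR divr_gt0.
move=> y; rewrite -ball_normE /= !nrE [in X in _ -> X]er !ltcR -mulrBr ltr_pdivlMr // => H.
apply: (le_lt_trans (nrM _ _)); apply: le_lt_trans H.
by rewrite mulrC ler_wpM2l ?nr_ge0 // lerDl.
Qed.

Lemma mulmx_left_continuous m n p (N : 'M[A]_(m, n)) :
  continuous (fun M : 'M[A]_(n, p) => N *m M).
Proof.
apply: mx_continuous => i j.
have -> : (fun M : 'M[A]_(n, p) => (N *m M) i j) = (fun M => \sum_k N i k * M k j).
  by apply/funext => M; rewrite mxE.
apply: continuous_big => [|k _]; first exact: add_continuous.
move=> M; apply: (@continuous_comp _ _ _ (fun M : 'M[A]_(n, p) => M k j) (fun x => N i k * x)).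
  exact: mx_entry_continuous.
exact: cs_mull_continuous.
Qed.

Lemma stab_mx_continuous n k : continuous (@stab_mx R A n k).
Proof.
apply: mx_continuous => i j; case: (split_ordP i) => i' ->; case: (split_ordP j) => j' ->.
- under eq_fun do rewrite /stab_mx block_mxEul; exact: mx_entry_continuous.
- under eq_fun do rewrite /stab_mx block_mxEur; exact: cst_continuous.
- under eq_fun do rewrite /stab_mx block_mxEdl; exact: cst_continuous.
- under eq_fun do rewrite /stab_mx block_mxEdr; exact: cst_continuous.
Qed.

Lemma star_mx0 m n : map_mx (@star R A) (0 : 'M[A]_(m, n)) = 0.
Proof. by apply/matrixP => i j; rewrite !mxE star0. Qed.

Lemma star_mxC n (a : A) : star_mx (a%:M : 'M[A]_n) = (star a)%:M.
Proof.
apply/matrixP => i j; rewrite !mxE eq_sym; case: (i == j); rewrite ?mulr1n //.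
by rewrite !mulr0n star0.
Qed.

Lemma star_mx1 n : star_mx (1%:M : 'M[A]_n) = 1%:M.
Proof. by rewrite star_mxC star1. Qed.

Lemma star_mx_mul n (M N : 'M[A]_n) : star_mx (M *m N) = star_mx N *m star_mx M.
Proof.
apply/matrixP => i j; rewrite !mxE star_sum; apply: eq_bigr => k _.
by rewrite !mxE star_mul.
Qed.

Lemma star_mxK n (M : 'M[A]_n) : star_mx (star_mx M) = M.
Proof. by apply/matrixP => i j; rewrite !mxE starK. Qed.

Lemma star_block n k (a : 'M[A]_n) (b : 'M[A]_(n, k)) c (d : 'M[A]_k) :
  star_mx (block_mx a b c d) = block_mx (star_mx a) (map_mx (@star R A) c)^T
    (map_mx (@star R A) b)^T (star_mx d).
Proof. by rewrite /star_mx map_block_mx tr_block_mx. Qed.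

Lemma star_stab n k (M : 'M[A]_n) : star_mx (stab_mx k M) = stab_mx k (star_mx M).
Proof. by rewrite /stab_mx star_block !star_mx0 !trmx0 star_mx1. Qed.

Lemma stab_mul n k (M N : 'M[A]_n) : stab_mx k M *m stab_mx k N = stab_mx k (M *m N).
Proof.
by rewrite /stab_mx mulmx_block !mulmx0 !mul0mx !addr0 mulmx1 add0r.
Qed.

Lemma stab1 n k : stab_mx k (1%:M : 'M[A]_n) = 1%:M.
Proof. by rewrite /stab_mx -scalar_mx_block. Qed.

Lemma stab_stab n k l (M : 'M[A]_n) :
  stab_mx (k + l) M = castmx (esym (addnA n k l), esym (addnA n k l))
    (stab_mx l (stab_mx k M)).
Proof.
rewrite /stab_mx (scalar_mx_block k l) -[0 in LHS]row_mx0 -[X in block_mx _ _ X _]col_mx0.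
by rewrite block_mxA col_mx0 row_mx0.
Qed.

Lemma unitary_mx_mul n (M N : 'M[A]_n) : unitary_mx M -> unitary_mx N -> unitary_mx (M *m N).
Proof.
move=> [M1 M2] [N1 N2]; split; rewrite star_mx_mul.
- by rewrite -mulmxA (mulmxA (star_mx M)) M1 mul1mx.
- by rewrite -mulmxA (mulmxA N) N2 mul1mx.
Qed.

Lemma unitary_mx_star n (M : 'M[A]_n) : unitary_mx M -> unitary_mx (star_mx M).
Proof. by case=> M1 M2; split; rewrite star_mxK. Qed.

Lemma unitary_mx_stab n k (M : 'M[A]_n) : unitary_mx M -> unitary_mx (stab_mx k M).
Proof. by case=> M1 M2; split; rewrite star_stab stab_mul ?M1 ?M2 stab1. Qed.

Lemma component_image (T U : topologicalType) (f : T -> U) (P : set T) (Q : set U) x y :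
  continuous f -> (forall z, P z -> Q (f z)) -> connected_component P x y ->
  connected_component Q (f x) (f y).
Proof.
move=> fc PQ [B [Bx BP Bc] By]; exists (f @` B); last by exists y.
split; first by exists x.
  by move=> _ [z /BP/PQ ? <-].
exact/(connected_continuous_connected Bc)/continuous_subspaceT.
Qed.

Lemma unitary0_mx_mul n (M N : 'M[A]_n) :
  unitary0_mx M -> unitary0_mx N -> unitary0_mx (M *m N).
Proof.
move=> M0 N0; apply: (connected_component_trans M0).
rewrite -{1}[M]mulmx1.
apply: (component_image (@mulmx_left_continuous _ _ _ M)) N0 => X.
exact/unitary_mx_mul/(connected_component_sub M0).
Qed.

Lemma unitary0_mx_stab n k (M : 'M[A]_n) : unitary0_mx M -> unitary0_mx (stab_mx k M).
Proof.
move=> M0; rewrite /unitary0_mx -(stab1 n k).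
apply: (component_image (@stab_mx_continuous n k)) M0 => X.
exact: unitary_mx_stab.
Qed.

Lemma corner_star k (a b c d : A) :
  star_mx (corner k a b c d) = corner k (star a) (star c) (star b) (star d).
Proof. exact: corner_map_tr star0 star1. Qed.

Lemma corner_stab k (a : A) : corner k a 0 0 1 = stab_mx 1 (stab_mx k (a%:M : 'M[A]_1)).
Proof. exact: corner_diag. Qed.

Lemma corner_continuous (T : topologicalType) k (a b c d : T -> A) :
  continuous a -> continuous b -> continuous c -> continuous d ->
  continuous (fun t => corner k (a t) (b t) (c t) (d t)).
Proof.
move=> ac bc cc dc; apply: mx_continuous => i j.
have ext (f g : T -> A) : (forall t, f t = g t) -> continuous f -> continuous g.
  by move=> /funext ->.
have cst (e : A) : continuous (fun _ : T => e) by exact: cst_continuous.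
have one (e : A) (i1 j1 : 'I_1) : e%:M i1 j1 = e by rewrite !ord1 mxE eqxx.
case: (split_ordP i) => i' ->; case: (split_ordP j) => j' ->.
- case: (split_ordP i') => i2 ->; case: (split_ordP j') => j2 ->.
  + by apply: ext ac => t; rewrite /corner !block_mxEul one.
  + by apply: ext (cst 0) => t; rewrite /corner block_mxEul block_mxEur mxE.
  + by apply: ext (cst 0) => t; rewrite /corner block_mxEul block_mxEdl mxE.
  + by apply: ext (cst ((1%:M : 'M[A]_k) i2 j2)) => t;
      rewrite /corner block_mxEul block_mxEdr.
- case: (split_ordP i') => i2 ->.
  + by apply: ext bc => t; rewrite /corner block_mxEur col_mxEu one.
  + by apply: ext (cst 0) => t; rewrite /corner block_mxEur col_mxEd mxE.
- case: (split_ordP j') => j2 ->.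
  + by apply: ext cc => t; rewrite /corner block_mxEdl row_mxEl one.
  + by apply: ext (cst 0) => t; rewrite /corner block_mxEdl row_mxEr mxE.
- by apply: ext dc => t; rewrite /corner block_mxEdr one.
Qed.

Lemma corner_unitary k (a d : A) : unitary a -> unitary d -> unitary_mx (corner k a 0 0 d).
Proof.
move=> [a1 a2] [d1 d2]; split; rewrite corner_star corner_mul !star0.
- by rewrite !mulr0 !mul0r !addr0 !add0r a1 d1 corner1.
- by rewrite !mulr0 !mul0r !addr0 !add0r a2 d2 corner1.
Qed.

(* Whitehead: conjugating diag(w, 1) by a rotation in the plane of the first
   and last coordinates moves it to diag(1, w), which commutes with diag(x, 1). *)
Lemma commutator_unitary0_mx k (w x : A) : unitary w -> unitary x ->
  unitary0_mx (stab_mx 1 (stab_mx k ((x * w * star x * star w)%:M : 'M[A]_1))).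
Proof.
move=> uw ux; pose c (t : R) : A := cos t :*: 1; pose s (t : R) : A := sin t :*: 1.
have cC t y : c t * y = y * c t by apply: rsc1C.
have sC t y : s t * y = y * s t by apply: rsc1C.
have cs t : c t * c t + s t * s t = 1.
  by rewrite -!rsc1M -rscDl -!expr2 cos2Dsin2 rsc1.
have cS t : star (c t) = c t by rewrite star_rsc star1.
have sS t : star (s t) = s t by rewrite star_rsc star1.
have cc : ccont c := ccont_real (@continuous_cos R).
have sc : ccont s := ccont_real (@continuous_sin R).
pose U t := corner k (c t) (- s t) (s t) (c t).
have UU t : unitary_mx (U t).
  split; rewrite corner_star starN cS sS corner_mul -(corner1 k); congr corner;
    have st := sC t (c t); by first [rewrite -[RHS](cs t); ncring | ncring_with [:: c t]].
pose W t v := U t *m corner k v 0 0 1 *m star_mx (U t).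
have WE t v : W t v = corner k (c t * v * c t + s t * s t) (c t * v * s t - s t * c t)
    (s t * v * c t - c t * s t) (s t * v * s t + c t * c t).
  rewrite /W corner_star !corner_mul starN cS sS.
  by congr corner; rewrite !mulr0 !mulr1 ?addr0 ?add0r ?mulNr ?mulrN ?opprK.
have WU t v : unitary v -> unitary_mx (W t v).
  move=> uv; apply: unitary_mx_mul (unitary_mx_star (UU t)).
  by apply: unitary_mx_mul => //; exact: (corner_unitary k uv (unitary1 A)).
have uw' := unitary_star uw; have ux' := unitary_star ux.
pose P t := corner k x 0 0 1 *m W t w *m corner k (star x) 0 0 1 *m W t (star w).
have PU t : unitary_mx (P t).
  have CU (v : A) : unitary v -> unitary_mx (corner k v 0 0 1).
    by move=> uv; exact: (corner_unitary k uv (unitary1 A)).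
  exact: (unitary_mx_mul (unitary_mx_mul (unitary_mx_mul (CU _ ux) (WU t _ uw))
    (CU _ ux')) (WU t _ uw')).
(* Families of corners with continuous entries are stable under products, so continuity of [P]
   reduces to that of sums and products in [A]. *)
pose CC (M : R -> 'M[A]_(1 + k + 1)) := exists f : R -> A, exists g : R -> A,
  exists h : R -> A, exists j : R -> A, [/\ ccont f, ccont g, ccont h & ccont j] /\
  forall t, M t = corner k (f t) (g t) (h t) (j t).
have CCM M N : CC M -> CC N -> CC (fun t => M t *m N t).
  move=> [f [g [h [j [[fc gc hc jc] E]]]]] [f' [g' [h' [j' [[fc' gc' hc' jc'] E']]]]].
  do 4 eexists; split; last by move=> t; rewrite E E' corner_mul.
  by split; apply: ccontD; apply: ccontM.
have CCcst (a b e d : A) : CC (fun=> corner k a b e d).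
  exists (fun=> a), (fun=> b), (fun=> e), (fun=> d).
  by split=> //; split; apply: ccont_cst.
have sc' : ccont (fun t => - s t).
  by apply: (@ccont_lip _ _ _ -%R 1) sc => y z; rewrite -opprD nrN mul1r.
have CCU : CC U by exists c, (fun t => - s t), s, c.
have CCU' : CC (fun t => star_mx (U t)).
  exists c, s, (fun t => - s t), c; split=> // t.
  by rewrite corner_star starN cS sS.
have CCW v : CC (fun t => W t v) := CCM _ _ (CCM _ _ CCU (CCcst v 0 0 1)) CCU'.
have Pc : continuous P.
  have [f [g [h [j [[fc gc hc jc] E]]]]] : CC P :=
    CCM _ _ (CCM _ _ (CCM _ _ (CCcst x 0 0 1) (CCW w)) (CCcst (star x) 0 0 1)) (CCW (star w)).
  rewrite (_ : P = fun t => corner k (f t) (g t) (h t) (j t)); last exact/funext.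
  by apply: corner_continuous; apply: ccont_continuous.
have P0 : P 0 = stab_mx 1 (stab_mx k ((x * w * star x * star w)%:M : 'M[A]_1)).
  have c0 : c 0 = 1 by rewrite /c cos0 rsc1.
  have s0 : s 0 = 0 by rewrite /s sin0 rsc0.
  rewrite /P !WE !corner_mul c0 s0 -corner_stab.
  by congr corner; rewrite ?(mulr0, mul0r, mulr1, mul1r, addr0, add0r, subr0).
have P1 : P (pi / 2) = 1%:M.
  have c0 : c (pi / 2) = 0 by rewrite /c cos_pihalf rsc0.
  have s0 : s (pi / 2) = 1 by rewrite /s sin_pihalf rsc1.
  rewrite /P !WE !corner_mul c0 s0 -corner1; case: uw => _ w2; case: ux => _ x2.
  by congr corner; rewrite ?(mulr0, mul0r, mulr1, mul1r, addr0, add0r, subr0) ?w2.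
rewrite -P0 /unitary0_mx -P1.
have RC : connected [set: R] by apply/connected_intervalP.
apply: (@component_image _ _ P setT); first exact: Pc.
  by move=> t _; apply: PU.
by rewrite connected_component_id.
Qed.

(** [x * w] is the commutator [x * w * star x * star w] times [w * x], and the commutator is
    connected to 1 after one more stabilisation; hence [k + 1] and [l + 1]. The remaining work is
    transport along equalities of dimensions. *)
Lemma K1_eq_commute (w x : A) n (z : 'M[A]_n) : unitary w -> unitary x ->
  K1_eq ((w * x)%:M : 'M[A]_1) z -> K1_eq ((x * w)%:M : 'M[A]_1) z.
Proof.
move=> uw ux [k [l [e H]]].
have e1 : (1 + (k + 1) = n + (l + 1))%N by rewrite !addnA e.
exists (k + 1)%N, (l + 1)%N, e1.
have key N (Z : 'M[A]_N) (f : (1 + k = N)%N) :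
    unitary0_mx (castmx (f, f) (stab_mx k (w * x)%:M) *m star_mx Z) ->
    unitary0_mx (stab_mx 1 (castmx (f, f) (stab_mx k (x * w)%:M)) *m star_mx (stab_mx 1 Z)).
  case: N / f Z => Z; rewrite !castmx_id => /(unitary0_mx_stab 1).
  move=> /(unitary0_mx_mul (commutator_unitary0_mx k uw ux)).
  rewrite -[X in _ *m X]stab_mul -star_stab mulmxA !stab_mul; congr unitary0_mx.
  congr (stab_mx 1 (stab_mx k _) *m _); rewrite -scalar_mxM; congr (_%:M).
  case: uw => w1 _; case: ux => x1 _.
  by rewrite -!mulrA (mulrA (star w)) w1 mul1r x1 mulr1.
have {}H := key _ _ _ H.
rewrite !stab_stab.
have cast_star m m' (f : m = m') (M : 'M[A]_m) :
  star_mx (castmx (f, f) M) = castmx (f, f) (star_mx M) by case: m' / f.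
have cast_mul m m' (f : m = m') (M N : 'M[A]_m) :
  castmx (f, f) M *m castmx (f, f) N = castmx (f, f) (M *m N) by case: m' / f.
have cast_stab m m' (f : m = m') (M : 'M[A]_m) (g : (m + 1 = m' + 1)%N) :
  stab_mx 1 (castmx (f, f) M) = castmx (g, g) (stab_mx 1 M).
  by case: m' / f g => g; rewrite !castmx_id.
have cast_comp m m' m2 (f : m = m') (g : m' = m2) (M : 'M[A]_m) :
  castmx (g, g) (castmx (f, f) M) = castmx (etrans f g, etrans f g) M.
  by rewrite castmx_comp.
have cast_u0 m m' (f : m = m') (M : 'M[A]_m) :
  unitary0_mx M -> unitary0_mx (castmx (f, f) M) by case: m' / f.
have e2 : (1 + k + 1 = n + l + 1)%N by rewrite e.
move: H; rewrite (cast_stab _ _ _ _ e2) => /(cast_u0 _ _ (esym (addnA n l 1))).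
rewrite -cast_mul -cast_star !cast_comp.
by congr (unitary0_mx (castmx (_, _) _ *m _)); apply: eq_irrelevance.
Qed.

(** [w * x] and [x * w] have the same class, so injectivity gives [w * x = x * w * v] with [v]
    connected to 1, and the commutator is a conjugate of [v]. *)
Lemma commutator_uconn (w x : A) : K1_injective A -> unitary w -> unitary x ->
  uconn (w * x * star w * star x).
Proof.
move=> inj uw ux; have uwx := unitaryM uw ux; have uxw := unitaryM ux uw.
have E : K1_class ((w * x)%:M : 'M[A]_1) = K1_class ((x * w)%:M : 'M[A]_1).
  apply/seteqP; split=> -[n z] [uz /= H]; split=> //=; exact: K1_eq_commute H.
have := inj _ _ uwx uxw E => C.
have : unitary0_coset (w * x) (w * x).
  exists 1; last exact: mulr1.
  by apply: connected_component_refl; apply: unitary1.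
rewrite C => -[v /unitary0_uconn cv e].
have -> : w * x * star w * star x = (x * w) * v * star (x * w).
  by rewrite e star_mul !mulrA.
exact: uconn_conj.
Qed.

End MatrixTopology.

(** * Maps out of a tensor product and the half flip *)

Section LinearFunctional.
Context {K : fieldType} {V : lmodType K}.

(* A subspace maximal among those avoiding [q] is a complement of the line
   spanned by [q]. *)
Lemma exists_functional (q : V) : q <> 0 ->
  exists f : V -> K, (forall (a : K) x y, f (a *: x + y) = a * f x + f y) /\ f q = 1.
Proof.
move=> q0.
pose sub (W : set V) := forall (a : K) x y, W x -> W y -> W (a *: x + y).
pose P (W : set V) := sub W /\ ~ W q.
have [W [[Wsub Wq] Wmax]] : exists W, P W /\ forall B, W `<` B -> ~ P B.
  apply: Zorn_bigcup => F FP Ftot; split; last by case=> X /FP[_ Xq].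
  move=> a x y [X FX Xx] [Y FY Yy].
  case: (Ftot X Y FX FY) => [XY|YX].
    by exists Y => //; apply: (FP Y FY).1 => //; apply: XY.
  by exists X => //; apply: (FP X FX).1 => //; apply: YX.
have W0 : W 0.
  apply: contrapT => W0; apply: (Wmax (W `|` [set 0])).
    split; first by move=> x; left.
    by move=> /(_ 0) H; apply: W0; apply: H; right.
  split=> [a x y|[//|]]; last by move=> e; apply: q0.
  case=> [Wx|->]; case=> [Wy|->]; rewrite ?scaler0 ?addr0 ?add0r.
  - by left; apply: Wsub.
  - case: (boolp.EM (W (a *: x))) => [|n]; first by left.
    exfalso; apply: n; have Wa : W (a *: x + x) by apply: Wsub.
    by have := Wsub (-1) _ _ Wx Wa; rewrite scaleN1r addrC addrK.
  - by left.
  - by right.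
have WZ a x : W x -> W (a *: x) by move=> /(Wsub a) /(_ W0); rewrite addr0.
have WD x y : W x -> W y -> W (x + y) by move=> Wx /(Wsub 1 _ _ Wx); rewrite scale1r.
have uniq c : W (c *: q) -> c = 0.
  move=> Wc; apply: contrapT => /eqP c0; apply: Wq.
  by have := WZ c^-1 _ Wc; rewrite scalerA mulVf // scale1r.
have /choice[f fP] x : exists c, W (x - c *: q).
  case: (boolp.EM (W x)) => Wx; first by exists 0; rewrite scale0r subr0.
  pose B := [set y | exists w c, W w /\ y = c *: x + w].
  have : ~ P B.
    apply: Wmax; split; first by move=> y Wy; exists y, 0; rewrite scale0r add0r.
    by move=> /(_ x) H; apply: Wx; apply: H; exists 0, 1; rewrite scale1r addr0.
  have Bsub : sub B.
    move=> a _ _ [w [c [Ww ->]]] [w' [c' [Ww' ->]]].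
    exists (a *: w + w'), (a * c + c'); split; first exact: Wsub.
    by rewrite scalerDr scalerDl scalerA addrACA.
  move=> /not_andP[//|/contrapT[w [c [Ww qE]]]].
  have c0 : c != 0 by apply/eqP => c0; apply: Wq; rewrite qE c0 scale0r add0r.
  exists c^-1; rewrite qE scalerDr scalerA mulVf // scale1r opprD addrA subrr add0r.
  by rewrite -scaleNr; apply: WZ.
exists f; split=> [a x y|].
  apply/eqP; rewrite -subr_eq0; apply/eqP; apply: uniq.
  have := WD _ _ (WD _ _ (WZ a _ (fP x)) (fP y)) (WZ (-1) _ (fP (a *: x + y))).
  congr W; rewrite scaleN1r scalerBr scalerA scalerBl scalerDl opprB.
  by rewrite [X in X + _]addrACA -opprD [LHS]addrC subrKA.
apply/esym/eqP; rewrite -subr_eq0; apply/eqP; apply: uniq.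
by rewrite scalerBl scale1r; apply: fP.
Qed.

End LinearFunctional.

Section BilinearOf.
Context {K : nzRingType} {U U' V : lmodType K} {f : U -> U' -> V}.
(** The alias carries the proof [hf], so that bilinearity established inside a proof can be packaged
    as a structure. *)
Definition bilinear_of (hf : bilinear_for *:%R *:%R f) : U -> U' -> V := f.
HB.instance Definition _ (hf : bilinear_for *:%R *:%R f) :=
  bilinear_isBilinear.Build K U U' V *:%R *:%R (bilinear_of hf) hf.
End BilinearOf.

Section TensorEval.
Context {R : realType}.
Implicit Types A B C D T : cstarAlgType R.

Definition commuting A D T (f : A -> T) (g : D -> T) : Prop :=
  forall a d, f a * g d = g d * f a.

(** For a functional [f] with [f q = 1], the bilinear map [f y *: x] sends the pair to [p]. *)
Lemma tensor_null_pair A D (p : A) (q : D) : tensor_null [:: (p, q)] -> q <> 0 -> p = 0.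
Proof.
move=> n q0; have [f [fl fq]] := exists_functional q0.
pose b (x : A) (y : D) : A := f y *: x.
have hb : bilinear_for *:%R *:%R b.
  split=> [y a x x'|x a y y']; rewrite /b /=; last by rewrite fl scalerDl scalerA.
  by rewrite scalerDr !scalerA mulrC.
have := n A (bilinear_of hb); rewrite big_seq1 /= /bilinear_of /b fq scale1r.
exact.
Qed.

Lemma tensor_null_map A D C (E : cstarAlgType R) (f : A -> C) (g : D -> E) (s : seq (A * D)) :
  linear f -> linear g -> tensor_null s -> tensor_null [seq (f p.1, g p.2) | p <- s].
Proof.
move=> fl gl n V b; rewrite big_map /=.
have hb : bilinear_for *:%R *:%R (fun x y => b (f x) (g y)).
  split=> [y a x x'|x a y y'] /=; first by rewrite fl linearPl.
  by rewrite gl linearPr.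
exact: (n V (bilinear_of hb)).
Qed.

Lemma tensor_null_swap A D (s : seq (A * D)) :
  tensor_null s -> tensor_null [seq (p.2, p.1) | p <- s].
Proof.
move=> n V b; rewrite big_map /=.
have hb : bilinear_for *:%R *:%R (fun x y => b y x).
  by split=> [y a x x'|x a y y'] /=; rewrite ?linearPl ?linearPr.
exact: (n V (bilinear_of hb)).
Qed.

Section Eval.
Context {A D T : cstarAlgType R} {f : A -> T} {g : D -> T}.
Hypotheses (hf : unital_starhom f) (hg : unital_starhom g) (fg : commuting f g).
Implicit Types s t : seq (A * D).

(** The operations of the algebraic tensor product, performed on representing lists. *)
Definition scale_list (c : R[i]) s := [seq (c *: p.1, p.2) | p <- s].
Definition mul_list s t := [seq (p.1 * q.1, p.2 * q.2) | p <- s, q <- t].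
Definition star_list s := [seq (star p.1, star p.2) | p <- s].

Lemma eval_cat s t : tensor_eval f g (s ++ t) = tensor_eval f g s + tensor_eval f g t.
Proof. exact: big_cat. Qed.

Lemma eval_scale c s : tensor_eval f g (scale_list c s) = c *: tensor_eval f g s.
Proof.
rewrite /tensor_eval big_map scaler_sumr; apply: eq_bigr => p _ /=.
by rewrite (homZ hf) scaleAl.
Qed.

Lemma eval_mul s t :
  tensor_eval f g (mul_list s t) = tensor_eval f g s * tensor_eval f g t.
Proof.
rewrite /tensor_eval /mul_list big_allpairs_dep big_distrlr /=.
apply: eq_bigr => p _; apply: eq_bigr => q _.
by rewrite (homM hf) (homM hg) !mulrA -(mulrA (f p.1)) fg !mulrA.
Qed.

Lemma eval_star s : tensor_eval f g (star_list s) = star (tensor_eval f g s).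
Proof.
rewrite /tensor_eval big_map star_sum; apply: eq_bigr => p _ /=.
by rewrite star_mul (hom_star hf) (hom_star hg) -(hom_star hf) -(hom_star hg) fg.
Qed.

Lemma eval_pair a d : tensor_eval f g [:: (a, d)] = f a * g d.
Proof. exact: big_seq1. Qed.

End Eval.

Lemma subset_dense (T : topologicalType) (X Y : set T) : X `<=` Y -> dense X -> dense Y.
Proof. by move=> XY dX O O0 oO; have [x [Ox /XY Yx]] := dX O O0 oO; exists x. Qed.

Lemma dense_approx A D T (iA : A -> T) (iD : D -> T) (x : T) (e : R) :
  dense (range (tensor_eval iA iD)) -> 0 < e ->
  exists s, nr (tensor_eval iA iD s - x) < e.
Proof.
move=> dn e0; have [|y [/= xy [s _ sy]]] := dn [set y | nr (x - y) < e] _ (nball_open x e0).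
  by exists x; rewrite /= subrr nr0.
by exists s; rewrite nrB sy.
Qed.

Lemma dense_slim A D T (iA : A -> T) (iD : D -> T) (x : T) :
  dense (range (tensor_eval iA iD)) ->
  exists s : nat -> seq (A * D), slim (fun n => tensor_eval iA iD (s n)) x.
Proof.
move=> dn; have pos n : 0 < n.+1%:R^-1 :> R by rewrite invr_gt0.
have /choice[s sP] n := dense_approx x dn (pos n).
exists s => e e0; have [N HN] := slim_harmonic (1 : T) e0.
pose M := Num.bound e^-1; exists M => n Mn; apply: (lt_trans (sP n)).
rewrite invf_plt ?posrE //; apply: (lt_le_trans (archi_boundP _)).
  by rewrite invr_ge0 ltW.
by rewrite ler_nat (leq_trans Mn).
Qed.

Lemma hom_eval A D T B (iA : A -> T) (iD : D -> T) (h : T -> B) s :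
  unital_starhom h -> h (tensor_eval iA iD s) = tensor_eval (h \o iA) (h \o iD) s.
Proof.
move=> hh; rewrite /tensor_eval (hom_sum hh); apply: eq_bigr => p _.
by rewrite (homM hh).
Qed.

Lemma hom_unique A D T B (iA : A -> T) (iD : D -> T) (h h' : T -> B) :
  dense (range (tensor_eval iA iD)) -> unital_starhom h -> unital_starhom h' ->
  (forall a, h (iA a) = h' (iA a)) -> (forall d, h (iD d) = h' (iD d)) ->
  h =1 h'.
Proof.
move=> dn hh hh' hA hD x; have [s sx] := dense_slim x dn.
apply: (slim_unique (hom_slim hh sx)); apply: slim_ext (hom_slim hh' sx) => n.
by rewrite !hom_eval //; apply: eq_bigr => p _ /=; rewrite hA hD.
Qed.

(** Extension by continuity. The value at [x] is a limit along one chosen approximating sequence;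
    [key] shows that every other sequence gives the same limit, whence all the algebraic
    identities. *)
Lemma tensor_ext A D T B (iA : A -> T) (iD : D -> T) (f : A -> B) (g : D -> B) :
  unital_starhom iA -> unital_starhom iD -> commuting iA iD ->
  dense (range (tensor_eval iA iD)) ->
  unital_starhom f -> unital_starhom g -> commuting f g ->
  (forall s, nr (tensor_eval f g s) <= nr (tensor_eval iA iD s)) ->
  exists h : T -> B, [/\ unital_starhom h, forall a, h (iA a) = f a
    & forall d, h (iD d) = g d].
Proof.
move=> hA hD AD dn hf hg fg bound.
have /choice[s sP] x := dense_slim x dn.
have sub p q : tensor_eval f g p - tensor_eval f g q
    = tensor_eval f g (p ++ scale_list (-1) q).
  by rewrite eval_cat (eval_scale hf) scaleN1r.
have subT p q : tensor_eval iA iD p - tensor_eval iA iD q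
    = tensor_eval iA iD (p ++ scale_list (-1) q).
  by rewrite eval_cat (eval_scale hA) scaleN1r.
have bound2 p q : nr (tensor_eval f g p - tensor_eval f g q)
    <= nr (tensor_eval iA iD p - tensor_eval iA iD q).
  by rewrite sub subT bound.
have /choice[h hP] x : exists l, slim (fun n => tensor_eval f g (s x n)) l.
  apply: slim_cauchy => e e0; have e2 : 0 < e / 2 by rewrite divr_gt0.
  have [N HN] := sP x _ e2; exists N => m n /HN Hm /HN Hn.
  apply: (le_lt_trans (bound2 _ _)); apply: (le_lt_trans (nr_triangle x _ _)).
  by rewrite (nrB x) [e]splitr ltrD.
have key x p : slim (fun n => tensor_eval iA iD (p n)) x ->
    slim (fun n => tensor_eval f g (p n)) (h x).
  move=> px; have d := slimB px (sP x); rewrite subrr in d.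
  have d' : slim (fun n => tensor_eval f g (p n) - tensor_eval f g (s x n)) 0.
    move=> e /d[N HN]; exists N => n /HN; rewrite !subr0; apply: le_lt_trans.
    exact: bound2.
  have := slimD d' (hP x); rewrite add0r; apply: slim_ext => n.
  by rewrite subrK.
have hpair a d : h (iA a * iD d) = f a * g d.
  apply: (@slim_unique _ _ (fun=> f a * g d)); last exact: slim_cst.
  apply: slim_ext (key _ (fun=> [:: (a, d)]) _) => [n|]; first by rewrite eval_pair.
  by apply: slim_ext (slim_cst _) => n; rewrite eval_pair.
exists h; split; last 2 first.
- by move=> a; rewrite -[iA a]mulr1 -(hom1 hD) hpair (hom1 hg) mulr1.
- by move=> d; rewrite -[iD d]mul1r -(hom1 hA) hpair (hom1 hf) mul1r.
split=> [c x y|| x].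
- apply: (@slim_unique _ _ (fun n => tensor_eval f g (scale_list c (s x n) ++ s y n))).
    apply: key; apply: slim_ext (slimD (slimZ c (sP x)) (sP y)) => n.
    by rewrite eval_cat (eval_scale hA).
  apply: slim_ext (slimD (slimZ c (hP x)) (hP y)) => n.
  by rewrite eval_cat (eval_scale hf).
- split=> [|x y].
    by have := hpair 1 1; rewrite (hom1 hA) (hom1 hD) (hom1 hf) (hom1 hg) !mulr1.
  apply: (@slim_unique _ _ (fun n => tensor_eval f g (mul_list (s x n) (s y n)))).
    apply: key; apply: slim_ext (slimM (sP x) (sP y)) => n.
    by rewrite (eval_mul hA hD).
  apply: slim_ext (slimM (hP x) (hP y)) => n.
  by rewrite (eval_mul hf hg).
- apply: (@slim_unique _ _ (fun n => tensor_eval f g (star_list (s x n)))).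
    apply: key; apply: slim_ext (slim_star (sP x)) => n.
    by rewrite (eval_star hA hD).
  apply: slim_ext (slim_star (hP x)) => n.
  by rewrite (eval_star hf hg).
Qed.

End TensorEval.

(** * Approximate innerness of the half flip *)

Section HalfFlip.
Context {R : realType} {D DD : cstarAlgType R} {i1 i2 : D -> DD} {phi : D -> DD}
  {psi : DD -> D}.
Hypotheses (mt : min_tensor i1 i2) (hphi : unital_starhom phi)
  (phiK : cancel phi psi) (psiK : cancel psi phi) (phi_i1 : aue phi i1).

Let hi1 : unital_starhom i1 := (let: conj (And4 (conj h _) _ _ _) _ := mt in h).
Let hi2 : unital_starhom i2 := (let: conj (And4 (conj _ h) _ _ _) _ := mt in h).
Let i12 : commuting i1 i2 := (let: conj (And4 _ h _ _) _ := mt in h).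
Let ind : forall s, tensor_eval i1 i2 s = 0 -> tensor_null s :=
  (let: conj (And4 _ _ h _) _ := mt in h).
Let dn : dense (range (tensor_eval i1 i2)) := (let: conj (And4 _ _ _ h) _ := mt in h).

Let least (T : cstarAlgType R) (j1 j2 : D -> T) s : cstar_tensor j1 j2 ->
  nr (tensor_eval i1 i2 s) <= nr (tensor_eval j1 j2 s).
Proof. by case: mt => _ m /m /(_ s); rewrite !nrE lecR. Qed.

Let eval_swap s : tensor_eval i2 i1 s = tensor_eval i1 i2 [seq (p.2, p.1) | p <- s].
Proof. by rewrite /tensor_eval big_map; apply: eq_bigr => p _; rewrite i12. Qed.

(** With the legs exchanged, [DD] is again a completion of the algebraic tensor product; minimality
    against this second presentation is the bound that extends the swap. *)
Lemma tensor_flip : exists F : DD -> DD,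
  [/\ unital_starhom F, forall d, F (i1 d) = i2 d & forall d, F (i2 d) = i1 d].
Proof.
have i21 : commuting i2 i1 by move=> a d; rewrite i12.
have swK (s : seq (D * D)) : [seq (p.2, p.1) | p <- [seq (p.2, p.1) | p <- s]] = s.
  by rewrite -map_comp map_id_in // => -[].
apply: (tensor_ext hi1 hi2 i12 dn hi2 hi1 i21) => s.
have ct : cstar_tensor i2 i1.
  split=> //.
  - move=> t; rewrite eval_swap => /ind /tensor_null_swap; by rewrite swK.
  - apply: (subset_dense _ dn) => _ [t _ <-]; exists [seq (p.2, p.1) | p <- t] => //.
    by rewrite eval_swap swK.
have := least [seq (p.2, p.1) | p <- s] ct.
by rewrite [X in _ <= nr X]eval_swap swK -eval_swap.
Qed.

(** Evaluating [phi ~ i1] on [psi \o i2] gives [i2 ~ i1 \o psi \o i2]. Transported to [D], the flip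
    is an automorphism [chi] of order two that carries [psi \o i2] to [psi \o i1]. Applying
    [G = chi (x) id] turns the relation into [i2 ~ i1 \o psi \o i1], and [psi \o i1 ~ id]. *)
Lemma half_flip : aue i1 i2.
Proof.
have hpsi : unital_starhom psi := hom_inv hphi phiK psiK.
have lam_id : aue (psi \o i1) id.
  apply: aue_sym; have := aue_postcomp hpsi phi_i1.
  by have -> : psi \o phi = id by apply/funext.
have i2_i1mu : aue i2 (i1 \o (psi \o i2)).
  have := aue_precomp (psi \o i2) phi_i1.
  by have -> : phi \o (psi \o i2) = i2 by apply/funext => d /=; rewrite psiK.
have [F [hF F1 F2]] := tensor_flip.
have FF x : F (F x) = x.
  by apply: (hom_unique dn (hom_comp hF hF) (hom_id DD)) => d /=; rewrite ?F1 ?F2.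
pose chi := psi \o F \o phi.
have hchi : unital_starhom chi := hom_comp hphi (hom_comp hF hpsi).
have chiK d : chi (chi d) = d by rewrite /chi /= psiK FF phiK.
pose j1 := i1 \o chi; have hj1 : unital_starhom j1 := hom_comp hchi hi1.
have j12 : commuting j1 i2 by move=> a d; apply: i12.
pose cl (s : seq (D * D)) := [seq (chi p.1, p.2) | p <- s].
have evj s : tensor_eval j1 i2 s = tensor_eval i1 i2 (cl s).
  by rewrite /tensor_eval big_map.
have clK s : cl (cl s) = s.
  by rewrite /cl -map_comp map_id_in // => -[a d] _ /=; rewrite chiK.
have ct : cstar_tensor j1 i2.
  split=> //.
  - have chil : linear chi by case: hchi.
    have idl : linear (@id D) by [].
    move=> s; rewrite evj => /ind n; have := tensor_null_map chil idl n.
    by rewrite -[X in tensor_null X -> _]/(cl (cl s)) clK.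
  - apply: (subset_dense _ dn) => _ [t _ <-]; exists (cl t) => //.
    by rewrite evj clK.
have [G [hG G1 G2]] : exists G : DD -> DD,
    [/\ unital_starhom G, forall d, G (i1 d) = j1 d & forall d, G (i2 d) = i2 d].
  apply: (tensor_ext hi1 hi2 i12 dn hj1 hi2 j12) => s.
  by have := least (cl s) ct; rewrite [X in _ <= nr X]evj clK -evj.
have := aue_postcomp hG i2_i1mu.
have -> : G \o i2 = i2 by apply/funext.
have -> : G \o (i1 \o (psi \o i2)) = i1 \o (psi \o i1).
  by apply/funext => d /=; rewrite G1 /j1 /chi /= psiK F2.
move=> H; apply: aue_sym; apply: (aue_trans H).
exact: (aue_postcomp hi1 lam_id).
Qed.

End HalfFlip.

(** * Averaging to scalars *)

Section CompletelyPositive.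
Context {R : realType}.
Implicit Types A D T : cstarAlgType R.

(** A completely positive map given by its Kraus operators. In this form an average over [D] is
    carried into any algebra by applying a homomorphism to the list. *)
Definition cp T (r : seq T) (x : T) : T := \sum_(y <- r) star y * x * y.
Definition ucp T (r : seq T) : Prop := cp r 1 = 1.

Lemma cpD T (r : seq T) x y : cp r (x + y) = cp r x + cp r y.
Proof. by rewrite /cp -big_split; apply: eq_bigr => z _; rewrite mulrDr mulrDl. Qed.

Lemma cpZ T (r : seq T) (c : R[i]) x : cp r (c *: x) = c *: cp r x.
Proof. by rewrite /cp scaler_sumr; apply: eq_bigr => z _; rewrite -scaleAr -scaleAl. Qed.

Lemma cpB T (r : seq T) x y : cp r (x - y) = cp r x - cp r y.
Proof. by rewrite -[- y]scaleN1r cpD cpZ scaleN1r. Qed.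

Lemma cp_psd T (r : seq T) x : psd x -> psd (cp r x).
Proof. by move=> xp; apply: psd_sum => y; apply: psd_conj. Qed.

Lemma cp_sa T (r : seq T) x : sa x -> sa (cp r x).
Proof.
by move=> xs; rewrite /sa /cp star_sum; apply: eq_bigr => y _; apply: sa_conj.
Qed.

Lemma cp_scal T (r : seq T) t : ucp r -> cp r (t :*: 1) = t :*: 1.
Proof. by move=> r1; rewrite /rsc cpZ r1. Qed.

Lemma cp_comp T (r r' : seq T) x :
  cp r' (cp r x) = cp [seq y * y' | y <- r, y' <- r'] x.
Proof.
rewrite /cp big_allpairs_dep exchange_big /=; apply: eq_bigr => y' _.
rewrite mulr_sumr mulr_suml; apply: eq_bigr => y _.
by rewrite star_mul !mulrA.
Qed.

Lemma ucp_comp T (r r' : seq T) : ucp r -> ucp r' ->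
  ucp [seq y * y' | y <- r, y' <- r'].
Proof. by move=> r1 r1'; rewrite /ucp -cp_comp r1. Qed.

Lemma ucp_id T : ucp [:: (1 : T)].
Proof. by rewrite /ucp /cp big_seq1 star1 !mulr1. Qed.

Lemma cp_id T (x : T) : cp [:: 1] x = x.
Proof. by rewrite /cp big_seq1 star1 mulr1 mul1r. Qed.

Lemma hom_cp A T (j : A -> T) (r : seq A) x : unital_starhom j ->
  j (cp r x) = cp (map j r) (j x).
Proof.
move=> hj; rewrite /cp (hom_sum hj) big_map; apply: eq_bigr => y _.
by rewrite !(homM hj) (hom_star hj).
Qed.

Lemma hom_ucp A T (j : A -> T) (r : seq A) : unital_starhom j -> ucp r -> ucp (map j r).
Proof. by move=> hj r1; rewrite /ucp -(hom1 hj) -hom_cp // r1. Qed.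

Lemma psd_norm_sa T (x : T) t : 0 <= t -> psd (t :*: 1 - x) -> psd (t :*: 1 + x) ->
  nr x <= t.
Proof.
move=> t0 p1 p2; have tC := rsc1C t x.
have xs : sa x.
  have -> : x = t :*: 1 - (t :*: 1 - x) by rewrite opprB addrC subrK.
  by apply: saB (psd_sa p1); apply: sa_rsc sa1.
have := @psdM _ _ _ _ p1 p2 (ltac:(ncring_with [:: t :*: (1 : T)])).
have -> : (t :*: 1 - x) * (t :*: 1 + x) = (t ^+ 2) :*: 1 - x ^+ 2.
  by rewrite (expr2 t) rsc1M; ncring_with [:: t :*: (1 : T)].
move=> p3; have := psd_le_norm (exprn_ge0 2 t0) (psd_sq xs) p3.
by rewrite nr_sa_sq // ler_pXn2r ?nnegrE ?nr_ge0.
Qed.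

Lemma nr_cp_sa T (r : seq T) x : ucp r -> sa x -> nr (cp r x) <= nr x.
Proof.
move=> r1 xs; apply: psd_norm_sa; first exact: nr_ge0.
  by rewrite -(cp_scal _ r1) -cpB; apply/cp_psd/psd_sub.
rewrite -(cp_scal _ r1) -cpD -[x in _ + x]opprK.
by apply/cp_psd/psd_sub; [apply: saN | rewrite nrN].
Qed.

Lemma nr_i T (x : T) : nr ('i *: x) = nr x.
Proof. by rewrite nrZ normCi mul1r. Qed.

Lemma sa_decomp T (x : T) : exists a b,
  [/\ sa a, sa b, x = a + 'i *: b, nr a <= nr x & nr b <= nr x].
Proof.
exists (2^-1 :*: (x + star x)), (2^-1 :*: ('i *: (star x - x))).
have half0 : 0 <= (2^-1 : R) by rewrite invr_ge0.
have n0 := nr_ge0 x.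
split.
- by apply: sa_rsc; rewrite /sa starD starK addrC.
- apply: sa_rsc; rewrite /sa starZ starB starK conjCi -(opprB (star x)) scalerN.
  by rewrite scaleNr opprK.
- have -> : 'i *: (2^-1 :*: ('i *: (star x - x))) = 2^-1 :*: (x - star x).
    rewrite /rsc [LHS]scalerA mulrC -scalerA; congr (_ *: _).
    by rewrite scalerA -expr2 sqrCi scaleN1r opprB.
  by rewrite -rscDr addrACA subrr addr0 rsc_half.
- by rewrite nr_rsc ger0_norm //; have := nrD x (star x); rewrite nr_star; lra.
- rewrite nr_rsc ger0_norm // nr_i; have := nrD (star x) (- x).
  by rewrite nrN nr_star; lra.
Qed.

(** The order bounds self-adjoint elements only; real and imaginary parts together cost the factor
    2. It does no harm, since the estimate serves for small errors and for continuity. *)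
Lemma nr_cp T (r : seq T) x : ucp r -> nr (cp r x) <= 2 * nr x.
Proof.
move=> r1; have [a [b [as_ bs -> an bn]]] := sa_decomp x.
have := nrD (cp r a) ('i *: cp r b); rewrite nr_i -cpZ -cpD.
by have := nr_cp_sa r1 as_; have := nr_cp_sa r1 bs; lra.
Qed.

End CompletelyPositive.

Section Averaging.
Context {R : realType} {D DD : cstarAlgType R} {i1 i2 : D -> DD}.
Hypotheses (ct : cstar_tensor i1 i2) (hflip : aue i1 i2).

Let hi1 : unital_starhom i1 := (let: And4 (conj h _) _ _ _ := ct in h).
Let hi2 : unital_starhom i2 := (let: And4 (conj _ h) _ _ _ := ct in h).
Let i12 : commuting i1 i2 := (let: And4 _ h _ _ := ct in h).
Let ind : forall s, tensor_eval i1 i2 s = 0 -> tensor_null s :=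
  (let: And4 _ _ h _ := ct in h).
Let dn : dense (range (tensor_eval i1 i2)) := (let: And4 _ _ _ h := ct in h).

Lemma hom_psd (A B : cstarAlgType R) (f : A -> B) x : unital_starhom f -> psd x -> psd (f x).
Proof.
move=> hf xp; apply: (@psd_eps _ _ _ 1) => t t0.
have [k [ks _ ek _]] := psd_sqrt_eps xp t0.
rewrite -(hom1 hf) -(hom_rsc hf) -(homD hf) -ek expr2 (homM hf) -expr2.
exact/psd_sq/(hom_sa hf).
Qed.

Lemma psd_conjr (T : cstarAlgType R) (x z : T) : psd z -> psd (x * z * star x).
Proof. by move=> /(psd_conj (star x)); rewrite starK. Qed.

(** The leg in [i2] of one term [i1 a * i2 d] is absorbed into the scalar [nr d ^+ 2]. Terms are
    added through [(v + w) X (v + w)^* <= 2 v X v^* + 2 w X w^*], the difference being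
    [(v - w) X (v - w)^*]; hence the factor 2 in [C']. *)
Lemma eval_conj_le (e : D) (s : seq (D * D)) : psd e -> exists C : R, 0 <= C /\
  psd (C :*: i1 (\sum_(p <- s) p.1 * e * star p.1)
       - tensor_eval i1 i2 s * i1 e * star (tensor_eval i1 i2 s)).
Proof.
move=> ep; elim: s => [|[a d] s [C [C0 IH]]].
  exists 0; rewrite /tensor_eval !big_nil !mul0r rsc0 subr0.
  by split=> //; apply: psd0.
set S := \sum_(p <- s) _ in IH *; set w := tensor_eval i1 i2 s in IH *.
pose b := a * e * star a; have bp : psd b by apply: psd_conjr.
have Sp : psd S by apply: psd_sum => p; apply: psd_conjr.
pose v := i1 a * i2 d.
pose M := nr d ^+ 2; have M0 : 0 <= M by rewrite exprn_ge0 // nr_ge0.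
have vp : psd (M :*: i1 b - v * i1 e * star v).
  have -> : M :*: i1 b - v * i1 e * star v = i1 b * (M :*: 1 - i2 (d * star d)).
    rewrite mulrBr -rscAr mulr1; congr (_ - _).
    rewrite /v star_mul /b !(homM hi1) (homM hi2) (hom_star hi1) (hom_star hi2).
    rewrite -!mulrA; congr (_ * _).
    rewrite (mulrA (i2 d)) -i12 -!mulrA; congr (_ * _).
    by rewrite mulrA -(hom_star hi1) -(hom_star hi2) -(homM hi2) -i12.
  apply: psdM; first exact: hom_psd.
  - apply: psd_sub; first by apply: (hom_sa hi2); rewrite /sa star_mul starK.
    by apply: (le_trans (nr_hom hi2 _)); rewrite nr_Mstar.
  - by rewrite mulrBr mulrBl i12 -rscAr -rscAl mulr1 mul1r.
pose C' := 2 * (M + C); exists C'; split; first by rewrite mulr_ge0 // addr_ge0.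
rewrite big_cons /tensor_eval big_cons /= -/S -/(tensor_eval i1 i2 s) -/w -/v -/b.
rewrite (homD hi1).
have -> : C' :*: (i1 b + i1 S) - (v + w) * i1 e * star (v + w)
  = (v - w) * i1 e * star (v - w) + 2 :*: (M :*: i1 b - v * i1 e * star v)
    + 2 :*: (C :*: i1 S - w * i1 e * star w) + (2 * C) :*: i1 b + (2 * M) :*: i1 S.
  rewrite /C' mulrDr starB starD !rscBr !rscA !rscDl !rscDr !rsc1.
  ncring.
have i1S := hom_psd hi1 Sp; have i1b := hom_psd hi1 bp.
do ?apply: psdD; try exact: psd_rsc.
- by apply/psd_conjr/hom_psd.
- by apply: psd_rsc => //; rewrite mulr_ge0.
- by apply: psd_rsc => //; rewrite mulr_ge0.
Qed.

Lemma tensor_pair_neq0 (a d : D) : i1 a * i2 d = 0 -> d <> 0 -> a = 0.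
Proof.
move=> ad0; apply: tensor_null_pair; apply: ind.
by rewrite /tensor_eval big_seq1.
Qed.

(* Through the half flip, i2 e is dominated up to a small error by a multiple
   of i1 (sum x e x^* ); tested against a corner of i2 e this bounds the sum
   below. *)
Lemma full_positive (e : D) : psd e -> e <> 0 ->
  exists r : seq D, \sum_(x <- r) star x * e * x = 1.
Proof.
(* [rho] is half the norm of [e], so [e - rho] has a nonzero positive part. Of [rho = 2 d], one [d]
   pays for the error of the half flip and the other remains as the lower bound of [C :*: S]. *)
move=> ep e0; pose d := nr e / 4; have ne0 := nr_gt0 e0.
have d0 : 0 < d by rewrite divr_gt0.
have es := psd_sa ep.
pose rho := d + d.
have nrho : ~ psd (- (e - rho :*: 1)).
  rewrite opprB => H; have := psd_le_norm _ ep H.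
  by rewrite /rho /d => /(_ (ltac:(lra))); lra.
have [q [qs qp q0]] := pos_part (saB es (sa_rsc rho sa1)) nrho.
have q2 : q * q <> 0.
  move=> qq; apply: q0; have {}qq : q = 0.
    apply/nr0_eq0/eqP; rewrite -sqrf_eq0 -nr_sa_sq // expr2 qq nr0 //.
  by rewrite qq !mul0r.
have [s sP] : exists s, nr (tensor_eval i1 i2 s * i1 e * star (tensor_eval i1 i2 s) - i2 e) <= d.
  have d2 : 0 < d / 2 by rewrite divr_gt0.
  have [u uu] := aue_finite [:: e] hflip d2; move=> /(_ e (mem_head _ _)) ue.
  have [s su] := dense_slim u dn.
  have [N /(_ N (leqnn N)) HN] := slimM (slimMr (i1 e) su) (slim_star su) d2.
  exists (s N); apply: (le_trans (nr_triangle (u * i1 e * star u) _ _)); lra.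
have [C [C0 CP]] := eval_conj_le s ep.
set S := \sum_(p <- s) _ in CP; set X := _ * i1 e * _ in CP sP.
have Xs : sa X by rewrite /X /sa !star_mul starK -(hom_star hi1) es mulrA.
have Ss : sa S.
  rewrite /S /sa star_sum; apply: eq_bigr => p _.
  by rewrite !star_mul starK es mulrA.
pose b := C :*: S - d :*: 1.
have bs : sa b by apply: saB; apply: sa_rsc => //; apply: sa1.
have P1 : psd (i2 (q * q) * i1 b).
  have -> : i2 (q * q) * i1 b =
      i2 q * (C :*: i1 S - X) * i2 q + i2 q * (d :*: 1 - (i2 e - X)) * i2 q
      + i2 (q * (e - rho :*: 1) * q).
    rewrite !(homM hi2) !(homB hi2) /b !(homB hi1) !(hom_rsc hi1) !(hom_rsc hi2).
    rewrite !(hom1 hi1) !(hom1 hi2) /rho rscDl.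
    have -> : i2 q * i2 q * (C :*: i1 S - d :*: 1) = i2 q * (C :*: i1 S - d :*: 1) * i2 q.
      rewrite -!mulrA; congr (_ * _); rewrite mulrBr mulrBl -!rscAr -!rscAl i12.
      by rewrite mulr1 mul1r.
    ncring.
  apply: psdD; first apply: psdD.
  - by apply: psd_conj_sa => //; apply: hom_sa.
  - apply: psd_conj_sa; first exact: (hom_sa hi2).
    apply: psd_sub; last by rewrite nrB.
    by apply: saB => //; apply: hom_sa.
  - exact: hom_psd.
(* Were [b] not positive, a nonzero positive compression [n * - b * n] would exist; its product with
   [i2 (q * q)] is both positive and negative, hence 0, against the independence of the two legs. *)
have bp : psd b.
  apply: contrapT => nb.
  have [n [ns np n0]] : exists q, [/\ sa q, psd (q * - b * q) & q * - b * q <> 0].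
    by apply: pos_part; [apply: saN | rewrite opprK].
  apply: n0; apply: (tensor_pair_neq0 _ q2).
  have qq : psd (q * q) by rewrite -expr2; apply: psd_sq.
  apply: psd_anti; first by apply: psdM; [apply: hom_psd | apply: hom_psd | apply: i12].
  have -> : - (i1 (n * - b * n) * i2 (q * q)) = i1 n * (i2 (q * q) * i1 b) * i1 n.
    have Qn := esym (i12 n (q * q)); have Qb := esym (i12 b (q * q)).
    by rewrite !(homM hi1) (homN hi1); ncring_with [:: i2 (q * q)].
  by apply: psd_conj_sa => //; apply: hom_sa.
have [g [gs ge]] := psd_invsqrt d0 bp.
exists [seq Num.sqrt C :*: (star p.1 * g) | p <- s].
rewrite big_map -ge /S rsc_sum mulr_sumr mulr_suml; apply: eq_bigr => p _.
rewrite star_rsc star_mul starK gs -!rscAl -!rscAr rscA -expr2 sqr_sqrtr //.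
by rewrite -rscAl !mulrA.
Qed.

(** After a shift making the element a positive [c] of norm [N], the cut-off [q] selects the part
    where [c] exceeds [rho], close to [N]. Since [q ^+ 2] can be averaged to 1, the same average
    compressed by [q] squeezes [c] between [rho] and [N]. *)
Lemma averaging (d : D) (e : R) : sa d -> 0 < e ->
  exists r t, ucp r /\ nr (cp r d - t :*: 1) <= e.
Proof.
move=> ds e0; pose c := nr d :*: 1 + d.
have cpd : psd c.
  by rewrite /c -[d in _ + d]opprK; apply: psd_sub; [apply: saN | rewrite nrN].
have ed : d = c - nr d :*: 1 by rewrite /c addrC addKr.
have [c0|/eqP c0] := eqVneq c 0.
  exists [:: 1], (- nr d); split; first exact: ucp_id.
  by rewrite cp_id {1}ed c0 sub0r rscNl subrr nr0 ltW.
pose N := nr c; have N0 : 0 < N := nr_gt0 c0.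
pose rho := Num.max (N - e) 0.
have rho0 : 0 <= rho by rewrite le_max lexx orbT.
have rhoN : rho < N by rewrite gt_max N0 andbT ltrBlDr ltrDl.
have rhoe : N - rho <= e by rewrite lerBlDl -lerBlDr le_max lexx.
have [q [qs qp q0]] : exists q, [/\ sa q, psd (q * (c - rho :*: 1) * q)
    & q * (c - rho :*: 1) * q <> 0].
  apply: pos_part; first by apply: saB (psd_sa cpd) _; apply: sa_rsc sa1.
  rewrite opprB => /(psd_le_norm rho0 cpd); rewrite -/N; lra.
have q2 : q ^+ 2 <> 0.
  move=> qq; apply: q0; have {}qq : q = 0.
    by apply/nr0_eq0/eqP; rewrite -sqrf_eq0 -nr_sa_sq // qq nr0.
  by rewrite qq !mul0r.
have [r rP] := full_positive (psd_sq qs) q2.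
have qr x : cp (map ( *%R q) r) x = \sum_(y <- r) star y * (q * x * q) * y.
  by rewrite /cp big_map; apply: eq_bigr => y _; rewrite star_mul qs !mulrA.
have r1 : ucp (map ( *%R q) r).
  by rewrite /ucp qr -[RHS]rP; apply: eq_bigr => y _; rewrite mulr1 expr2.
exists (map ( *%R q) r), (N - nr d); split=> //.
rewrite {1}ed cpB (cp_scal _ r1) rscBl opprB addrA subrK nrB.
apply: psd_le_norm; first exact: ltW.
  rewrite -(cp_scal _ r1) -cpB; apply: cp_psd; apply: psd_sub => //.
  exact: psd_sa.
have -> : e :*: 1 - (N :*: 1 - cp (map ( *%R q) r) c)
    = (e - (N - rho)) :*: 1 + cp (map ( *%R q) r) (c - rho :*: 1).
  by rewrite cpB (cp_scal _ r1) !rscBl; ncring.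
apply: psdD; first by apply: psd_rsc1; rewrite subr_ge0.
by rewrite qr; apply: psd_sum => y; apply: psd_conj.
Qed.

(** Elements are treated one after the other: a unital average fixes scalars and does not increase
    the distance of a self-adjoint element to them, so earlier gains persist. *)
Lemma averaging_seq (L : seq D) (e : R) : 0 < e -> (forall d, d \in L -> sa d) ->
  exists r, ucp r /\ forall d, d \in L -> exists t, nr (cp r d - t :*: 1) <= e.
Proof.
move=> e0; elim: L => [|d L IH] Ls.
  by exists [:: 1]; split; first exact: ucp_id.
have [|r [r1 rL]] := IH; first by move=> x xL; apply: Ls; rewrite inE xL orbT.
have [|r' [t [r1' rt]]] := @averaging (cp r d) e _ e0.
  by apply: cp_sa; apply: Ls; rewrite mem_head.
exists [seq y * y' | y <- r, y' <- r']; split; first exact: ucp_comp.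
move=> x; rewrite inE => /orP[/eqP ->|xL]; first by exists t; rewrite -cp_comp.
have [t' tx] := rL x xL; exists t'; rewrite -cp_comp -(cp_scal t' r1') -cpB.
apply: le_trans tx; apply: nr_cp_sa => //; apply: saB; last exact: sa_rsc sa1.
by apply: cp_sa; apply: Ls; rewrite inE xL orbT.
Qed.

End Averaging.

(** * States and slices *)

Section ScalarLimit.
Context {R : realType}.
Implicit Types D T : cstarAlgType R.

Lemma scalar_closed T (l : T) :
  (forall e : R, 0 < e -> exists t, nr (l - t :*: 1) <= e) -> exists t, l = t :*: 1.
Proof.
move=> H; have [n1|n1] := eqVneq (nr (1 : T)) 0.
  by exists 0; rewrite -[l]mulr1 (nr0_eq0 n1) mulr0 rsc0r.
have {n1} n1 : nr (1 : T) = 1.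
  apply: (mulfI n1); rewrite mulr1; have := nr_starM (1 : T).
  by rewrite star1 mulr1 expr2 => <-.
have /choice[t tP] n : exists t, nr (l - t :*: 1) <= n.+1%:R^-1.
  by apply: H; rewrite invr_gt0.
have small e : 0 < e -> exists N, forall n, (N <= n)%N -> n.+1%:R^-1 < e :> R.
  move=> e0; have [N HN] := slim_harmonic (1 : T) e0; exists N => n /HN.
  by rewrite subr0 nr_rsc n1 mulr1 ger0_norm // invr_ge0.
have : cvgn t.
  apply/cauchy_cvgP/cauchy_exP => e e0; have [N HN] := small _ (divr_gt0 e0 (ltr0Sn R 1)).
  exists (t N); exists N => // n /= Nn; rewrite /ball /=.
  have -> : `|t N - t n| = nr (t N :*: (1 : T) - t n :*: 1).
    by rewrite -rscBl nr_rsc n1 mulr1.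
  apply: (le_lt_trans (nr_triangle l _ _)); rewrite (nrB _ l).
  apply: (le_lt_trans (lerD (tP N) (tP n))).
  by rewrite [X in _ < X]splitr; apply: ltrD; apply: HN.
move=> /cvg_ex[/= s ts]; exists s; apply: (@slim_unique _ _ (fun n => t n :*: 1)).
  move=> e /small[N HN]; exists N => n /HN; apply: le_lt_trans.
  by rewrite nrB.
move=> e e0; have /cvgrPdist_lt/(_ _ e0)[N _ HN] := ts.
exists N => n /HN /=; rewrite -rscBl nr_rsc n1 mulr1 distrC; exact.
Qed.

Lemma separable_seq D : separable_space D -> exists f : nat -> D,
  forall x (e : R), 0 < e -> exists n, nr (f n - x) < e.
Proof.
case=> S [Sc Sd].
have S0 : S !=set0.
  have [||x [_ Sx]] := Sd setT; [by exists 0 | exact: openT | by exists x].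
have /pcard_surjP[f fS] : countable S := Sc.
exists f => x e e0; have [|y [/= xy Sy]] := Sd [set y | nr (x - y) < e] _ (nball_open x e0).
  by exists x; rewrite /= subrr nr0.
by have [n _ ny] := fS y Sy; exists n; rewrite ny nrB.
Qed.

Lemma separable_sa_seq D : separable_space D -> exists s : nat -> D,
  (forall n, sa (s n)) /\ forall x (e : R), sa x -> 0 < e -> exists n, nr (s n - x) < e.
Proof.
move=> /separable_seq[f dense_f]; pose re x := 2^-1 :*: (x + star x) : D.
exists (re \o f); split=> [n|x e xs e0] /=.
  by apply: sa_rsc; rewrite /sa starD starK addrC.
have [n fn] := dense_f x e e0; exists n; apply: le_lt_trans fn.
have {1}-> : x = re x by rewrite /re xs rsc_half.
have half0 : 0 <= (2^-1 : R) by rewrite invr_ge0.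
rewrite /re -rscBr opprD addrACA -starB nr_rsc ger0_norm //.
by have := nrD (f n - x) (star (f n - x)); rewrite nr_star; lra.
Qed.

End ScalarLimit.

Section State.
Context {R : realType} {D DD : cstarAlgType R} {i1 i2 : D -> DD}.
Hypotheses (sepD : separable_space D) (ct : cstar_tensor i1 i2) (hflip : aue i1 i2).

(** Stage [n] brings the first [n + 1] terms of a dense self-adjoint sequence within [1 / (n + 1)]
    of scalars, and later averages preserve this. The state is kept together with its averages,
    because these are what can be performed inside another algebra. *)
Lemma exists_state : exists (r : nat -> seq D) (om : D -> R[i]),
  (forall n, ucp (r n)) /\ forall d, slim (fun n => cp (r n) d) (om d *: (1 : D)).
Proof.
have [s [ss sd]] := separable_sa_seq sepD.
have pos n : 0 < n.+1%:R^-1 :> R by rewrite invr_gt0.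
have /choice[next nextP] (nx : nat * seq D) : exists r', ucp nx.2 -> ucp r' /\
    forall k, (k <= nx.1)%N -> exists t, nr (cp r' (cp nx.2 (s k)) - t :*: 1) <= nx.1.+1%:R^-1.
  case: nx => n r; have [|r' [r1' rP]] := @averaging_seq _ _ _ _ _ ct hflip
      [seq cp r (s k) | k <- iota 0 n.+1] _ (pos n).
    by move=> d /mapP[k _ ->]; apply: cp_sa.
  exists r' => _; split=> //= k kn; apply: rP; apply: (map_f (fun j => cp r (s j))).
  by rewrite mem_iota add0n ltnS.
pose fix rr n : seq D := if n is n'.+1 then
  [seq y * y' | y <- rr n', y' <- next (n', rr n')] else [:: 1].
have r1 n : ucp (rr n).
  elim: n => [|n IH] /=; first exact: ucp_id.
  by apply: ucp_comp => //; case: (nextP (n, rr n) IH).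
have rS n x : cp (rr n.+1) x = cp (next (n, rr n)) (cp (rr n) x) by rewrite cp_comp.
have r1' n : ucp (next (n, rr n)) by case: (nextP (n, rr n) (r1 n)).
have later n m x t : sa x -> (n <= m)%N -> nr (cp (rr m) x - t :*: 1) <= nr (cp (rr n) x - t :*: 1).
  move=> xs /subnK <-; elim: (m - n)%N => [//|k IH]; apply: le_trans IH.
  rewrite addSn rS -{1}(cp_scal t (r1' (k + n)%N)) -cpB; apply: nr_cp_sa => //.
  by apply: saB; [apply: cp_sa | apply: sa_rsc sa1].
have close x e : sa x -> 0 < e -> exists N t, forall m, (N <= m)%N ->
    nr (cp (rr m) x - t :*: 1) <= e.
  move=> xs e0; have e2 : 0 < e / 2 by rewrite divr_gt0.
  have [k kx] := sd x _ xs e2; have [M HM] := slim_harmonic (1 : D) e2.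
  have [N /= Nk Ne] : exists2 N, (k <= N)%N & N.+1%:R^-1 <= e / 2.
    exists (maxn k (Num.bound (e / 2)^-1)); first exact: leq_maxl.
    rewrite invf_ple ?posrE //; apply: (le_trans (ltW (archi_boundP _))).
      by rewrite invr_ge0 ltW.
    by rewrite ler_nat (leq_trans (leq_maxr k _)).
  have [_ /(_ k Nk)[t tP]] := nextP (N, rr N) (r1 N).
  exists N.+1, t => m Nm; have := later _ _ _ t (ss k) Nm; rewrite rS => H.
  have -> : cp (rr m) x - t :*: 1 = cp (rr m) (x - s k) + (cp (rr m) (s k) - t :*: 1).
    by rewrite cpB addrA subrK.
  apply: (le_trans (nrD _ _)); rewrite [leRHS]splitr; apply: lerD.
    apply: (le_trans (nr_cp_sa (r1 m) (saB xs (ss k)))); rewrite nrB; exact: ltW.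
  by apply: (le_trans H); apply: (le_trans tP).
have sa_lim x : sa x -> exists t : R, slim (fun n => cp (rr n) x) (t :*: 1).
  move=> xs; have [l xl] : exists l, slim (fun n => cp (rr n) x) l.
    apply: slim_cauchy => e e0; have e3 : 0 < e / 3 by rewrite divr_gt0.
    have [N [t tP]] := close x _ xs e3; exists N => m n /tP Hm /tP Hn.
    apply: (le_lt_trans (nr_triangle (t :*: 1) _ _)); rewrite (nrB _ (cp _ _)); lra.
  have [e e0|t lt] := @scalar_closed _ _ l; last by exists t; rewrite -lt.
  have [N [t tP]] := close x e xs e0; exists t.
  apply: (nr_slim_le (slimB (slim_shift N xl) (slim_cst (t :*: 1)))) => n.
  by apply: tP; rewrite leq_addl.
have /choice[om omP] d : exists c : R[i], slim (fun n => cp (rr n) d) (c *: (1 : D)).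
  have [a [b [/sa_lim[t ta] /sa_lim[u ub] -> _ _]]] := sa_decomp d.
  exists (t%:C + 'i * u%:C); rewrite scalerDl -scalerA.
  by apply: slim_ext (slimD ta (slimZ 'i ub)) => n; rewrite cpD cpZ.
by exists rr, om.
Qed.

End State.

Section Slices.
Context {R : realType} {D T : cstarAlgType R} {r : nat -> seq D} {om : D -> R[i]}
  {k : D -> T}.
Hypotheses (r1 : forall n, ucp (r n))
  (om_lim : forall d, slim (fun n => cp (r n) d) (om d *: (1 : D)))
  (hk : unital_starhom k).

Lemma state1 : om 1 *: (1 : D) = 1.
Proof. by apply: (slim_unique (om_lim 1)); apply: slim_ext (slim_cst 1) => n; rewrite r1. Qed.

Let cpk n (t : T) d : (forall x, t * k x = k x * t) ->
  cp (map k (r n)) (t * k d) = t * k (cp (r n) d).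
Proof.
move=> tk; rewrite (hom_cp _ _ hk) /cp mulr_sumr big_map [in RHS]big_map.
by apply: eq_bigr => y _; rewrite !mulrA -(hom_star hk) tk.
Qed.

Let slim_cpk (t : T) d : (forall x, t * k x = k x * t) ->
  slim (fun n => cp (map k (r n)) (t * k d)) (om d *: t).
Proof.
move=> tk; have := slimMl t (hom_slim hk (om_lim d)).
rewrite (homZ hk) (hom1 hk) -scaleAr mulr1.
by apply: slim_ext => n; rewrite cpk.
Qed.

(* Compressing the leg k(D) by the maps E_n -> omega turns sum t k(c) into
   sum omega(c) t. *)
Lemma slice_bound (L : seq (T * D)) :
  (forall p, p \in L -> forall x, p.1 * k x = k x * p.1) ->
  nr (\sum_(p <- L) om p.2 *: p.1) <= 2 * nr (\sum_(p <- L) p.1 * k p.2).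
Proof.
move=> Lk; have key (L' : seq (T * D)) : {subset L' <= L} ->
    slim (fun n => cp (map k (r n)) (\sum_(p <- L') p.1 * k p.2)) (\sum_(p <- L') om p.2 *: p.1).
  elim: L' => [|p L' IH] sub.
    rewrite !big_nil; apply: slim_ext (slim_cst 0) => n.
    by rewrite /cp big1 // => y _; rewrite mulr0 mul0r.
  rewrite !big_cons; apply: slim_ext (slimD (slim_cpk p.2 _) (IH _)) => [n||x xL].
  - by rewrite cpD.
  - by apply: Lk; apply: sub; rewrite mem_head.
  - by apply: sub; rewrite inE xL orbT.
apply: (nr_slim_le (key L (fun _ => id))) => n.
by apply: nr_cp; apply: hom_ucp.
Qed.

(** The double sum is the slice by [om] of [w * star w], where [w] sums the products [p.1 * k p.2],
    and slices are limits of positive maps. *)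
Lemma state_kernel_psd (M : seq (T * D)) :
  (forall p, p \in M -> forall x, p.1 * k x = k x * p.1) ->
  psd (\sum_(p <- M) \sum_(q <- M) om (p.2 * star q.2) *: (p.1 * star q.1)).
Proof.
move=> Mk.
have Mk' p x : p \in M -> k x * star p.1 = star p.1 * k x.
  move=> /Mk /(_ (star x)) e; rewrite -[k x]starK -(hom_star hk) -star_mul e.
  by rewrite star_mul (hom_star hk) starK.
pose w := \sum_(p <- M) p.1 * k p.2.
have ww : w * star w = \sum_(p <- M) \sum_(q <- M) p.1 * star q.1 * k (p.2 * star q.2).
  rewrite /w star_sum big_distrlr /= big_seq [RHS]big_seq; apply: eq_bigr => p pM.
  rewrite big_seq [RHS]big_seq; apply: eq_bigr => q qM.
  rewrite star_mul (homM hk) -(hom_star hk) -!mulrA; congr (_ * _).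
  by rewrite (Mk' q) // mulrA (Mk' q) // -mulrA.
apply: (@psd_slim _ _ (fun n => cp (map k (r n)) (w * star w))).
  by move=> n; apply: cp_psd; rewrite -{1}[w]starK; apply: psd_star_mul.
rewrite ww; have cpS n (L : seq (T * D)) (F : T * D -> T) :
    cp (map k (r n)) (\sum_(p <- L) F p) = \sum_(p <- L) cp (map k (r n)) (F p).
  elim: L => [|p L IH]; rewrite ?big_cons ?cpD ?IH // !big_nil /cp big1 //.
  by move=> y _; rewrite mulr0 mul0r.
apply: (@slim_ext _ _ (fun n => \sum_(p <- M) \sum_(q <- M)
    cp (map k (r n)) (p.1 * star q.1 * k (p.2 * star q.2)))) => [n|].
  by rewrite cpS; apply: eq_bigr => p _; rewrite cpS.
apply: slim_sum => p pM; apply: slim_sum => q qM; apply: slim_cpk => x.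
by rewrite -mulrA -Mk' // mulrA Mk // mulrA.
Qed.

End Slices.

(** * The universal property of D (x) D *)

Section TensorBound.
Context {R : realType} {D DD T : cstarAlgType R} {i1 i2 : D -> DD} {f g k : D -> T}
  {r : nat -> seq D} {om : D -> R[i]}.
Hypotheses (ct : cstar_tensor i1 i2) (hflip : aue i1 i2)
  (iso1 : forall x, nr x <= nr (i1 x)) (iso2 : forall x, nr x <= nr (i2 x))
  (r1 : forall n, ucp (r n))
  (om_lim : forall d, slim (fun n => cp (r n) d) (om d *: (1 : D)))
  (hf : unital_starhom f) (hg : unital_starhom g) (hk : unital_starhom k)
  (fg : commuting f g) (fk : commuting f k) (gk : commuting g k).
Implicit Types w z : seq (D * D).

Let hi1 : unital_starhom i1 := (let: And4 (conj h _) _ _ _ := ct in h).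
Let hi2 : unital_starhom i2 := (let: And4 (conj _ h) _ _ _ := ct in h).
Let i12 : commuting i1 i2 := (let: And4 _ h _ _ := ct in h).
Let dn : dense (range (tensor_eval i1 i2)) := (let: And4 _ _ _ h := ct in h).

(* d |-> (omega (x) id)(w (d (x) 1) w^* ), of finite rank, which is close to
   the identity when w is close to a unitary implementing the half flip. *)
Let theta w (d : D) : D :=
  \sum_(x <- w) \sum_(y <- w) om (x.1 * d * star y.1) *: (x.2 * star y.2).

Let Phi w z : T := tensor_eval f (g \o theta w) z.

(** The difference is a slice, along the leg [i1], of the half flip error. The extra pair
    [(i2 (- d), 1)] contributes [- d] because [om] is 1 at 1. *)
Lemma theta_close w d : nr (theta w d - d) <=
  2 * nr (tensor_eval i1 i2 w * i1 d * star (tensor_eval i1 i2 w) - i2 d).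
Proof.
apply: (le_trans (iso2 _)).
pose L := [seq (i2 (x.2 * star y.2), x.1 * d * star y.1) | x <- w, y <- w]
  ++ [:: (i2 (- d), 1)].
have := @slice_bound _ _ _ _ _ i1 r1 om_lim hi1 L.
have -> : \sum_(p <- L) om p.2 *: p.1 = i2 (theta w d - d).
  rewrite /L big_cat big_allpairs_dep big_seq1 /= (homD hi2); congr (_ + _).
    rewrite (hom_sum hi2); apply: eq_bigr => x _.
    by rewrite (hom_sum hi2); apply: eq_bigr => y _; rewrite (homZ hi2).
  by rewrite -(homZ hi2) -{1}[- d]mul1r scaleAl (state1 r1 om_lim) mul1r.
have -> : \sum_(p <- L) p.1 * i1 p.2
    = tensor_eval i1 i2 w * i1 d * star (tensor_eval i1 i2 w) - i2 d.
  rewrite /L big_cat big_allpairs_dep big_seq1 /= (hom1 hi1) mulr1 (homN hi2).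
  congr (_ - _); rewrite /tensor_eval star_sum !mulr_suml; apply: eq_bigr => x _.
  rewrite mulr_sumr; apply: eq_bigr => y _.
  rewrite star_mul -(hom_star hi1) -(hom_star hi2) -i12 !(homM hi1) !(homM hi2).
  have c3 := i12 d x.2; have c5 := i12 (star y.1) x.2.
  rewrite -(i12 (star y.1) (star y.2)) -!mulrA; congr (_ * _).
  by rewrite (mulrA (i2 x.2)) -c3 -!mulrA (mulrA (i2 x.2) (i1 (star y.1))) -c5 -!mulrA.
apply=> p; rewrite /L mem_cat => /orP[/allpairsP[[x y] [_ _ ->]]|].
  by move=> a /=; rewrite -i12.
by rewrite inE => /eqP -> a /=; rewrite -i12.
Qed.

(** [Phi w] is [f (x) g] with the second leg passed through [theta w]. The homomorphism [k] enters
    here: it hosts the state, and the value is the slice of a positive element built from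
    [f p.1 * g x.2 * k (x.1 * p.2)]. *)
Lemma Phi_psd w h : psd (Phi w (mul_list h (star_list h))).
Proof.
pose M := [seq (f p.1 * g x.2, x.1 * p.2) | p <- h, x <- w].
have := @state_kernel_psd _ _ _ _ _ k om_lim hk M.
have -> : \sum_(p <- M) \sum_(q <- M) om (p.2 * star q.2) *: (p.1 * star q.1)
    = Phi w (mul_list h (star_list h)).
  rewrite /M big_allpairs_dep /Phi /tensor_eval /mul_list big_allpairs_dep.
  apply: eq_bigr => p _; rewrite /star_list big_map.
  under eq_bigr do rewrite big_allpairs_dep.
  rewrite exchange_big; apply: eq_bigr => q _ /=.
  rewrite /theta (hom_sum hg) mulr_sumr; apply: eq_bigr => x _.
  rewrite (hom_sum hg) mulr_sumr; apply: eq_bigr => y _.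
  rewrite (homZ hg) -scaleAr !star_mul; congr (om _ *: _); first by rewrite !mulrA.
  rewrite (homM hf) (homM hg) -(hom_star hg) -(hom_star hf) -!mulrA; congr (_ * _).
  by rewrite -fg mulrA -fg -mulrA.
apply=> p /allpairsP[[a x] [_ _ ->]] b /=.
by rewrite -mulrA gk mulrA fk mulrA.
Qed.

(** [theta w] has finite rank, so [Phi w] is a finite sum of slices along [i2], each bounded. The
    constant depends on [w] and serves only for continuity. *)
Lemma Phi_bound w : exists C : R, forall z, nr (Phi w z) <= C * nr (tensor_eval i1 i2 z).
Proof.
exists (\sum_(x <- w) \sum_(y <- w) 2 * nr x.1 * nr y.1 * nr (x.2 * star y.2)) => z.
have -> : Phi w z = \sum_(x <- w) \sum_(y <- w)
    f (\sum_(p <- z) om (x.1 * p.2 * star y.1) *: p.1) * g (x.2 * star y.2).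
  rewrite /Phi /tensor_eval (eq_bigr (fun p : D * D => \sum_(x <- w) \sum_(y <- w)
      f p.1 * g (om (x.1 * p.2 * star y.1) *: (x.2 * star y.2)))); last first.
    move=> p _; rewrite /= /theta (hom_sum hg) mulr_sumr; apply: eq_bigr => x _.
    by rewrite (hom_sum hg) mulr_sumr.
  rewrite exchange_big; apply: eq_bigr => x _ /=.
  rewrite exchange_big; apply: eq_bigr => y _ /=.
  rewrite (hom_sum hf) mulr_suml; apply: eq_bigr => p _.
  by rewrite (homZ hf) (homZ hg) -scaleAr -scaleAl.
apply: (le_trans (nr_sum _ _)); rewrite mulr_suml; apply: ler_sum => x _.
apply: (le_trans (nr_sum _ _)); rewrite mulr_suml; apply: ler_sum => y _.
rewrite mulrAC; apply: nrM_le; last exact: nr_hom.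
apply: (le_trans (nr_hom hf _)); apply: (le_trans (iso1 _)).
pose L := [seq (i1 p.1, x.1 * p.2 * star y.1) | p <- z].
have := @slice_bound _ _ _ _ _ i2 r1 om_lim hi2 L.
have -> : \sum_(p <- L) om p.2 *: p.1
    = i1 (\sum_(p <- z) om (x.1 * p.2 * star y.1) *: p.1).
  by rewrite big_map (hom_sum hi1); apply: eq_bigr => p _; rewrite (homZ hi1).
have -> : \sum_(p <- L) p.1 * i2 p.2 = i2 x.1 * tensor_eval i1 i2 z * star (i2 y.1).
  rewrite big_map /tensor_eval mulr_sumr mulr_suml; apply: eq_bigr => p _ /=.
  by rewrite !(homM hi2) (hom_star hi2) !mulrA i12.
move=> H; apply: (le_trans (H _)).
  by move=> p /mapP[q _ ->] a /=; apply: i12.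
rewrite -!mulrA ler_wpM2l // mulrA [leRHS]mulrA.
rewrite [nr x.1 * nr y.1 * _]mulrAC.
apply: nrM_le; last by rewrite nr_star nr_hom.
by apply: nrM_le => //; apply: nr_hom.
Qed.

Lemma eval_scal1 (t : R) :
  tensor_eval i1 i2 (scale_list t%:C [:: (1, 1)]) = t :*: 1.
Proof. by rewrite (eval_scale hi1) eval_pair (hom1 hi1) (hom1 hi2) mulr1. Qed.

(** A positive map is controlled by its value at 1. With [Z] of norm [L], [L + e - Z] is a square
    [h ^+ 2]; approximating [h] by elements of the algebraic tensor product makes [Phi_psd]
    applicable, and [Phi_bound] passes to the limit. *)
Lemma Phi_le w v : nr (Phi w (mul_list v (star_list v))) <=
  nr (tensor_eval i1 i2 (mul_list v (star_list v))) * nr (theta w 1).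
Proof.
set z := mul_list v _; set L := nr (tensor_eval i1 i2 z); have L0 : 0 <= L := nr_ge0 _.
set Z := tensor_eval i1 i2 z in L L0 *.
have ZE : Z = tensor_eval i1 i2 v * star (tensor_eval i1 i2 v).
  by rewrite /Z (eval_mul hi1 hi2 i12) (eval_star hi1 hi2 i12).
have Zs : sa Z by rewrite ZE /sa star_mul starK.
pose one : seq (D * D) := [:: (1, 1)].
have Phi1 : Phi w one = g (theta w 1).
  by rewrite /Phi eval_pair /= (hom1 hf) mul1r.
have Phi1p : psd (Phi w one).
  by have := Phi_psd w one; rewrite /mul_list /star_list /= !star1 !mulr1.
have [C CP] := Phi_bound w.
have le1 : psd (L :*: Phi w one - Phi w z).
  apply: (@psd_eps _ _ _ (Phi w one)) => e e0.
  have [h [hs _ eh _]] := psd_sqrt_eps (psd_sub Zs (lexx _)) e0.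
  have [p ph] := dense_slim h dn.
  pose q n := mul_list (p n) (star_list (p n)).
  pose y n := scale_list (L + e)%:C one ++ scale_list (-1) z ++ scale_list (-1) (q n).
  have y0 : slim (fun n => tensor_eval i1 i2 (y n)) 0.
    have -> : (0 : DD) = (L + e) :*: 1 + (- Z + - (h * star h)).
      by rewrite hs -expr2 eh rscDl -/L; ncring.
    apply: slim_ext (slimD (slim_cst _) (slimD (slim_cst _)
      (slimN (slimM ph (slim_star ph))))) => n.
    rewrite /y !eval_cat eval_scal1 !(eval_scale hi1) !scaleN1r -/Z /q.
    by rewrite (eval_mul hi1 hi2 i12) (eval_star hi1 hi2 i12).
  have Phi0 : slim (fun n => Phi w (y n)) 0.
    move=> d d0; have C1 : 0 < `|C| + 1 by rewrite ltr_wpDl.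
    have [N HN] := y0 _ (divr_gt0 d0 C1); exists N => n /HN.
    rewrite !subr0 ltr_pdivlMr // mulrC; apply: le_lt_trans.
    apply: (le_trans (CP _)); rewrite ler_wpM2r ?nr_ge0 //.
    by apply: (le_trans (ler_norm C)); rewrite lerDl.
  apply: (@psd_slim _ _ (fun n => Phi w (q n))); first by move=> n; apply: Phi_psd.
  have -> : L :*: Phi w one - Phi w z + e :*: Phi w one
      = (L + e) :*: Phi w one - Phi w z - 0 by rewrite rscDl; ncring.
  apply: slim_ext (slimB (slim_cst ((L + e) :*: Phi w one - Phi w z)) Phi0) => n.
  have -> : Phi w (y n) = (L + e) :*: Phi w one - Phi w z - Phi w (q n).
    by rewrite /Phi /y !eval_cat !(eval_scale hf) !scaleN1r addrA.
  ncring.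
pose m := nr (Phi w one).
have m0 : 0 <= m := nr_ge0 _.
apply: (@le_trans _ _ (L * m)); last by rewrite ler_wpM2l // /m Phi1 nr_hom.
apply: psd_le_norm; [by rewrite mulr_ge0 | exact: Phi_psd |].
have -> : (L * m) :*: 1 - Phi w z
    = L :*: (m :*: 1 - Phi w one) + (L :*: Phi w one - Phi w z).
  by rewrite rscBr rscA; ncring.
apply: psdD => //; apply: psd_rsc => //; apply: psd_sub => //.
exact: psd_sa.
Qed.

(** By the C*-identity it is enough to treat [z], the product of [s] with its adjoint. As [theta w]
    tends to the identity, [Phi w z] tends to the value of [f (x) g] at [z], while the factor
    [nr (theta w 1)] falls to at most 1. *)
Lemma tensor_bound s : nr (tensor_eval f g s) <= nr (tensor_eval i1 i2 s).
Proof.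
rewrite -(@ler_pXn2r _ 2) ?nnegrE ?nr_ge0 // -!nr_Mstar.
rewrite -(eval_star hf hg fg) -(eval_mul hf hg fg).
rewrite -(eval_star hi1 hi2 i12) -(eval_mul hi1 hi2 i12).
set z := mul_list s (star_list s); set L := nr (tensor_eval i1 i2 z).
have L0 : 0 <= L := nr_ge0 _.
pose K := \sum_(p <- z) nr p.1.
have K0 : 0 <= K by apply: sumr_ge0 => p _; apply: nr_ge0.
(* The two errors are [K * (4 * d)], from replacing [g] by [g \o theta], and [L * (4 * d)], from
   [theta] at 1. *)
apply/ler_addgt0Pr => e e0; pose c := 4 * (L + K) + 1.
have c0 : 0 < c by rewrite /c; lra.
pose d := e / c; have d0 : 0 < d by rewrite divr_gt0.
pose F := 1 :: [seq p.2 | p <- z].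
have [u uu uF] := aue_finite F hflip d0.
have [w wu] := dense_slim u dn.
have lim x : slim (fun n => tensor_eval i1 i2 (w n) * i1 x * star (tensor_eval i1 i2 (w n)))
    (u * i1 x * star u) by apply: slimM (slimMr _ wu) (slim_star wu).
have [N /(_ N (leqnn N)) HN] := slim_finite_in F lim d0.
have th x : x \in F -> nr (theta (w N) x - x) <= 4 * d.
  move=> xF; apply: (le_trans (theta_close _ _)).
  have := nr_triangle (u * i1 x * star u)
    (tensor_eval i1 i2 (w N) * i1 x * star (tensor_eval i1 i2 (w N))) (i2 x).
  have := HN x xF; have := uF x xF; lra.
have close : nr (tensor_eval f g z - Phi (w N) z) <= K * (4 * d).
  rewrite /Phi /tensor_eval -sumrB; apply: (le_trans (nr_sum _ _)).
  rewrite /K mulr_suml big_seq [leRHS]big_seq; apply: ler_sum => p pz.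
  rewrite -mulrBr; apply: nrM_le; first exact: nr_hom.
  rewrite -(homB hg); apply: (le_trans (nr_hom hg _)); rewrite nrB; apply: th.
  by rewrite inE map_f ?orbT.
have P1 := Phi_le (w N) s; rewrite -/z -/L in P1.
have t1 : nr (theta (w N) 1) <= 1 + 4 * d.
  have := nr_leB (theta (w N) 1) 1; have := th 1 (mem_head _ _).
  have := nr1_le1 (A := D); lra.
have P2 : nr (Phi (w N) z) <= L * (1 + 4 * d).
  by apply: (le_trans P1); rewrite ler_wpM2l.
have := nr_leB (tensor_eval f g z) (Phi (w N) z).
have dc : c * d = e by rewrite /d mulrC divfK // gt_eqF.
have d00 := ltW d0; rewrite -dc /c; nra.
Qed.

End TensorBound.

Section UniversalProperty.
Context {R : realType} {D DD : cstarAlgType R} {i1 i2 phi : D -> DD} {psi : DD -> D}.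
Hypotheses (sepD : separable_space D) (mt : min_tensor i1 i2)
  (hphi : unital_starhom phi) (phiK : cancel phi psi) (psiK : cancel psi phi)
  (phi_i1 : aue phi i1).

Lemma aue_nr (A B : cstarAlgType R) (s t : A -> B) x : aue s t -> nr (t x) <= nr (s x).
Proof.
case=> u [uu us]; apply: (nr_slim_le (us x)) => n.
by rewrite nr_unitary_conj.
Qed.

(** [tensor_bound] applies to [f] and [g \o lam], with [g \o mu] hosting the state. Conjugation by
    [g (v n)] fixes the range of [f] and turns [g \o lam] into [g] in the limit, so the bound passes
    to [f] and [g]. *)
Lemma universal (T : cstarAlgType R) (f g : D -> T) :
  unital_starhom f -> unital_starhom g -> commuting f g ->
  exists h : DD -> T, [/\ unital_starhom h, forall d, h (i1 d) = f d
    & forall d, h (i2 d) = g d].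
Proof.
move=> hf hg fg; have hflip := half_flip mt hphi phiK psiK phi_i1.
have ct : cstar_tensor i1 i2 by case: mt.
have [[hi1 hi2] i12 _ dn] := ct.
have hpsi := hom_inv hphi phiK psiK.
have iso1 x : nr x <= nr (i1 x).
  rewrite -{1}[x]phiK; apply: (le_trans (nr_hom hpsi _)).
  exact: aue_nr (aue_sym phi_i1).
have iso2 x : nr x <= nr (i2 x).
  by apply: (le_trans (iso1 x)); apply: aue_nr (aue_sym hflip).
have [r [om [r1 om_lim]]] := exists_state sepD ct hflip.
pose lam := psi \o i1; pose mu := psi \o i2.
have hlam : unital_starhom lam := hom_comp hi1 hpsi.
have hmu : unital_starhom mu := hom_comp hi2 hpsi.
have [v [vv vlam]] : aue lam id.
  apply: aue_sym; have := aue_postcomp hpsi phi_i1.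
  by have -> : psi \o phi = id by apply/funext.
apply: (tensor_ext hi1 hi2 i12 dn hf hg fg) => s.
have lm : commuting (g \o lam) (g \o mu).
  by move=> a d; rewrite /= -!(homM hg) -!(homM hpsi) i12.
have b1 : nr (tensor_eval f (g \o lam) s) <= nr (tensor_eval i1 i2 s).
  apply: (tensor_bound ct hflip iso1 iso2 r1 om_lim hf (hom_comp hlam hg)
    (hom_comp hmu hg) _ _ lm).
  - by move=> a d; apply: fg.
  - by move=> a d; apply: fg.
apply: le_trans b1.
have lim : slim (fun n => g (v n) * tensor_eval f (g \o lam) s * star (g (v n)))
    (tensor_eval f g s).
  apply: (@slim_ext _ _ (fun n => \sum_(p <- s) f p.1 * g (v n * lam p.2 * star (v n)))) => [n|].
    rewrite /tensor_eval mulr_sumr mulr_suml; apply: eq_bigr => p _ /=.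
    by rewrite !(homM hg) (hom_star hg) !mulrA fg.
  by apply: slim_sum => p _; apply: slimMl; apply: hom_slim.
apply: (nr_slim_le lim) => n; rewrite nr_unitary_conj //.
exact: hom_unitary.
Qed.

End UniversalProperty.

(** * Strong asymptotic unitary equivalence *)

Section Absorbing.
Context {R : realType} {D DD : cstarAlgType R} {i1 i2 phi : D -> DD} {psi : DD -> D}.
Hypotheses (sepD : separable_space D) (K1D : K1_injective D) (mt : min_tensor i1 i2)
  (hphi : unital_starhom phi) (phiK : cancel phi psi) (psiK : cancel psi phi)
  (phi_i1 : aue phi i1).

Let lam := psi \o i1.
Let mu := psi \o i2.
Let hi1 : unital_starhom i1 := (let: conj (And4 (conj h _) _ _ _) _ := mt in h).
Let hi2 : unital_starhom i2 := (let: conj (And4 (conj _ h) _ _ _) _ := mt in h).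
Let i12 : commuting i1 i2 := (let: conj (And4 _ h _ _) _ := mt in h).
Let dn : dense (range (tensor_eval i1 i2)) := (let: conj (And4 _ _ _ h) _ := mt in h).
Let hpsi : unital_starhom psi := hom_inv hphi phiK psiK.
Let hlam : unital_starhom lam := hom_comp hi1 hpsi.
Let hmu : unital_starhom mu := hom_comp hi2 hpsi.

Lemma lam_id : aue lam id.
Proof.
apply: aue_sym; have := aue_postcomp hpsi phi_i1.
by have -> : psi \o phi = id by apply/funext.
Qed.

Lemma lam_mu : commuting lam mu.
Proof. by move=> a d; rewrite /lam /mu /= -!(homM hpsi) i12. Qed.

Let hflip : aue i1 i2 := half_flip mt hphi phiK psiK phi_i1.

(* If [u] implements the half flip, so does [u w^*] for w = 1 (x) psi u, which is
   unitarily equivalent to [u]; thus [u w^*] is close to a commutator. *)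
Lemma half_flip_uconn (F : seq D) (e : R) : 0 < e ->
  exists2 v : DD, uconn v & forall d, d \in F -> nr (v * i1 d * star v - i2 d) < e.
Proof.
move=> e0; have [u uu uF] := aue_finite F hflip e0.
have kap_id : aue (i2 \o psi) id.
  have mu_id : aue mu id.
    exact: aue_trans (aue_sym (aue_postcomp hpsi hflip)) lam_id.
  have := aue_precomp psi (aue_postcomp hphi mu_id).
  have -> : (phi \o id) \o psi = id by apply/funext => x /=.
  by have -> : (phi \o mu) \o psi = i2 \o psi by apply/funext => x /=; rewrite psiK.
pose w := i2 (psi u).
have uw : unitary w by apply: (hom_unitary hi2); apply: (hom_unitary hpsi).
have half0 : 0 < (2^-1 : R) by rewrite invr_gt0.
have [z uz] := aue_finite [:: u] kap_id half0 => /(_ u (mem_head _ _)) /= zu.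
exists (u * star w); last first.
  move=> d dF; apply: le_lt_trans (uF d dF).
  have wd : star w * i1 d = i1 d * star w by rewrite /w -(hom_star hi2) i12.
  rewrite star_mul starK !mulrA -(mulrA u) wd !mulrA -(mulrA _ (star w)).
  by case: uw => -> _; rewrite mulr1.
(* K_1-injectivity concerns [D]: the unitary is moved there by [psi], and the path found is brought
   back by [phi]. *)
have -> : u * star w = phi (psi (u * star w)) by rewrite psiK.
apply: (uconn_hom hphi); rewrite (homM hpsi) (hom_star hpsi).
set x := psi u; set y := psi w; pose a := star (psi z).
have ux : unitary x := hom_unitary hpsi uu.
have uy : unitary y := hom_unitary hpsi uw.
have ua : unitary a := unitary_star (hom_unitary hpsi uz).
apply: (uconn_close (commutator_uconn K1D ux ua)).
  by apply: unitaryM => //; apply: unitary_star.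
have -> : x * star y - x * a * star x * star a
    = x * star (y - a * x * star a).
  by rewrite starB !star_mul starK; ncring.
rewrite nr_unitaryl // nr_star nrB (unitary_swapV _ _ ua) /a starK.
have := nr_hom hpsi (z * w * star z - u).
rewrite (homB hpsi) !(homM hpsi) (hom_star hpsi) -/x -/y => H.
by apply: (le_trans H); apply: ltW.
Qed.

(** * Homomorphisms into an absorbing algebra *)

Section Target.
Context {B : cstarAlgType R} {lamB : B -> B} {muB : D -> B}.
Hypotheses (hlamB : unital_starhom lamB) (lamB_id : aue lamB id)
  (hmuB : unital_starhom muB) (lmB : commuting lamB muB).

Lemma universal_target (s : D -> B) : unital_starhom s ->
  exists h : DD -> B, [/\ unital_starhom h, forall d, h (i1 d) = lamB (s d)
    & forall d, h (i2 d) = muB d].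
Proof.
move=> hs; apply: (universal sepD mt hphi phiK psiK phi_i1 (f := lamB \o s)) => //.
- exact: hom_comp.
- by move=> a d; apply: lmB.
Qed.

Lemma conj_triangle (u v x y z : B) : unitary u ->
  nr (u * (v * x * star v) * star u - z)
    <= nr (v * x * star v - y) + nr (u * y * star u - z).
Proof.
move=> uu; apply: (le_trans (nr_triangle (u * y * star u) _ _)).
by rewrite -mulrBl -mulrBr nr_unitary_conj.
Qed.

(** Both [lamB \o s] and [lamB \o g] are carried to [muB] by unitaries joined to 1. The unitary [w]
    removing [lamB] may lie in another component, but it only conjugates [star v' * v]. Four
    approximations enter, each within [e / 4]. *)
Lemma uconn_equiv (s g : D -> B) (F : seq D) (e : R) :
  unital_starhom s -> unital_starhom g -> 0 < e ->
  exists2 v, uconn v & forall d, d \in F -> nr (v * s d * star v - g d) < e.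
Proof.
move=> hs hg e0; have e4 : 0 < e / 4 by rewrite divr_gt0.
have toMu (t : D -> B) : unital_starhom t -> exists2 v, uconn v &
    forall d, d \in F -> nr (v * lamB (t d) * star v - muB d) < e / 4.
  move=> /universal_target[h [hh h1 h2]].
  have [v cv vF] := half_flip_uconn F e4; exists (h v); first exact: uconn_hom cv.
  move=> d dF; rewrite -h1 -h2 -(hom_star hh) -!(homM hh) -(homB hh).
  exact: le_lt_trans (nr_hom hh _) (vF d dF).
have [v cv vF] := toMu s hs; have [v' cv' vF'] := toMu g hg.
have [w uw wF] := aue_finite (map s F ++ map g F) lamB_id e4.
have uv := uconn_unitary cv; have uv' := uconn_unitary cv'.
exists (w * (star v' * v) * star w).
  by apply: uconn_conj => //; apply: uconnM => //; apply: uconn_star.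
move=> d dF.
have a1 : nr (star w * s d * w - lamB (s d)) < e / 4.
  rewrite -unitary_swapV //; apply: wF; rewrite mem_cat map_f //.
have a2 : nr (w * lamB (g d) * star w - g d) < e / 4.
  by apply: wF; rewrite mem_cat (map_f g) ?orbT.
have a3 : nr (star v' * muB d * v' - lamB (g d)) < e / 4.
  by rewrite -unitary_swapV //; apply: vF'.
have a4 := vF d dF.
have uw' := unitary_star uw; have uv'' := unitary_star uv'.
have t1 := conj_triangle (u := v) (star w) (s d) (lamB (s d)) (muB d) uv.
have t2 := conj_triangle (u := star v') (v) (star w * s d * w) (muB d) (lamB (g d)) uv''.
have t3 := conj_triangle (u := w) (star v') (v * (star w * s d * w) * star v)
  (lamB (g d)) (g d) uw.
rewrite ?starK in t1 t2 t3.
have -> : w * (star v' * v) * star w * s d * star (w * (star v' * v) * star w)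
   = w * (star v' * (v * (star w * s d * w) * star v) * v') * star w.
  by rewrite !star_mul !starK !mulrA.
lra.
Qed.

(* A unitary [x] joined to 1 and almost commuting with g(D) is joined to 1 by
   the path U^* lam(x_t) U, U flipping lam g to mu, which commutes with lam(x_t). *)
Lemma homotopy (g : D -> B) (F : seq D) (e : R) : unital_starhom g -> 0 < e ->
  exists (G : seq D) (d : R), 0 < d /\ forall x, uconn x ->
    (forall a, a \in G -> nr (x * g a - g a * x) < d) ->
    pathin (fun y => unitary y /\ forall a, a \in F -> nr (y * g a - g a * y) < e) 1 x.
Proof.
move=> hg e0; have [h [hh h1 h2]] := universal_target hg.
pose M : R := \sum_(a <- F) nr a + 1.
have M1 : 1 <= M by rewrite lerDr; apply: sumr_ge0 => a _; apply: nr_ge0.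
have FM a : a \in F -> nr a <= M.
  move=> aF; rewrite /M (big_rem a) //= -addrA lerDl addr_ge0 //.
  by apply: sumr_ge0 => b _; apply: nr_ge0.
have M0 : 0 < M by apply: lt_le_trans M1.
(* [8^-1] keeps [f x] within [4 * t <= 2^-1] of [x], as [short_path] requires. On that short path
   the commutators are at most [4 * t + 16 * (t * M) <= 20 * (t * M)], half of what [e] allows. *)
pose t : R := Num.min (8^-1) (e / (40 * M)).
have M40 : 0 < 40 * M by rewrite mulr_gt0.
have t0 : 0 < t by rewrite lt_min invr_gt0 ltr0n divr_gt0.
have t8 : t <= 8^-1 by rewrite ge_min lexx.
have tM : 40 * (t * M) <= e.
  by rewrite mulrCA -ler_pdivlMr // ge_min lexx orbT.
have [u uu uF] := aue_finite F hflip t0.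
have [s su] := dense_approx u dn t0.
pose U := h u; have uU : unitary U := hom_unitary hh uu.
have UF a : a \in F -> nr (U * lamB (g a) * star U - muB a) < t.
  move=> aF; rewrite -h1 -h2 -(hom_star hh) -!(homM hh) -(homB hh).
  exact: le_lt_trans (nr_hom hh _) (uF a aF).
pose Q : R := \sum_(p <- s) nr p.2 + 1.
have Q0 : 0 < Q by rewrite ltr_wpDl // sumr_ge0 // => p _; apply: nr_ge0.
(* [lamB x] commutes with the range of [muB], so its commutator with the image of [s] only involves
   the first legs of [s], weighted by the norms of the second legs, which [Q] bounds. *)
exists (map fst s), (t / Q); split; first by rewrite divr_gt0.
move=> x cx xG; have ux := uconn_unitary cx.
have lx : nr (lamB x * U - U * lamB x) <= 3 * t.
  pose S := h (tensor_eval i1 i2 s).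
  have SU : nr (S - U) < t by rewrite -(homB hh); apply: le_lt_trans (nr_hom hh _) su.
  have lS : nr (lamB x * S - S * lamB x) <= t.
    have -> : lamB x * S - S * lamB x
        = \sum_(p <- s) lamB (x * g p.1 - g p.1 * x) * muB p.2.
      rewrite /S /tensor_eval (hom_sum hh) mulr_sumr mulr_suml -sumrB.
      apply: eq_bigr => p _; rewrite (homM hh) h1 h2 (homB hlamB) !(homM hlamB).
      by rewrite mulrBl -!mulrA -lmB.
    apply: (le_trans (nr_sum _ _)); apply: (@le_trans _ _ (\sum_(p <- s) t / Q * nr p.2)).
      rewrite big_seq [leRHS]big_seq; apply: ler_sum => p ps.
      apply: nrM_le; last exact: nr_hom.
      apply: (le_trans (nr_hom hlamB _)); apply: ltW; apply: xG.
      exact: (map_f fst).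
    rewrite -mulr_sumr mulrAC ler_pdivrMr // ler_wpM2l ?(ltW t0) //.
    by rewrite lerDl.
  have -> : lamB x * U - U * lamB x
    = (lamB x * S - S * lamB x) + ((S - U) * lamB x - lamB x * (S - U)) by ncring.
  have ulx := hom_unitary hlamB ux.
  have := nrD (lamB x * S - S * lamB x) ((S - U) * lamB x - lamB x * (S - U)).
  have := nrD ((S - U) * lamB x) (- (lamB x * (S - U))).
  rewrite nrN (nr_unitaryl _ ulx) (nr_unitaryr _ ulx); lra.
(* [w] depends on [x], which is harmless now that [G] and the tolerance are fixed. *)
have [w uw wF] := aue_finite (x :: map g F) lamB_id t0.
have wx := wF x (mem_head _ _).
have wg a : a \in F -> nr (w * lamB (g a) * star w - g a) < t.
  by move=> aF; apply: wF; rewrite inE (map_f g) ?orbT.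
pose W := w * star U; have uW : unitary W by apply: unitaryM => //; apply: unitary_star.
pose f y := W * lamB y * star W.
have commC (y a b : B) : unitary y -> nr (y * a - a * y) <= nr (y * b - b * y) + 2 * nr (a - b).
  move=> uy; have -> : y * a - a * y
    = (y * b - b * y) + (y * (a - b) - (a - b) * y) by ncring.
  apply: (le_trans (nrD _ _)); rewrite lerD2l.
  have := nrD (y * (a - b)) (- ((a - b) * y)).
  by rewrite nrN (nr_unitaryl _ uy) (nr_unitaryr _ uy); lra.
have fcomm y a : unitary y -> a \in F -> nr (f y * g a - g a * f y) <= 4 * t.
  move=> uy aF; have ufy : unitary (f y).
    by apply: unitaryM (unitary_star uW); apply: unitaryM => //; apply: hom_unitary.
  have := commC _ (g a) (W * muB a * star W) ufy.
  have -> : f y * (W * muB a * star W) - W * muB a * star W * f y = 0.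
    have W1 : star W * W = 1 by case: uW.
    have -> : f y * (W * muB a * star W) - W * muB a * star W * f y
      = W * lamB y * (star W * W) * muB a * star W
        - W * muB a * (star W * W) * lamB y * star W by rewrite /f; ncring.
    by rewrite W1 !mulr1 -!(mulrA W) lmB subrr.
  rewrite nr0 add0r => H; apply: (le_trans H).
  have e1 : nr (g a - W * muB a * star W) <= t + t.
    rewrite nrB; have -> : W * muB a * star W = w * (star U * muB a * U) * star w.
      by rewrite /W star_mul starK !mulrA.
    have H1 := conj_triangle (u := w) (star U) (muB a) (lamB (g a)) (g a) uw.
    rewrite starK in H1; apply: (le_trans H1); rewrite -unitary_swapV //.
    by apply: lerD; apply: ltW; [apply: UF | apply: wg].
  lra.
have fx : nr (f x - x) <= 4 * t.
  have H1 := conj_triangle (u := w) (star U) (lamB x) (lamB x) x uw.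
  have -> : f x = w * (star U * lamB x * star (star U)) * star w.
    by rewrite /f /W star_mul !mulrA.
  apply: (le_trans H1); rewrite unitary_swapV; last exact: unitary_star.
  rewrite starK unitary_swap // nrB; lra.
have ufx : unitary (f x).
  by apply: unitaryM (unitary_star uW); apply: unitaryM => //; apply: hom_unitary.
apply: (@pathin_trans _ _ _ _ (f x)).
  have f1 : f 1 = 1 by rewrite /f (hom1 hlamB) mulr1; case: uW.
  rewrite -{1}f1; apply: (@pathin_map _ _ _ f 1 _ _ _ _ _ _ cx).
    move=> y z; rewrite mul1r /f -mulrBl -mulrBr nr_unitary_conj // -(homB hlamB).
    exact: nr_hom.
  move=> y uy; split.
    by apply: unitaryM (unitary_star uW); apply: unitaryM => //; apply: hom_unitary.
  by move=> a aF; apply: (le_lt_trans (fcomm y a uy aF)); nra.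
have xf : nr (x - f x) <= 2^-1 by rewrite nrB; lra.
apply: pathin_weaken (short_path ufx ux xf) => y [uy yf]; split=> // a aF.
have -> : y * g a - g a * y = (f x * g a - g a * f x)
    + ((y - f x) * g a - g a * (y - f x)) by ncring.
have ga : nr (g a) <= M by apply: (le_trans (nr_hom hg _)); apply: FM.
have y8 : nr (y - f x) <= 8 * t by apply: (le_trans yf); rewrite nrB; lra.
have := nrD (f x * g a - g a * f x) ((y - f x) * g a - g a * (y - f x)).
have := nrD ((y - f x) * g a) (- (g a * (y - f x))); rewrite nrN.
have := nrM_le y8 ga; have := nrM_le ga y8; have := fcomm x a ux aF; nra.
Qed.

(** If [V n] and [V n.+1] both nearly carry [s] to [g], then [V n.+1 * star (V n)] nearly commutes
    with the range of [g]; its path from [homotopy], multiplied by [V n], keeps carrying [s] to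
    [g]. *)
Lemma asymp_equiv (s g : D -> B) : unital_starhom s -> unital_starhom g ->
  strong_asymp_unitary_equiv s g.
Proof.
move=> hs hg; have [q qd] := separable_seq sepD.
pose F n := [seq q i | i <- iota 0 n.+1]; pose e n : R := n.+1%:R^-1.
have e_gt0 n : 0 < e n by rewrite invr_gt0.
have /choice[Gd GdP] n : exists Gd : seq D * R, 0 < Gd.2 /\ forall x, uconn x ->
    (forall a, a \in Gd.1 -> nr (x * g a - g a * x) < Gd.2) ->
    pathin (fun y => unitary y /\ forall a, a \in F n -> nr (y * g a - g a * y) < e n) 1 x.
  by have [G [d H]] := homotopy (F n) hg (e_gt0 n); exists (G, d).
(* Step [n] uses the tolerance of [Gd n] for [V n] and for [V n.+1], so each [V n] must also meet
   that of its predecessor; at 0 the predecessor is 0 itself. *)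
pose tol n := Num.min (e n) (Num.min ((Gd n).2 / 2) ((Gd n.-1).2 / 2)).
have tol0 n : 0 < tol n.
  by rewrite !lt_min e_gt0 !divr_gt0 //; case: (GdP n); case: (GdP n.-1).
have /choice[V VP] n : exists v, uconn v /\
    forall d, d \in F n ++ (Gd n).1 ++ (Gd n.-1).1 -> nr (v * s d * star v - g d) < tol n.
  by have [v cv vF] := uconn_equiv (F n ++ (Gd n).1 ++ (Gd n.-1).1) hs hg (tol0 n); exists v.
have cV n : uconn (V n) by case: (VP n).
have uV n := uconn_unitary (cV n).
pose P n y := unitary y /\ forall d, d \in F n -> nr (y * s d * star y - g d) < 2 * e n.
have step n : pathin (P n) (V n) (V n.+1).
  pose x := V n.+1 * star (V n).
  have cx : uconn x by apply: uconnM => //; apply: uconn_star.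
  have [d0 /(_ x cx) H] := GdP n.
  have xG a : a \in (Gd n).1 -> nr (x * g a - g a * x) < (Gd n).2.
    move=> aG; rewrite -unitary_swap; last exact: uconn_unitary.
    have b1 : nr (star (V n) * g a * V n - s a) < (Gd n).2 / 2.
      rewrite -unitary_swapV //; case: (VP n) => _ /(_ a).
      rewrite !mem_cat aG orbT => /(_ isT); rewrite !lt_min => /and3P[] //.
    have b2 : nr (V n.+1 * s a * star (V n.+1) - g a) < (Gd n).2 / 2.
      case: (VP n.+1) => _ /(_ a); rewrite !mem_cat aG !orbT => /(_ isT).
      by rewrite !lt_min => /and3P[].
    have := conj_triangle (u := V n.+1) (star (V n)) (g a) (s a) (g a) (uV n.+1).
    rewrite starK /x star_mul starK !mulrA => H1; apply: (le_lt_trans H1).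
    by rewrite [X in _ < X]splitr; apply: ltrD.
  have VV : x * V n = V n.+1 by rewrite /x -mulrA; case: (uV n) => -> _; rewrite mulr1.
  rewrite -{1}[V n]mul1r -VV.
  apply: (@pathin_map _ _ _ (fun y => y * V n) 1 _ _ _ _ _ _ (H xG)).
    by move=> y z; rewrite -mulrBl nr_unitaryr // mul1r.
  move=> y [uy yF]; split; first exact: unitaryM.
  move=> a aF; rewrite star_mul !mulrA.
  have := conj_triangle (u := y) (V n) (s a) (g a) (g a) uy; rewrite !mulrA.
  have := yF a aF; rewrite -unitary_swap // => y1.
  have v1 : nr (V n * s a * star (V n) - g a) < e n.
    case: (VP n) => _ /(_ a); rewrite !mem_cat aF => /(_ isT).
    by rewrite !lt_min => /and3P[].
  move=> H1; apply: (le_lt_trans H1); rewrite mulrDl mul1r; exact: ltrD.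
(* A path from 1 to [V 0] is put in front so that [u 0 = 1]; the stages are thereby shifted by
   one. *)
have steps n : pathin (if n is m.+1 then P m else @unitary R B)
    (if n is m.+1 then V m else 1) (V n).
  by case: n => [|n]; [apply: cV | apply: step].
have [u [uc u0 uP]] := path_concat (V := fun n => if n is m.+1 then V m else 1) steps.
exists u; split.
- exact/continuous_subspaceT/ccont_continuous.
- by move=> t /uP[[|n] _]; [| case].
- exact: u0.
move=> d; apply/cvgrPdist_lt => eps eps0.
have er : eps = (complex.Re eps)%:C by rewrite RRe_real // gtr0_real.
have eps1 : 0 < complex.Re eps by rewrite -ltcR -er.
set r := complex.Re eps in er eps1.
have r4 : 0 < r / 4 by rewrite divr_gt0.
have [k kd] := qd d _ r4; pose N := maxn k (Num.bound (r / 4)^-1).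
(* With the shift, stage [n.+1] ends before [n.+2], so [t > N.+2] forces [N <= n]. *)
exists N.+2%:R; split=> [|t Nt]; first exact: num_real.
have t0 : 0 <= t by apply: le_trans (ltW Nt).
have [[|n] tn] := uP t t0; first by move: (lt_trans Nt tn); rewrite ltr_nat.
have Nn : (N <= n)%N by move: (lt_trans Nt tn); rewrite ltr_nat !ltnS => /ltnW.
case=> ut /(_ (q k)) => H.
have {}H : nr (u t * s (q k) * star (u t) - g (q k)) < 2 * e n.
  apply: H; apply: map_f; rewrite mem_iota add0n ltnS.
  by apply: leq_trans Nn; apply: leq_maxl.
have en : e n <= r / 4.
  rewrite /e invf_ple ?posrE //; apply: (le_trans (ltW (archi_boundP _))).
    by rewrite invr_ge0 ltW.
  by rewrite ler_nat (leq_trans _ (leqW Nn)) // leq_maxr.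
rewrite nrE er ltcR nrB.
have -> : u t * s d * star (u t) - g d = (u t * s (q k) * star (u t) - g (q k))
    - (u t * s (q k - d) * star (u t) - g (q k - d)).
  by rewrite (homB hs) (homB hg); ncring.
have n1 : nr (u t * s (q k - d) * star (u t)) < r / 4.
  by rewrite nr_unitary_conj //; apply: le_lt_trans (nr_hom hs _) kd.
have n2 : nr (g (q k - d)) < r / 4 by apply: le_lt_trans (nr_hom hg _) kd.
have := nrD (u t * s (q k) * star (u t) - g (q k))
  (- (u t * s (q k - d) * star (u t) - g (q k - d))).
have := nrD (u t * s (q k - d) * star (u t)) (- g (q k - d)).
rewrite !nrN; lra.
Qed.

End Target.

(** The endomorphism is [id (x) lam]. On the algebraic tensor product it is a pointwise limit of
    conjugations by [iD (u n)], which bounds it for any C*-norm and also makes it approximately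
    inner. *)
Lemma tensor_absorbing (A AD : cstarAlgType R) (iA : A -> AD) (iD : D -> AD) :
  cstar_tensor iA iD -> exists al : AD -> AD,
  [/\ unital_starhom al, aue al id & commuting al (iD \o mu)].
Proof.
case=> -[hA hD] AD_comm _ dnA; have [u [uu ul]] := aue_sym lam_id.
have lim s : slim (fun n => iD (u n) * tensor_eval iA iD s * star (iD (u n)))
    (tensor_eval iA (iD \o lam) s).
  apply: (@slim_ext _ _ (fun n => \sum_(p <- s) iA p.1 * iD (u n * p.2 * star (u n)))) => [n|].
    rewrite /tensor_eval mulr_sumr mulr_suml; apply: eq_bigr => p _.
    by rewrite !(homM hD) (hom_star hD) !mulrA AD_comm.
  by apply: slim_sum => p _; apply: slimMl; apply: hom_slim.
have [al [hal alA alD]] : exists al : AD -> AD, [/\ unital_starhom al,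
    forall a, al (iA a) = iA a & forall d, al (iD d) = iD (lam d)].
  apply: (tensor_ext hA hD AD_comm dnA hA (hom_comp hlam hD)) => [a d|s].
    exact: AD_comm.
  apply: (nr_slim_le (lim s)) => n; rewrite nr_unitary_conj //.
  exact: hom_unitary.
have al_eval s : al (tensor_eval iA iD s) = tensor_eval iA (iD \o lam) s.
  rewrite (hom_eval _ _ _ hal); apply: eq_bigr => p _ /=; by rewrite alA alD.
exists al; split=> //.
- apply: aue_sym; exists (iD \o u); split=> [n|x e e0] /=; first exact: hom_unitary.
  have e3 : 0 < e / 3 by rewrite divr_gt0.
  have [s sx] := dense_approx x dnA e3; have [N HN] := lim s _ e3.
  exists N => n /HN; rewrite -al_eval => H.
  have uDn : unitary (iD (u n)) by apply: hom_unitary.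
  have -> : iD (u n) * x * star (iD (u n)) - al x
      = (iD (u n) * tensor_eval iA iD s * star (iD (u n)) - al (tensor_eval iA iD s))
        - (iD (u n) * (tensor_eval iA iD s - x) * star (iD (u n))
           - al (tensor_eval iA iD s - x)).
    by rewrite (homB hal); ncring.
  set X := tensor_eval iA iD s in sx H *.
  have n1 : nr (iD (u n) * (X - x) * star (iD (u n))) < e / 3 by rewrite nr_unitary_conj.
  have n2 : nr (al (X - x)) < e / 3 by apply: le_lt_trans (nr_hom hal _) sx.
  have := nrD (iD (u n) * X * star (iD (u n)) - al X)
    (- (iD (u n) * (X - x) * star (iD (u n)) - al (X - x))).
  have := nrD (iD (u n) * (X - x) * star (iD (u n))) (- al (X - x)).
  rewrite !nrN; lra.
- move=> x d /=; have [s sx] := dense_slim x dnA.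
  apply: (slim_unique (slimMr (iD (mu d)) (hom_slim hal sx))).
  apply: slim_ext (slimMl (iD (mu d)) (hom_slim hal sx)) => n.
  rewrite al_eval /tensor_eval mulr_suml mulr_sumr; apply: eq_bigr => p _ /=.
  by rewrite mulrA -AD_comm -!mulrA -!(homM hD) lam_mu.
Qed.

Lemma endo_asymp_equiv (s g : D -> D) : unital_starhom s -> unital_starhom g ->
  strong_asymp_unitary_equiv s g.
Proof. exact: (asymp_equiv hlam lam_id hmu lam_mu). Qed.

Lemma tensor_asymp_equiv (A AD : cstarAlgType R) (iA : A -> AD) (iD : D -> AD) :
  cstar_tensor iA iD -> forall s g : D -> AD,
  unital_starhom s -> unital_starhom g -> strong_asymp_unitary_equiv s g.
Proof.
move=> ctA s g; have [al [hal al_id al_mu]] := tensor_absorbing ctA.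
have hD : unital_starhom iD by case: ctA => -[].
exact: (asymp_equiv hal al_id (hom_comp hmu hD) al_mu).
Qed.

End Absorbing.

Theorem theorem2p2 (R : realType) (D : cstarAlgType R)
    (D_separable : separable_space D)
    (D_ssa : strongly_self_absorbing D)
    (D_K1inj : K1_injective D) :
  (forall (A AD : cstarAlgType R) (iA : A -> AD) (iD : D -> AD),
     min_tensor iA iD ->
     forall sigma gamma : D -> AD,
       unital_starhom sigma -> unital_starhom gamma ->
       strong_asymp_unitary_equiv sigma gamma) /\
  (forall sigma gamma : D -> D,
     unital_starhom sigma -> unital_starhom gamma ->
     strong_asymp_unitary_equiv sigma gamma).
Proof.
case: D_ssa => _ _ [DD [i1 [i2 [phi [mt [hphi [psi phiK psiK]] /aueP phi_i1]]]]].
split; last exact: (endo_asymp_equiv D_separable D_K1inj mt hphi phiK psiK phi_i1).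
move=> A AD iA iD [ctA _].
exact: (tensor_asymp_equiv D_separable D_K1inj mt hphi phiK psiK phi_i1 ctA).
Qed.
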